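(* Let $(\omega_t,J_t)$ be a solution of symplectic curvature flow on $M^{2n}$, with associated metrics $g_t$. Then the norm of the Chern torsion tensor evolves by $$\left(\tfrac{\partial}{\partial t}-\Delta\right)|\tau|^2=|B|^2-2|\nabla\tau|^2-4g^{ap}g^{bq}g^{dr}\Omega_{rpq}^e\left(\tau_{edc}\tau_{abc}+\tau_{cde}\tau_{acb}+\tau_{ced}\tau_{acb}\right),$$ and in particular, when $\dim_{\mathbb C}M=2$, $$\left(\tfrac{\partial}{\partial t}-\Delta\right)|\tau|^2=-2|\nabla\tau|^2-4g^{dr}g^{ap}g^{bq}\Omega_{rpq}^e\left(\tau_{edc}\tau_{abc}+2\tau_{ced}\tau_{acb}\right).$$ Here the repeated lower index $c$ is contracted using $g^{-1}$.
   Context: Conventions. An almost Kähler manifold $(M^{2n},g,J,\omega)$ is a smooth manifold with Riemannian metric $g$, almost complex structure $J$ (with $J\partial_i=J_i^k\partial_k$), $g(JX,JY)=g(X,Y)$, and $\omega(X,Y):=g(JX,Y)$ closed, i.e. $\omega_{ij}=J_i^a g_{ja}$, $d\omega=0$. $\dim_{\mathbb C}M:=n$. Set $\omega^{ij}:=J^i_s g^{js}$, so that $\omega^{ac}\omega_{cb}=\delta^a_b$. Repeated indices are summed (with $g^{-1}$ if both are lower). Chern connection: $\nabla=\partial+\Upsilon$ is the unique connection with $\nabla\omega=0$, $\nabla J=0$ and torsion $\tau_{ij}^k:=\Upsilon_{ij}^k-\Upsilon_{ji}^k$ satisfying $\tau_{ij}^k=-J_i^aJ_j^b\tau_{ab}^k$.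 $\tau_{ijk}:=\tau_{ij}^l g_{lk}$. Its curvature $\Omega$ is defined by $[\nabla_a,\nabla_b]X^k=\Omega_{abd}^kX^d-\tau_{ab}^e\nabla_eX^k$, and $\Omega_{abcd}:=\Omega_{abc}^kg_{kd}$. $\Delta:=g^{ij}\nabla_i\nabla_j$. All norms are full tensor norms induced by $g$, e.g. $|\tau|^2=g^{ia}g^{jb}g^{kc}\tau_{ijk}\tau_{abc}$. $\mathrm{Rc}$ is the Ricci tensor of $g$; $D$ is the Levi-Civita connection. $P_{ab}:=\omega^{cd}\Omega_{abcd}$. For a 2-tensor $A$, $A^{2,0+0,2}_{ij}:=\tfrac12(A_{ij}-J_i^sJ_j^uA_{su})$. Also $$B:=\tfrac14B^1-\tfrac12B^2,\quad B^1_{ij}:=g^{kl}g_{mn}(D_iJ_k^m)(D_jJ_l^n),\quad B^2_{ij}:=g^{kl}g_{mn}(D_kJ_i^m)(D_lJ_j^n).$$ Symplectic curvature flow: one-parameter families of almost Kähler structures $(\omega_t,J_t)$ (with metric $g_t$) solving $$\left(\tfrac{\partial\omega}{\partial t}\right)_{ij}=-P_{ij},\qquad \left(\tfrac{\partial J}{\partial t}\right)_i^k=-\left(P^{2,0+0,2}_{iw}-2J_i^e\mathrm{Rc}^{2,0+0,2}_{ew}\right)g^{wk};$$ the resulting metric evolution is $\tfrac{\partial g}{\partial t}=-2\mathrm{Rc}+2B$. *)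

(* Defs.v *)
From mathcomp Require Import all_boot all_order all_algebra.
From mathcomp Require Import all_classical all_reals all_analysis.

Set Implicit Arguments.
Unset Strict Implicit.
Unset Printing Implicit Defensive.

Import Order.TTheory GRing.Theory Num.Theory.
Import numFieldNormedType.Exports.

Local Open Scope classical_set_scope.
Local Open Scope ring_scope.

(* C^oo on an open set U of a finite-dimensional space: every iterated
   directional derivative exists and is continuous at every point of U. *)
Definition smooth_on (R : realType) (V : normedModType R) (U : set V)
    (f : V -> R) : Prop :=
  forall (s : seq V) (x : V), U x ->
    let h := foldr (fun v u => 'D_v u) f s in
    {for x, continuous h} /\ forall v : V, derivable h x v.

Definition pd (R : realType) (m : nat) (i : 'I_m) (f : 'rV[R]_m -> R) :
  'rV[R]_m -> R := 'D_(delta_mx 0 i) f.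

(* The atlas need not be maximal; [chart_inv c] matters only on the image of
   the domain of c. *)
Record manifold (R : realType) (m : nat) := Manifold {
  carrier :> topologicalType;
  carrier_hausdorff : hausdorff_space carrier;
  carrier_second_countable : @second_countable carrier;
  chart : Type;
  chart_dom : chart -> set carrier;
  chart_map : chart -> carrier -> 'rV[R]_m;
  chart_inv : chart -> 'rV[R]_m -> carrier;
  chart_dom_open : forall c, open (chart_dom c);
  chart_img_open : forall c, open (chart_map c @` chart_dom c);
  chart_mapK : forall c p, chart_dom c p -> chart_inv c (chart_map c p) = p;
  chart_map_continuous : forall c,
    {within chart_dom c, continuous (chart_map c)};
  chart_inv_continuous : forall c,
    {within chart_map c @` chart_dom c, continuous (chart_inv c)};
  chart_cover : forall p, exists c, chart_dom c p;
  chart_smooth : forall c c' i,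
    smooth_on (chart_map c @` (chart_dom c `&` chart_dom c'))
      (fun x => chart_map c' (chart_inv c x) 0 i)
}.

(* Tensor calculus in the coordinates of one chart. Fields are given by their
   components; the lower indices of a component come first, the upper one (if
   any) last, so J i k is J_i^k and U i j k is U_ij^k, the k-th component of
   nabla_{d_i} d_j. *)
Section LocalCalculus.
Variables (R : realType) (m : nat).
Local Notation pt := 'rV[R]_m.
Local Notation fld1 := ('I_m -> pt -> R).
Local Notation fld2 := ('I_m -> 'I_m -> pt -> R).
Local Notation fld3 := ('I_m -> 'I_m -> 'I_m -> pt -> R).
Implicit Types (i j k l a b c d : 'I_m) (x : pt).

Definition ginv (g : fld2) i j x : R := invmx (\matrix_(a, b) g a b x) i j.

Definition kform (g J : fld2) i j x : R := \sum_a J i a x * g j a x.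

Definition kform_inv (g J : fld2) i j x : R := \sum_s J s i x * ginv g j s x.

Definition cov_fun (f : pt -> R) i x : R := pd i f x.

Definition cov_vec (U : fld3) (X : fld1) i k x : R :=
  pd i (X k) x + \sum_a U i a k x * X a x.

Definition cov_form1 (U : fld3) (A : fld1) i j x : R :=
  pd i (A j) x - \sum_a U i j a x * A a x.

Definition cov_form2 (U : fld3) (A : fld2) i j k x : R :=
  pd i (A j k) x - \sum_a U i j a x * A a k x - \sum_a U i k a x * A j a x.

Definition cov_form3 (U : fld3) (A : fld3) i j k l x : R :=
  pd i (A j k l) x - \sum_a U i j a x * A a k l x
    - \sum_a U i k a x * A j a l x - \sum_a U i l a x * A j k a x.

Definition cov_end (U : fld3) (A : fld2) i j k x : R :=
  pd i (A j k) x - \sum_a U i j a x * A a k x + \sum_a U i a k x * A j a x.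

Definition laplacian (g : fld2) (U : fld3) (f : pt -> R) x : R :=
  \sum_i \sum_j ginv g i j x * cov_form1 U (cov_fun f) i j x.

Definition torsion (U : fld3) i j k x : R := U i j k x - U j i k x.

(* [curvature U a b d k] is Omega_abd^k. It is read off from the identity
     [nabla_a, nabla_b] X^k = Omega_abd^k X^d - tau_ab^e nabla_e X^k
   at X = d_d; nabla_a nabla_b X^k is the second covariant derivative, i.e. the
   covariant derivative of the (1,1)-tensor nabla X. *)
Definition coord_vec d : fld1 := fun k _ => (k == d)%:R.

Definition cov2_vec (U : fld3) (X : fld1) a b k x : R :=
  cov_end U (cov_vec U X) a b k x.

Definition curvature (U : fld3) a b d k x : R :=
  cov2_vec U (coord_vec d) a b k x - cov2_vec U (coord_vec d) b a k x
    + \sum_e torsion U a b e x * cov_vec U (coord_vec d) e k x.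

Definition torsion_low (g : fld2) (U : fld3) i j k x : R :=
  \sum_l torsion U i j l x * g l k x.

Definition curvature_low (g : fld2) (U : fld3) a b c d x : R :=
  \sum_k curvature U a b c k x * g k d x.

Definition chern_P (g J : fld2) (U : fld3) a b x : R :=
  \sum_c \sum_d kform_inv g J c d x * curvature_low g U a b c d x.

(* For the Levi-Civita connection G; the contracted pair is the one that makes
   round spheres have positive Ricci curvature. *)
Definition ricci (G : fld3) b d x : R := \sum_a curvature G a b d a x.

Definition anti_inv (J A : fld2) i j x : R :=
  2^-1 * (A i j x - \sum_s \sum_u J i s x * J j u x * A s u x).

Definition tensorB1 (g J : fld2) (G : fld3) i j x : R :=
  \sum_k \sum_l \sum_p \sum_q
    ginv g k l x * g p q x * cov_end G J i k p x * cov_end G J j l q x.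

Definition tensorB2 (g J : fld2) (G : fld3) i j x : R :=
  \sum_k \sum_l \sum_p \sum_q
    ginv g k l x * g p q x * cov_end G J k i p x * cov_end G J l j q x.

Definition tensorB (g J : fld2) (G : fld3) i j x : R :=
  4^-1 * tensorB1 g J G i j x - 2^-1 * tensorB2 g J G i j x.

Definition sqnorm2 (g A : fld2) x : R :=
  \sum_i \sum_j \sum_a \sum_b
    ginv g i a x * ginv g j b x * A i j x * A a b x.

Definition sqnorm3 (g : fld2) (A : fld3) x : R :=
  \sum_i \sum_j \sum_k \sum_a \sum_b \sum_c
    ginv g i a x * ginv g j b x * ginv g k c x * A i j k x * A a b c x.

Definition sqnorm4 (g : fld2) (A : 'I_m -> fld3) x : R :=
  \sum_i \sum_j \sum_k \sum_l \sum_a \sum_b \sum_c \sum_d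
    ginv g i a x * ginv g j b x * ginv g k c x * ginv g l d x
      * A i j k l x * A a b c d x.

End LocalCalculus.

(* Fields on a manifold are given by their components in each chart, and are
   constrained only on the images of the charts. *)
Section GlobalFields.
Variables (R : realType) (m : nat) (M : manifold R m).
Local Notation pt := 'rV[R]_m.

Definition chart_img (c : chart M) : set pt := chart_map c @` chart_dom c.

Definition overlap (c c' : chart M) : set pt :=
  chart_map c @` (chart_dom c `&` chart_dom c').

Definition transition (c c' : chart M) (x : pt) : pt :=
  chart_map c' (chart_inv c x).

(* d x'^a / d x^i *)
Definition jac (c c' : chart M) (i a : 'I_m) : pt -> R :=
  pd i (fun x => transition c c' x 0 a).

Definition field2 := chart M -> 'I_m -> 'I_m -> pt -> R.
Definition field3 := chart M -> 'I_m -> 'I_m -> 'I_m -> pt -> R.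

Definition bilinear_form_field (A : field2) : Prop :=
  (forall c i j, smooth_on (chart_img c) (A c i j)) /\
  (forall c c' i j x, overlap c c' x ->
     A c i j x = \sum_a \sum_b
       jac c c' i a x * jac c c' j b x * A c' a b (transition c c' x)).

Definition endomorphism_field (A : field2) : Prop :=
  (forall c i k, smooth_on (chart_img c) (A c i k)) /\
  (forall c c' i b x, overlap c c' x ->
     \sum_k A c i k x * jac c c' k b x
     = \sum_a jac c c' i a x * A c' a b (transition c c' x)).

Definition affine_connection (U : field3) : Prop :=
  (forall c i j k, smooth_on (chart_img c) (U c i j k)) /\
  (forall c c' i j e x, overlap c c' x ->
     \sum_k U c i j k x * jac c c' k e x
     = pd i (jac c c' j e) x
       + \sum_a \sum_b
           jac c c' i a x * jac c c' j b x * U c' a b e (transition c c' x)).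

Definition riemannian_metric (g : field2) : Prop :=
  [/\ bilinear_form_field g,
      (forall c i j x, chart_img c x -> g c i j x = g c j i x) &
      (forall c x (v : 'rV[R]_m), chart_img c x -> v != 0 ->
         0 < \sum_i \sum_j g c i j x * v 0 i * v 0 j)].

Definition almost_complex (J : field2) : Prop :=
  endomorphism_field J /\
  (forall c i k x, chart_img c x ->
     \sum_a J c i a x * J c a k x = - (i == k)%:R).

Definition almost_kahler (g J : field2) : Prop :=
  [/\ riemannian_metric g,
      almost_complex J,
      (forall c i j x, chart_img c x ->
         \sum_a \sum_b J c i a x * J c j b x * g c a b x = g c i j x) &
      (forall c i j k x, chart_img c x ->
         let w := kform (g c) (J c) in
         pd i (w j k) x + pd j (w k i) x + pd k (w i j) x = 0)].

Definition levi_civita_connection (g : field2) (G : field3) : Prop :=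
  [/\ affine_connection G,
      (forall c i j k x, chart_img c x -> torsion (G c) i j k x = 0) &
      (forall c i j k x, chart_img c x -> cov_form2 (G c) (g c) i j k x = 0)].

Definition chern_connection (g J : field2) (U : field3) : Prop :=
  [/\ affine_connection U,
      (forall c i j k x, chart_img c x ->
         cov_form2 (U c) (kform (g c) (J c)) i j k x = 0),
      (forall c i j k x, chart_img c x -> cov_end (U c) (J c) i j k x = 0) &
      (forall c i j k x, chart_img c x ->
         torsion (U c) i j k x =
         - \sum_a \sum_b J c i a x * J c j b x * torsion (U c) a b k x)].

Definition smooth_family (T : set R) (A : R -> field2) : Prop :=
  forall c i j, smooth_on (V := (R * 'rV[R]_m)%type) (T `*` chart_img c)
    (fun z => A z.1 c i j z.2).

(* U t and G t are meant to be the Chern and the Levi-Civita connection of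
   (g t, J t). *)
Definition symplectic_curvature_flow (T : set R) (g J : R -> field2)
    (U G : R -> field3) : Prop :=
  [/\ smooth_family T g,
      smooth_family T J,
      (forall t, T t -> almost_kahler (g t) (J t)),
      (forall t c i j x, T t -> chart_img c x ->
         derive1 (fun s => kform (g s c) (J s c) i j x) t
         = - chern_P (g t c) (J t c) (U t c) i j x) &
      (forall t c i k x, T t -> chart_img c x ->
         derive1 (fun s => J s c i k x) t
         = - \sum_w
               (anti_inv (J t c) (chern_P (g t c) (J t c) (U t c)) i w x
                - 2 * \sum_e J t c i e x
                        * anti_inv (J t c) (ricci (G t c)) e w x)
               * ginv (g t c) w k x)].

End GlobalFields.

(* Main.v *)
From HB Require Import structures.
Require Import Defs.
From mathcomp Require Import all_boot all_order all_algebra.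
From mathcomp Require Import perm ring lra.
From mathcomp Require Import all_classical all_reals all_analysis.
Set Implicit Arguments.
Unset Strict Implicit.
Unset Printing Implicit Defensive.
Import Order.TTheory GRing.Theory Num.Theory.
Import numFieldNormedType.Exports.
Local Open Scope classical_set_scope.
Local Open Scope ring_scope.

(** Write tau for the Chern torsion with all indices lowered, h for the inverse
    metric and S_jk = h^pl (nabla_p tau)_ljk. Since omega is closed, tau has
    vanishing cyclic sum; it is J-anti-invariant in every pair of slots, and
    contracting an anti-invariant pair with an invariant one gives zero. By this
    principle the flow reduces to d/dt J_i^k = 4 S_il h^lp J_p^k.

    The engine is a contracted Bianchi identity: for every tensor V of the
    algebraic type of tau,
      V^ijk ((nabla_l tau)_ijk - 4 (nabla_i tau)_ljk
             - J_i^b J_l^a (nabla_a tau)_bjk) = 0,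
    the curvature terms cancelling between the Bianchi identity against V and the
    one against its J-twist. Differentiated once more, it trades nabla S, which
    governs d/dt |tau|^2, for the Laplacian of tau; what remains are commutators of
    covariant derivatives and quadratic torsion terms, which combine to |B|^2 and
    the curvature terms of the statement.

    In real dimension 4 an adapted orthonormal frame leaves four independent
    components of tau, and the quartic torsion terms cancel.

    The tensor algebra takes place over a commutative ring with commuting
    derivations; the geometry enters by taking for it the smooth functions on
    (time interval) x (chart image). *)

(** * A decision procedure for index expressions *)

(** The evolution of g and of the connection is never computed in full. |tau|^2 meets dg/dt only
    through the J-invariant tensors b1_ij = tau_aci tau_acj and b2_ij = tau_iac tau_jac, to which
    the part of dg/dt due to dJ/dt is orthogonal, and it meets the time derivative of the connection
    only contracted with tau, where differentiating nabla J = 0 in time determines it. What remains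
    is a balance of Ricci-type contractions of the Chern curvature with b1 and b2. There are three,
    according to the traced pair ([rY], [pY], [sY]); Bianchi expresses two of them by [rY] up to
    pairings of b1 and b2, and then [rY] drops out. The three curvature terms of the statement do
    not arise symmetrically, but the first of them, and the difference of the other two, are
    themselves quartic in tau ([TOT1_E], [TOT23_E]). These two identities equalise the coefficients
    and complete the square |b1 - 2 b2|^2 = |B|^2. For complex dimension 2 the second one is used
    once more, and |B|^2 cancels against the pairing of b1 and b2 that it costs. *)

Section IteratedSum.
Variables (A : comPzRingType) (I : finType).

Fixpoint sumk k (F : seq I -> A) : A :=
  if k is k'.+1 then \sum_i sumk k' (fun s => F (i :: s)) else F [::].

Lemma eq_sumk k F G : (forall s, size s = k -> F s = G s) -> sumk k F = sumk k G.
Proof.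
elim: k F G => [|k IH] F G H /=; first exact: H.
by apply: eq_bigr => i _; apply: IH => s sk; apply: H; rewrite /= sk.
Qed.

Lemma sumk_scale c l G : c * sumk l G = sumk l (fun s => c * G s).
Proof.
elim: l G => [|l IH] G //=.
by rewrite mulr_sumr; apply: eq_bigr => i _; rewrite IH.
Qed.

Lemma sumk_mul k l F G :
  sumk k F * sumk l G = sumk (k + l) (fun s => F (take k s) * G (drop k s)).
Proof.
elim: k F => [|k IH] F /=.
  by rewrite sumk_scale add0n; apply: eq_sumk => s _; rewrite take0 drop0.
by rewrite mulr_suml; apply: eq_bigr => i _; rewrite IH.
Qed.

Lemma sumk_tuple k F : sumk k F = \sum_(t : k.-tuple I) F t.
Proof.
elim: k F => [|k IH] F /=.
  rewrite (bigD1 [tuple]) //= big1 ?addr0 // => t /eqP [].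
  exact: tuple0.
under eq_bigr do rewrite IH.
rewrite pair_big /= (reindex (fun t : k.+1.-tuple I => (thead t, behead_tuple t))).
  by apply: eq_bigr => t _; rewrite [in RHS](tuple_eta t).
exists (fun p : I * k.-tuple I => cons_tuple p.1 p.2) => [t _|[i t] _] /=.
  by rewrite [RHS]tuple_eta; apply: val_inj.
by congr (_, _); apply: val_inj.
Qed.

(** Renaming of dummy indices: the index tuples are reindexed by the permutation p of positions,
    whose inverse q is read off from [index]. The element [i0] is a default for [nth]. *)
Lemma sumk_perm k F i0 (p : seq nat) : perm_eq p (iota 0 k) ->
  sumk k F = sumk k (fun s => F [seq nth i0 s j | j <- p]).
Proof.
move=> pk; have szp : size p = k by rewrite (perm_size pk) size_iota.
have pin j : (j < k)%N -> (nth 0%N p j < k)%N.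
  move=> jk; have: nth 0%N p j \in iota 0 k by rewrite -(perm_mem pk) mem_nth ?szp.
  by rewrite mem_iota.
pose q := [seq index j p | j <- iota 0 k].
have qE j : (j < k)%N -> nth 0%N q j = index j p.
  by move=> jk; rewrite (nth_map 0%N) ?size_iota // nth_iota.
have inp j : (j < k)%N -> j \in p by move=> jk; rewrite (perm_mem pk) mem_iota.
rewrite !sumk_tuple.
pose h (r : seq nat) (t : k.-tuple I) : k.-tuple I :=
  [tuple nth i0 t (nth 0%N r j) | j < k].
have hE r (t : k.-tuple I) j : (j < k)%N ->
    nth i0 (h r t) j = nth i0 t (nth 0%N r j).
  by move=> jk; rewrite -[j]/(val (Ordinal jk)) -tnth_nth tnth_mktuple.
have ih (r : seq nat) r' : (forall j, (j < k)%N -> (nth 0%N r j < k)%N /\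
     nth 0%N r' (nth 0%N r j) = j) -> cancel (h r') (h r).
  move=> H t; apply: eq_from_tnth => j; rewrite !(tnth_nth i0).
  by have [H1 H2] := H j (ltn_ord j); rewrite !hE // H2.
have up : uniq p by rewrite (perm_uniq pk) iota_uniq.
rewrite (reindex (h p)).
  apply: eq_bigr => t _; congr F; apply: (@eq_from_nth _ i0).
    by rewrite size_tuple size_map szp.
  move=> j; rewrite size_tuple => jk.
  by rewrite hE // (nth_map 0%N) ?szp.
exists (h q) => t _; apply: ih => j jk.
  by rewrite qE // nth_index ?inp //; split=> //; rewrite -[X in (_ < X)%N]szp index_mem inp.
by split; rewrite ?pin // qE ?pin // index_uniq ?szp.
Qed.

End IteratedSum.

(** * Syntax and normal form of index expressions *)

Inductive texpr :=
  | TInt of int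
  | TAtom of nat & seq nat
  | TAdd of texpr & texpr
  | TOpp of texpr
  | TMul of texpr & texpr
  | TSum of texpr
  | TDer of option nat & texpr.

(* A factor is an iterated derivative (outermost first) of an atom applied to
   index variables; variables are de Bruijn levels. *)
Definition factor := (seq (option nat) * nat * seq nat)%type.
(* integer coefficient, number of summed variables, factors *)
Definition monom := (int * nat * seq factor)%type.

Definition wf_factor N (f : factor) :=
  all (fun o : option nat => if o is Some v then (v < N)%N else true) f.1.1
  && all (fun v => v < N)%N f.2.

Definition ren_factor (r : nat -> nat) (f : factor) : factor :=
  ([seq omap r o | o <- f.1.1], f.1.2, [seq r v | v <- f.2]).

(** Levels below n are free and stay; the summed levels of the second factor of a product move past
    the k summed levels of the first, so that no capture occurs. *)
Definition shift_var n k v := if (v < n)%N then v else (v + k)%N.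

Definition mul_monom n (a b : monom) : monom :=
  (a.1.1 * b.1.1, (a.1.2 + b.1.2)%N,
   a.2 ++ [seq ren_factor (shift_var n a.1.2) f | f <- b.2]).

Fixpoint der_factors o (fs : seq factor) : seq (seq factor) :=
  if fs is f :: fs' then
    ((o :: f.1.1, f.1.2, f.2) :: fs') :: [seq f :: gs | gs <- der_factors o fs']
  else [::].

(** Levels make [TSum] free of renaming: its variable has level n, just below the summed variables
    in the monomials of the body, so only the count grows. *)
Fixpoint tnorm n (e : texpr) : seq monom :=
  match e with
  | TInt z => [:: (z, 0%N, [::])]
  | TAtom a l => [:: (1, 0%N, [:: ([::], a, l)])]
  | TAdd e1 e2 => tnorm n e1 ++ tnorm n e2
  | TOpp e => [seq (- a.1.1, a.1.2, a.2) | a <- tnorm n e]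
  | TMul e1 e2 => [seq mul_monom n a b | a <- tnorm n e1, b <- tnorm n e2]
  | TSum e => [seq (a.1.1, a.1.2.+1, a.2) | a <- tnorm n.+1 e]
  | TDer o e =>
      flatten [seq [seq (a.1, fs) | fs <- der_factors o a.2] | a <- tnorm n e]
  end.

Fixpoint wf_texpr n (e : texpr) : bool :=
  match e with
  | TInt _ => true
  | TAtom _ l => all (fun v => v < n)%N l
  | TAdd e1 e2 | TMul e1 e2 => wf_texpr n e1 && wf_texpr n e2
  | TOpp e => wf_texpr n e
  | TSum e => wf_texpr n.+1 e
  | TDer o e => (if o is Some v then (v < n)%N else true) && wf_texpr n e
  end.

Definition wf_monom n (a : monom) := all (wf_factor (n + a.1.2)) a.2.

(** * Comparison of monomials up to renaming of summed indices *)

Section Matching.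
(* [syms] lists the atoms that are symmetric in their two indices. *)
Variables (syms : seq nat) (n : nat).

Definition sym_factor (f : factor) : factor :=
  if (f.1.2 \in syms) && (size f.2 == 2) then (f.1, sort leq f.2) else f.

(** A pair (y, x) in [mp] sends the summed variable y of the second monomial to x in the first; the
    map stays injective, and a free variable matches only itself. *)
Definition unify_var (mp : seq (nat * nat)) x y : option (seq (nat * nat)) :=
  if (x < n)%N || (y < n)%N then if x == y then Some mp else None
  else if has (fun p => p.1 == y) mp then
         if (y, x) \in mp then Some mp else None
       else if has (fun p => p.2 == x) mp then None else Some ((y, x) :: mp).

Fixpoint unify_vars mp (s t : seq nat) : option (seq (nat * nat)) :=
  match s, t with
  | [::], [::] => Some mp
  | x :: s', y :: t' =>
      if unify_var mp x y is Some mp' then unify_vars mp' s' t' else None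
  | _, _ => None
  end.

Fixpoint unify_ders mp (s t : seq (option nat)) : option (seq (nat * nat)) :=
  match s, t with
  | [::], [::] => Some mp
  | None :: s', None :: t' => unify_ders mp s' t'
  | Some x :: s', Some y :: t' =>
      if unify_var mp x y is Some mp' then unify_ders mp' s' t' else None
  | _, _ => None
  end.

Definition unify_factor mp (f g : factor) : seq (seq (nat * nat)) :=
  if f.1.2 == g.1.2 then
    if unify_ders mp f.1.1 g.1.1 is Some mp' then
      pmap (unify_vars mp' f.2)
        (if f.1.2 \in syms then [:: g.2; rev g.2] else [:: g.2])
    else [::]
  else [::].

Definition known (mp : seq (nat * nat)) (f : factor) :=
  count (fun v => (v < n)%N || has (fun p => p.2 == v) mp) f.2.

(** The factor with the most indices already determined is matched next, which keeps the branching
    of the search low. *)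
Fixpoint pick_factor mp best (seen fs : seq factor) : factor * seq factor :=
  if fs is f :: fs' then
    if (known mp best < known mp f)%N then pick_factor mp f (best :: seen) fs'
    else pick_factor mp best (f :: seen) fs'
  else (best, seen).

(* Untrusted: [same_factors] checks the renaming that the search returns. *)
Fixpoint search_match fuel mp (fs gs : seq factor) : option (seq (nat * nat)) :=
  if fuel is fuel'.+1 then
    if fs is f0 :: fs0 then
      let: (f, fs') := pick_factor mp f0 [::] fs0 in
      (fix try seen rest :=
         if rest is g :: rest' then
           match (fix first mps := if mps is mp' :: mps' then
                    match search_match fuel' mp' fs' (seen ++ rest') with
                    | Some r => Some r
                    | None => first mps'
                    end else None) (unify_factor mp f g) with
           | Some r => Some r
           | None => try (g :: seen) rest'
           end
         else None) [::] gs
    else Some mp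
  else None.

Definition rename_var (mp : seq (nat * nat)) v :=
  if (v < n)%N then v else nth v [seq p.2 | p <- mp & p.1 == v] 0.

(** The checks force the renaming to permute the summed levels n, ..., n + k - 1 and compare the
    factors as multisets. The test [n <= _] guards against truncated subtraction, by which a summed
    variable sent to a free one would pass for level n. *)
Definition same_factors k (fs gs : seq factor) : bool :=
  (size fs == size gs) &&
  if search_match (size fs).+1 [::] fs gs is Some mp then
    perm_eq [seq (rename_var mp (n + j) - n)%N | j <- iota 0 k] (iota 0 k)
    && all (fun j => n <= rename_var mp (n + j))%N (iota 0 k)
    && perm_eq (map sym_factor fs)
         [seq sym_factor (ren_factor (rename_var mp) g) | g <- gs]
  else false.

Fixpoint insert_monom (a : monom) (s : seq monom) : seq monom :=
  if s is b :: s' then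
    if (a.1.2 == b.1.2) && same_factors a.1.2 b.2 a.2
    then (a.1.1 + b.1.1, b.1.2, b.2) :: s'
    else b :: insert_monom a s'
  else [:: a].

Definition tcheck (e : texpr) : bool :=
  wf_texpr n e && all (fun a : monom => a.1.1 == 0) (foldr insert_monom [::] (tnorm n e)).

End Matching.

(** * Soundness of the normal form *)

Section Denotation.
Variables (A : comPzRingType) (m : nat) (der : option 'I_m -> A -> A).
Hypothesis derD : forall o x y, der o (x + y) = der o x + der o y.
Hypothesis derM : forall o x y, der o (x * y) = der o x * y + x * der o y.
Variable atoms : seq (seq (option 'I_m) -> A).
Variable syms : seq nat.

(** A level out of range gives [None], and a derivative along it would turn into the time
    derivative; [wf_texpr] rules this out. *)
Definition look (env : seq 'I_m) v : option 'I_m := nth None [seq Some i | i <- env] v.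

Definition den_atom a (l : seq (option 'I_m)) : A := nth (fun=> 0) atoms a l.

Fixpoint tden env (e : texpr) : A :=
  match e with
  | TInt z => z%:~R
  | TAtom a l => den_atom a [seq look env v | v <- l]
  | TAdd e1 e2 => tden env e1 + tden env e2
  | TOpp e => - tden env e
  | TMul e1 e2 => tden env e1 * tden env e2
  | TSum e => \sum_i tden (rcons env i) e
  | TDer o e => der (obind (look env) o) (tden env e)
  end.

Definition den_factor env (f : factor) : A :=
  foldr (fun o => der (obind (look env) o)) (den_atom f.1.2 [seq look env v | v <- f.2])
    f.1.1.

Definition den_factors env (fs : seq factor) : A := \prod_(f <- fs) den_factor env f.

Definition den_monom env (a : monom) : A :=
  a.1.1%:~R * sumk a.1.2 (fun s => den_factors (env ++ s) a.2).

Definition den_monoms env (s : seq monom) : A := \sum_(a <- s) den_monom env a.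

Lemma der0 o : der o 0 = 0.
Proof. by apply: (@addrI _ (der o 0)); rewrite -derD !addr0. Qed.

Lemma derN o x : der o (- x) = - der o x.
Proof. by apply: (@addrI _ (der o x)); rewrite -derD !subrr der0. Qed.

Lemma der_sum o J (r : seq J) (P : pred J) (F : J -> A) :
  der o (\sum_(j <- r | P j) F j) = \sum_(j <- r | P j) der o (F j).
Proof. exact: (big_morph (der o) (derD o) (der0 o)). Qed.

Lemma derMz o z x : der o (z%:~R * x) = z%:~R * der o x.
Proof.
rewrite !mulrzl; case: z => k; rewrite -?pmulrn.
  by elim: k => [|k IH]; rewrite ?mulr0n ?der0 // !mulrS derD IH.
rewrite NegzE !mulrNz -!pmulrn derN; congr (- _).
by elim: k.+1 => [|j IH]; rewrite ?mulr0n ?der0 // !mulrS derD IH.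
Qed.

Lemma der_sumk o k (F : seq 'I_m -> A) : der o (sumk k F) = sumk k (fun s => der o (F s)).
Proof. by elim: k F => [|k IH] F //=; rewrite der_sum; apply: eq_bigr => i _. Qed.

Lemma look_catl env s v : (v < size env)%N -> look (env ++ s) v = look env v.
Proof. by move=> H; rewrite /look map_cat nth_cat size_map H. Qed.

Lemma eq_den_factor env env' r f N : wf_factor N f ->
  (forall v, (v < N)%N -> look env v = look env' (r v)) ->
  den_factor env f = den_factor env' (ren_factor r f).
Proof.
case: f => [[ds a] l] /andP[/= wd wl] H; rewrite /den_factor /=.
have -> : [seq look env' v | v <- [seq r v | v <- l]] = [seq look env v | v <- l].
  rewrite -map_comp; apply/eq_in_map => v vl /=.
  by rewrite H //; apply: (allP wl).
elim: ds wd => [|o ds IH] //= /andP[wo wd]; rewrite IH //.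
by case: o wo => //= v vN; rewrite H.
Qed.

Lemma eq_den_factors env env' r fs N : all (wf_factor N) fs ->
  (forall v, (v < N)%N -> look env v = look env' (r v)) ->
  den_factors env fs = den_factors env' [seq ren_factor r f | f <- fs].
Proof.
move=> wf H; rewrite /den_factors big_map; elim: fs wf => [|f fs IH] /=.
  by rewrite !big_nil.
by case/andP=> wf wfs; rewrite !big_cons IH // (eq_den_factor wf H).
Qed.

Lemma ren_factor_id f : ren_factor id f = f.
Proof.
case: f => [[ds a] l]; rewrite /ren_factor map_id; congr (_, _, _).
by rewrite -[RHS]map_id; apply: eq_map; case.
Qed.

Lemma den_mul env a b : wf_monom (size env) a -> wf_monom (size env) b ->
  den_monom env (mul_monom (size env) a b) = den_monom env a * den_monom env b.
Proof.
case: a b => [[c k] fs] [[d l] gs]; rewrite /wf_monom /den_monom /= => wa wb.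
rewrite intrM mulrACA sumk_mul; congr (_ * _); apply: eq_sumk => s sk.
rewrite /den_factors big_cat /=; congr (_ * _).
  have := @eq_den_factors (env ++ s) (env ++ take k s) id fs _ wa.
  rewrite /den_factors big_map => -> //; first by under eq_bigr do rewrite ren_factor_id.
  move=> v vl; rewrite -[in LHS](cat_take_drop k s) catA [LHS]look_catl //.
  by rewrite size_cat size_take sk; case: ifP => // /negbT; rewrite -leqNgt; case:
    (l) sk => [|l']; rewrite ?addn0 // addnS ltnNge leq_addr.
symmetry; apply: (eq_den_factors wb) => v vl.
rewrite /look /shift_var !map_cat !nth_cat !size_map.
case: ifP => vn; first by rewrite vn.
have -> : (v + k < size env)%N = false.
  by apply/negbTE; rewrite -leqNgt (leq_trans _ (leq_addr _ _)) // leqNgt vn.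
rewrite -addnBAC; last by rewrite leqNgt vn.
by rewrite map_drop nth_drop addnC.
Qed.

Lemma wf_ren N N' r f : wf_factor N f -> (forall v, v < N -> r v < N')%N ->
  wf_factor N' (ren_factor r f).
Proof.
case: f => [[ds a] l] /andP[/= wd wl] H; apply/andP; split=> /=; rewrite all_map.
  by apply: sub_all wd; case=> //= v; apply: H.
by apply: sub_all wl => v; apply: H.
Qed.

Lemma wf_factorW N N' f : (N <= N')%N -> wf_factor N f -> wf_factor N' f.
Proof.
move=> NN' H; rewrite -(ren_factor_id f); apply: wf_ren H _ => v vN.
exact: leq_trans NN'.
Qed.

Lemma wf_tnorm n e : wf_texpr n e -> all (wf_monom n) (tnorm n e).
Proof.
elim: e n => [z|a l|e1 IH1 e2 IH2|e IH|e1 IH1 e2 IH2|e IH|o e IH] n //=.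
- by move=> wl; rewrite /wf_monom /= addn0 /wf_factor /= wl.
- by case/andP=> /IH1 w1 /IH2 w2; rewrite all_cat w1.
- by move=> /IH w; rewrite all_map; apply: sub_all w => a.
- case/andP=> /IH1 /allP w1 /IH2 /allP w2; apply/allP => x /allpairsP[[a b] /= [/w1 wa /w2 wb ->]]
  {x}.
  move: wa wb; rewrite /wf_monom /= all_cat all_map => wa wb.
  rewrite addnA; apply/andP; split.
    by apply: sub_all wa => f; apply: wf_factorW; rewrite leq_addr.
  apply: sub_all wb => f wf /=; apply: wf_ren wf _ => v vl; rewrite /shift_var.
  case: ifP => vn; first by rewrite -addnA ltn_addr.
  by rewrite addnAC ltn_add2r.
- by move=> /IH w; rewrite all_map; apply: sub_all w => a; rewrite /wf_monom /= addSnnS.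
case/andP=> wo /IH /allP w; apply/allP => x /flattenP[y /mapP[a /w wa ->]] /mapP[fs fsin ->] {x y}.
move: wa fsin; rewrite /wf_monom /=.
elim: (a.2) fs => [|f gs IHf] fs //= /andP[wf wg]; rewrite inE => /orP[/eqP ->|].
  rewrite /= wg andbT; move: wf; rewrite /wf_factor /= => /andP[-> ->].
  by rewrite !andbT; case: (o) wo => // v vn; rewrite ltn_addr.
by case/mapP => hs /IHf {}IHf ->; rewrite /= wf IHf.
Qed.

Lemma den_tnorm env e : wf_texpr (size env) e ->
  tden env e = den_monoms env (tnorm (size env) e).
Proof.
rewrite /den_monoms.
elim: e env => [z|a l|e1 IH1 e2 IH2|e IH|e1 IH1 e2 IH2|e IH|o e IH] env //=.
- by rewrite big_seq1 /den_monom /= /den_factors big_nil mulr1.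
- by rewrite big_seq1 /den_monom /= /den_factors big_seq1 cats0 mulr1z mul1r.
- by case/andP=> w1 w2; rewrite IH1 // IH2 // big_cat.
- move=> w; rewrite IH // big_map -sumrN; apply: eq_bigr => a _.
  by rewrite /den_monom /= intrN mulNr.
- case/andP=> w1 w2; rewrite IH1 // IH2 // big_allpairs_dep /= mulr_suml.
  have /allP W1 := wf_tnorm w1; have /allP W2 := wf_tnorm w2.
  rewrite big_seq [in RHS]big_seq; apply: eq_bigr => a /W1 wa; rewrite mulr_sumr.
  by rewrite big_seq [in RHS]big_seq; apply: eq_bigr => b /W2 wb; rewrite den_mul.
- move=> w; rewrite big_map.
  under eq_bigr => i _ do rewrite IH ?size_rcons //.
  rewrite exchange_big; apply: eq_bigr => a _.
  rewrite /den_monom /= mulr_sumr; apply: eq_bigr => i _; congr (_ * _).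
  by apply: eq_sumk => s _; rewrite cat_rcons.
case/andP=> wo w; rewrite IH // der_sum big_flatten /= big_map.
apply: eq_bigr => a _; rewrite big_map /den_monom /= derMz -mulr_sumr; congr (_ * _).
rewrite der_sumk.
transitivity (sumk a.1.2 (fun s => \sum_(fs <- der_factors o a.2) den_factors (env ++ s) fs)).
  apply: eq_sumk => s _.
  have -> : obind (look env) o = obind (look (env ++ s)) o.
    by case: (o) wo => //= v vn; rewrite look_catl.
  rewrite /den_factors; elim: (a.2) => [|f fs IHf] /=.
    (* The empty product is 1, whose derivative vanishes by the Leibniz rule for 1 = 1 * 1. *)
    rewrite !big_nil; apply: (@addrI _ (der (obind (look (env ++ s)) o) 1)).
    by rewrite addr0 -{3}[1]mulr1 derM mulr1 mul1r.
  rewrite !big_cons derM IHf; congr (_ + _).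
  by rewrite big_map mulr_sumr; apply: eq_bigr => gs _; rewrite big_cons.
elim: (a.1.2) (der_factors o a.2) env {IH wo w} => [|k IHk] r env //=.
under [RHS]eq_bigr => fs _ do under eq_bigr => i _ do
  under eq_sumk => s _ do rewrite -cat_rcons.
rewrite exchange_big; apply: eq_bigr => i _.
by under eq_sumk => s _ do under eq_bigr => fs _ do rewrite -cat_rcons.
Qed.

Hypothesis symsP : forall a, a \in syms ->
  forall x y, den_atom a [:: x; y] = den_atom a [:: y; x].

Lemma den_sym env f : den_factor env (sym_factor syms f) = den_factor env f.
Proof.
rewrite /sym_factor; case: ifP => // /andP[]; case: f => [[ds a] l] /= asym.
case: l => [|x [|y [|]]] //= _; rewrite /den_factor /=.
rewrite /sort /=; case: ifP => //= _; by rewrite symsP.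
Qed.

Lemma den_factors_sym env fs :
  den_factors env (map (sym_factor syms) fs) = den_factors env fs.
Proof. by rewrite /den_factors big_map; apply: eq_bigr => f _; rewrite den_sym. Qed.

Lemma same_factorsP env k fs gs : all (wf_factor (size env + k)) gs ->
  same_factors syms (size env) k fs gs ->
  sumk k (fun s => den_factors (env ++ s) fs) =
  sumk k (fun s => den_factors (env ++ s) gs).
Proof.
move=> wg /andP[_]; case: search_match => // mp /andP[/andP[pk up] pf].
have pfE s : den_factors (env ++ s) fs =
    den_factors (env ++ s) [seq ren_factor (rename_var (size env) mp) g | g <- gs].
  by rewrite -den_factors_sym -[RHS]den_factors_sym -map_comp; apply: perm_big.
case: (posnP k) => [k0|k_gt0].
  rewrite {k}k0 /= in wg pk up *; rewrite pfE.
  symmetry; rewrite addn0 in wg; apply: (eq_den_factors wg) => v vn.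
  by rewrite /rename_var cats0 vn.
(* [sumk_perm] needs a default index; if there is none, both sums are empty because k is
   positive. *)
case: (pickP (fun _ : 'I_m => true)) => [j0 _|e0]; last first.
  case: k k_gt0 {wg pk up} => // k _ /=.
  by rewrite !big1 // => i _; have := e0 i.
rewrite [RHS](sumk_perm _ j0 pk); apply: eq_sumk => s sk.
rewrite pfE; symmetry.
apply: (eq_den_factors wg) => v vl; rewrite /look !map_cat !nth_cat !size_map.
case: ifP => vn; first by rewrite /rename_var vn vn.
have vjE : (size env + (v - size env))%N = v by rewrite subnKC // leqNgt vn.
have jk : (v - size env < k)%N by rewrite -(ltn_add2l (size env)) vjE.
rewrite (nth_map j0) ?size_map ?size_iota // (nth_map 0%N) ?size_map ?size_iota //.
rewrite (nth_map 0%N) ?size_iota // nth_iota // add0n vjE.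
have /allP/(_ (v - size env)%N) := up; rewrite mem_iota /= => /(_ jk); rewrite vjE.
rewrite /rename_var vn => ge; rewrite ltnNge ge /=.
rewrite (nth_map j0) // sk.
have: (rename_var (size env) mp v - size env)%N \in iota 0 k.
  by rewrite -(perm_mem pk); apply/mapP; exists (v - size env)%N; rewrite ?vjE // mem_iota.
by rewrite mem_iota /rename_var vn.
Qed.

Lemma den_insert env a s : wf_monom (size env) a ->
  den_monoms env (insert_monom syms (size env) a s) = den_monom env a + den_monoms env s.
Proof.
rewrite /den_monoms => wa; elim: s => [|b s IH] /=.
  by rewrite big_seq1 big_nil addr0.
case: ifP => [/andP[/eqP kE sf]|_]; rewrite !big_cons; last by rewrite IH addrCA.
rewrite addrA; congr (_ + _); rewrite /den_monom /= intrD mulrDl -kE.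
by congr (_ * _ + _); apply: same_factorsP.
Qed.

Lemma tcheckP env e : tcheck syms (size env) e -> tden env e = 0.
Proof.
case/andP=> w /allP c0; rewrite den_tnorm //.
have -> : den_monoms env (tnorm (size env) e) =
          den_monoms env (foldr (insert_monom syms (size env)) [::] (tnorm (size env) e)).
  have := wf_tnorm w; elim: (tnorm _ e) => [|a s IH] //= /andP[wa ws].
  by rewrite den_insert // -IH // /den_monoms big_cons.
rewrite /den_monoms big_seq big1 // => a /c0 /eqP; rewrite /den_monom => ->.
by rewrite mul0r.
Qed.

End Denotation.

Section Lifts.
Variables (A : comPzRingType) (m : nat).
Local Notation I := 'I_m.
Local Notation args := (seq (option I)).
Definition lift0 (x : A) (s : args) : A := x.
Definition lift1 (f : I -> A) (s : args) : A :=
  if s is [:: Some a] then f a else 0.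
Definition lift2 (f : I -> I -> A) (s : args) : A :=
  if s is [:: Some a; Some b] then f a b else 0.
Definition lift3 (f : I -> I -> I -> A) (s : args) : A :=
  if s is [:: Some a; Some b; Some c] then f a b c else 0.
Definition lift4 (f : I -> I -> I -> I -> A) (s : args) : A :=
  if s is [:: Some a; Some b; Some c; Some d] then f a b c d else 0.
Definition lift5 (f : I -> I -> I -> I -> I -> A) (s : args) : A :=
  if s is [:: Some a; Some b; Some c; Some d; Some e] then f a b c d e else 0.

Lemma lift2_sym (f : I -> I -> A) : (forall i j, f i j = f j i) ->
  forall x y, lift2 f [:: x; y] = lift2 f [:: y; x].
Proof. by move=> H [i|] [j|] //=. Qed.

Fixpoint syms_ok (atoms : seq (args -> A)) (syms : seq nat) : Prop :=
  if syms is a :: syms' then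
    (forall x y, nth (fun=> 0) atoms a [:: x; y] = nth (fun=> 0) atoms a [:: y; x])
    /\ syms_ok atoms syms'
  else True.

Lemma tensor_eq0 (der : option I -> A -> A) atoms syms env e (a b : A) :
  (forall o x y, der o (x + y) = der o x + der o y) ->
  (forall o x y, der o (x * y) = der o x * y + x * der o y) ->
  syms_ok atoms syms ->
  tden der atoms env e = a - b -> tcheck syms (size env) e -> a = b.
Proof.
move=> derD derM ok E /(tcheckP derD derM) e0; apply/subr0_eq; rewrite -E e0 //.
by elim: syms ok {e0} => //= s l IH [sP /IH H] x; rewrite inE => /orP[/eqP ->|/H].
Qed.

End Lifts.

(** * Reification *)

Ltac tr_length l :=
  match l with _ :: ?l' => let k := tr_length l' in constr:(S k) | _ => constr:(O) end.

Ltac tr_level env v :=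
  match env with
  | v :: ?e => tr_length e
  | _ :: ?e => tr_level e v
  end.

Ltac tr_position x l :=
  match l with
  | x :: _ => constr:(O)
  | _ :: ?l' => let k := tr_position x l' in constr:(S k)
  end.

Ltac tr_add x l :=
  match l with
  | context [x :: _] => l
  | _ => constr:(x :: l)
  end.

(** The arguments of an atom are its trailing arguments, up to five, that are index variables;
    whatever precedes them, section parameters included, belongs to the head. *)
Ltac tr_split der env t :=
  match t with
  | ?f ?a ?b ?c ?d ?e =>
      let la := tr_level env a in let lb := tr_level env b in
      let lc := tr_level env c in let ld := tr_level env d in
      let le := tr_level env e in
      constr:((lift5 f, [:: la; lb; lc; ld; le]))
  | ?f ?a ?b ?c ?d =>
      let la := tr_level env a in let lb := tr_level env b in
      let lc := tr_level env c in let ld := tr_level env d in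
      constr:((lift4 f, [:: la; lb; lc; ld]))
  | ?f ?a ?b ?c =>
      let la := tr_level env a in let lb := tr_level env b in
      let lc := tr_level env c in
      constr:((lift3 f, [:: la; lb; lc]))
  | ?f ?a ?b =>
      let la := tr_level env a in let lb := tr_level env b in
      constr:((lift2 f, [:: la; lb]))
  | ?f ?a => let la := tr_level env a in constr:((lift1 f, [:: la]))
  | _ => match type of der with
         | option (ordinal ?m) -> _ => constr:((@lift0 _ m t, @nil nat))
         end
  end.

Ltac tr_under env F tac :=
  let x := fresh "tx" in
  match type of F with
  | ?I -> _ =>
    let r := constr:(fun x : I => ltac:(
      let b := eval cbv beta in (F x) in
      let r := tac constr:(x :: env) b in exact r)) in
    match r with fun _ => ?l => l end
  end.

Ltac tr_atoms der acc env t :=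
  match t with
  | @GRing.add _ ?x ?y => let acc := tr_atoms der acc env x in tr_atoms der acc env y
  | @GRing.mul _ ?x ?y => let acc := tr_atoms der acc env x in tr_atoms der acc env y
  | @GRing.opp _ ?x => tr_atoms der acc env x
  | @GRing.zero _ => acc
  | @GRing.one _ => acc
  | @GRing.natmul _ ?x _ => tr_atoms der acc env x
  | der None ?x => tr_atoms der acc env x
  | der (Some _) ?x => tr_atoms der acc env x
  | @bigop _ _ _ _ (fun i => BigBody i _ true (@?F i)) =>
      tr_under env F ltac:(fun env b => tr_atoms der acc env b)
  | _ => match tr_split der env t with (?c, _) => tr_add c acc end
  end.

Ltac tr_reify der atoms env t :=
  match t with
  | @GRing.add _ ?x ?y =>
      let a := tr_reify der atoms env x in let b := tr_reify der atoms env y in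
      constr:(TAdd a b)
  | @GRing.mul _ ?x ?y =>
      let a := tr_reify der atoms env x in let b := tr_reify der atoms env y in
      constr:(TMul a b)
  | @GRing.opp _ ?x => let a := tr_reify der atoms env x in constr:(TOpp a)
  | @GRing.zero _ => constr:(TInt (Posz O))
  | @GRing.one _ => constr:(TInt (Posz 1))
  | @GRing.natmul _ (@GRing.one _) ?n => constr:(TInt (Posz n))
  | der None ?x => let a := tr_reify der atoms env x in constr:(TDer None a)
  | der (Some ?i) ?x =>
      let l := tr_level env i in
      let a := tr_reify der atoms env x in constr:(TDer (Some l) a)
  | @bigop _ _ _ _ (fun i => BigBody i _ true (@?F i)) =>
      let r := tr_under env F ltac:(fun env b => tr_reify der atoms env b) in
      constr:(TSum r)
  | _ =>
    match tr_split der env t with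
    | (?c, ?l) => let p := tr_position c atoms in constr:(TAtom p l)
    end
  end.

Ltac tr_env I acc :=
  match goal with
  | i : I |- _ =>
      lazymatch acc with context [i :: _] => fail | _ => tr_env I constr:(i :: acc) end
  | _ => acc
  end.

Ltac tr_syms symcl atoms k :=
  match atoms with
  | @nil _ => constr:(@nil nat)
  | ?c :: ?l =>
    let r := tr_syms symcl l constr:(S k) in
    match symcl with
    | context [c :: _] => constr:(k :: r)
    | _ => r
    end
  end.

(* [symcl] lists the symmetric atoms and [symtac] proves their symmetry. *)
Ltac tring_with der derD derM symcl symtac :=
  match type of der with
  | option ?I -> ?A -> ?A =>
    let env := tr_env I constr:(@nil I) in
    match goal with
    | |- ?a = ?b =>
      let t := eval cbv beta in (a - b) in
      let atoms := tr_atoms der constr:(@nil (seq (option I) -> A)) env t in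
      let syms := tr_syms symcl atoms constr:(O) in
      let e := tr_reify der atoms env t in
      let renv := eval cbv in (rev env) in
      refine (@tensor_eq0 _ _ der atoms syms renv e a b derD derM _ _ _);
      [ cbn [syms_ok nth]; repeat split; apply: lift2_sym; symtac
      | reflexivity
      | vm_compute; reflexivity]
    end
  end.

Section Combination.
Variables (A : comPzRingType).
Implicit Types a b c x y : A.

Lemma esum (I : finType) (F G : I -> A) : (forall i, F i = G i) -> \sum_i F i = \sum_i G i.
Proof. by move=> H; apply: eq_bigr. Qed.

Lemma emul c x y : x = y -> c * x = c * y. Proof. by move->. Qed.

Lemma eadd a b x y : a = b -> x = y -> a + x = b + y. Proof. by move-> => ->. Qed.

Lemma esub a b x y : a = b -> x = y -> a - x = b - y. Proof. by move-> => ->. Qed.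

(* [x = y] is a certificate, a combination of known identities: only the difference
   of its sides has to agree with that of the goal, which [tring] decides. *)
Lemma lin_comb a b x y : x = y -> a - b = x - y -> a = b.
Proof. by move=> -> /eqP; rewrite subrr subr_eq0 => /eqP. Qed.

End Combination.

Notation "\each i .. j , E" := (esum (fun i => .. (esum (fun j => E)) ..))
  (at level 200, i binder, j binder, right associativity).

(** * First-order identities *)

Section FirstOrder.
Variables (A : comPzRingType) (m : nat).
Local Notation I := 'I_m.
Hypothesis two_reg : forall x : A, 2 * x = 0 -> x = 0.

(** A placeholder for the tactic. Here [dg] and [dJ] are independent arrays, so that the section
    applies both to values at a point, where there is no derivation to use, and to the ring of
    smooth functions. *)
Definition zero_der (o : option I) (x : A) : A := 0.
Lemma zero_derD o x y : zero_der o (x + y) = zero_der o x + zero_der o y.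
Proof. by rewrite /zero_der addr0. Qed.
Lemma zero_derM o x y : zero_der o (x * y) = zero_der o x * y + x * zero_der o y.
Proof. by rewrite /zero_der mulr0 mul0r addr0. Qed.

Variables (g h J : I -> I -> A) (U G : I -> I -> I -> A).
Variables (dg dJ : I -> I -> I -> A).

Hypothesis gC : forall i j, g i j = g j i.
Hypothesis hC : forall i j, h i j = h j i.
Hypothesis hg : forall (X : I -> A) i, \sum_a \sum_b h i a * g a b * X b = X i.
Hypothesis JJ : forall (X : I -> A) i, \sum_a \sum_b J i a * J a b * X b = - X i.
Hypothesis JJt : forall (X : I -> A) i, \sum_a \sum_b J a b * J b i * X a = - X i.
Hypothesis dgC : forall i j k, dg i j k = dg i k j.
Hypothesis gJJ : forall i j, \sum_a \sum_b J i a * J j b * g a b = g i j.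

Ltac tring := tring_with zero_der zero_derD zero_derM [:: lift2 g; lift2 h]
  ltac:(first [exact: gC | exact: hC]).
Tactic Notation "tlc" uconstr(H) := refine (lin_comb H _); tring.

Lemma two_reg_inj (x y : A) : 2 * x = 2 * y -> x = y.
Proof. by move=> e; apply/subr0_eq/two_reg; rewrite mulrBr e subrr. Qed.

Lemma complex_skew i j : \sum_a J i a * g j a = - \sum_a J j a * g i a.
Proof.
have E1 := (\each b, emul (J i b) (gJJ b j)).
have E2 := JJ (fun b => \sum_c J j c * g b c) i.
tlc (esub E2 E1).
Qed.

Definition kf i j := \sum_a J i a * g j a.
Definition dkf i j k := \sum_a (dJ i j a * g k a + J j a * dg i k a).
Hypothesis Uw : forall i j k, dkf i j k = \sum_a U i j a * kf a k + \sum_a U i k a * kf j a.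
Hypothesis UJ : forall i j k, dJ i j k = \sum_a U i j a * J a k - \sum_a U i a k * J j a.

(** Up to sign g is omega with J inserted in one slot, and both omega and J are parallel. *)
Lemma chern_metric i j k : dg i j k = \sum_a U i j a * g a k + \sum_a U i k a * g j a.
Proof.
have E1 := (\each x, emul (J j x) (Uw i x k)).
have E2 := JJ (fun a => dg i k a) j.
have E3 := (\each x a, emul (J j x * g k a) (UJ i x a)).
have E5 := JJ (fun c => \sum_a U i c a * g k a) j.
have E6 := (\each a, emul (U i k a) (JJ (fun b => g a b) j)).
rewrite /dkf /kf in E1 *.
tlc (esub (eadd E2 (eadd E3 (dgC i j k))) (eadd E1 (eadd E5 E6))).
Qed.

Definition tor i j k := U i j k - U j i k.
Definition ltor i j k := \sum_l tor i j l * g l k.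
Hypothesis tJJ : forall i j k, tor i j k = - \sum_a \sum_b J i a * J j b * tor a b k.
Hypothesis dw0 : forall i j k, dkf i j k + dkf j k i + dkf k i j = 0.

Definition kftor i j k := \sum_l tor i j l * kf l k.

(** Since nabla omega = 0, the exterior derivative of omega is the cyclic sum of tau_ij^l
    omega_lk. *)
Lemma kftor_cyclic i j k : kftor i j k + kftor j k i + kftor k i j = 0.
Proof.
have E1 := dw0 i j k.
have E2 := eadd (Uw i j k) (eadd (Uw j k i) (Uw k i j)).
have E3 := eadd (\each a, emul (U i k a) (complex_skew j a)) (eadd (\each a, emul (U j i a)
  (complex_skew k a)) (\each a, emul (U k j a) (complex_skew i a))).
rewrite /kf in E2 E3.
by rewrite /kftor /tor /kf; tlc (esub E1 (eadd E2 E3)).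
Qed.

Lemma kftor_J12 i j k : \sum_a J i a * kftor a j k = \sum_a J j a * kftor i a k.
Proof.
have E1 := (\each a l, emul (J i a * kf l k) (tJJ a j l)).
have E2 := JJ (fun a => \sum_b \sum_l J j b * tor a b l * kf l k) i.
rewrite /kftor; tlc (esub E1 E2).
Qed.

Lemma kftor_JJ i j k : \sum_a \sum_b J i a * J j b * kftor a b k = - kftor i j k.
Proof.
have E1 := (\each l, emul (kf l k) (tJJ i j l)).
rewrite /kftor; tlc E1.
Qed.

Let kftorJ i j k := \sum_a \sum_b J i a * J k b * kftor a j b.

Lemma kftorJ_cyc i j k : kftorJ j k i + kftorJ k i j = kftor i j k.
Proof.
have E1 := (\each a b, emul (J i a * J j b) (kftor_cyclic a b k)).
have E2 := (\each b, emul (J j b) (kftor_J12 k i b)).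
rewrite /kftorJ; tlc (esub (eadd E1 E2) (kftor_JJ i j k)).
Qed.

(** This carries anti-invariance from the first two slots to the first and third. Adding
    [kftorJ_cyc] cyclically shows that twice the cyclic sum of [kftorJ] vanishes; dividing by 2 and
    subtracting [kftorJ_cyc] isolates a single term. *)
Lemma kftorJE i j k : kftorJ i j k = - kftor i j k.
Proof.
have E0 : kftorJ i j k + kftorJ j k i + kftorJ k i j = 0.
  apply: two_reg.
  tlc (eadd (kftorJ_cyc i j k) (eadd (kftorJ_cyc j k i) (eadd (kftorJ_cyc k i j)
    (kftor_cyclic i j k)))).
tlc (esub E0 (kftorJ_cyc i j k)).
Qed.

Lemma kftor_J13 i j k : \sum_a J i a * kftor a j k = \sum_a J k a * kftor i j a.
Proof.
have E1 := (\each b, emul (J k b) (kftorJE i j b)).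
have E2 := JJ (fun b => \sum_a J i a * kftor a j b) k.
rewrite /kftorJ in E1; tlc (esub E2 E1).
Qed.

(** Lowering with omega instead of g twists the third slot by J. As J may be moved between slots,
    the symmetries found for [kftor] pass on to [ltor]. *)
Lemma kftor_ltor i j k : kftor i j k = - \sum_a J k a * ltor i j a.
Proof.
have E := (\each l, emul (tor i j l) (complex_skew l k)).
by rewrite /kftor /kf /ltor; tlc E.
Qed.

Lemma ltor_kftor i j k : ltor i j k = \sum_a J k a * kftor i j a.
Proof.
have E1 := (\each a, emul (J k a) (kftor_ltor i j a)).
have E2 := JJ (ltor i j) k.
tlc (esub E2 E1).
Qed.

Lemma ltor_J12 i j k : \sum_a J i a * ltor a j k = \sum_a J j a * ltor i a k.
Proof.
have E1 := (\each a, emul (J i a) (ltor_kftor a j k)).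
have E2 := (\each a, emul (J j a) (ltor_kftor i a k)).
have E3 := (\each a, emul (J k a) (kftor_J12 i j a)).
tlc (eadd (esub E1 E2) E3).
Qed.

Lemma ltor_J13 i j k : \sum_a J i a * ltor a j k = \sum_a J k a * ltor i j a.
Proof.
have E1 := (\each a, emul (J i a) (ltor_kftor a j k)).
have E2 := (\each a, emul (J k a) (ltor_kftor i j a)).
have E3 := (\each a, emul (J k a) (kftor_J13 i j a)).
tlc (eadd (esub E1 E2) E3).
Qed.

Lemma ltor_J23 i j k : \sum_a J j a * ltor i a k = \sum_a J k a * ltor i j a.
Proof. by rewrite -ltor_J12 ltor_J13. Qed.

Lemma ltor_cyclic i j k : ltor i j k + ltor j k i + ltor k i j = 0.
Proof.
have E1 := eadd (ltor_kftor i j k) (eadd (ltor_kftor j k i) (ltor_kftor k i j)).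
have E2 := kftor_J13 i j k.
have E3 := esub (kftor_J13 k i j) (kftor_J12 k i j).
have E4 := (\each a, emul (J i a) (kftor_cyclic a j k)).
tlc (esub (eadd E1 E4) (eadd E2 E3)).
Qed.

Hypothesis GC : forall i j k, G i j k = G j i k.
Hypothesis Gg : forall i j k,
  dg i j k = \sum_a G i j a * g a k + \sum_a G i k a * g j a.

Lemma christoffel i j k :
  2 * G i j k = \sum_l h k l * (dg i j l + dg j i l - dg l i j).
Proof.
have E1 := (\each l, emul (h k l) (Gg i j l)).
have E2 := (\each l, emul (h k l) (Gg j i l)).
have E3 := (\each l, emul (h k l) (Gg l i j)).
have E4 := (\each l a, emul (h k l * g a l) (GC i j a)).
have E5 := hg (G i j) k.
have E6 := (\each l a, emul (h k l * g j a) (GC i l a)).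
have E7 := (\each l a, emul (h k l * g i a) (GC j l a)).
tlc (esub (eadd E3 E4) (eadd E1 (eadd E2 (eadd E6 (eadd E7 (emul 2 E5)))))).
Qed.

Definition contor i j k := \sum_a (U i j a - G i j a) * g a k.

(** Both connections are metric, so their difference is skew in the last two indices and 2
    contor_ijk = T_ijk - T_jki + T_kij with T = [ltor]; the vanishing cyclic sum reduces the right
    side to -2 T_jki. *)
Lemma contor_ltor i j k : contor i j k = ltor k j i.
Proof.
apply: two_reg_inj.
have K p q r := esub (Gg p q r) (chern_metric p q r).
have Cs p q r : contor p q r = - contor p r q by rewrite /contor; tlc (esub (Gg p q r)
  (chern_metric p q r)).
have Ct p q r : ltor p q r = contor p q r - contor q p r.
  by rewrite /contor /ltor /tor; tlc (\each a, emul (g a r) (GC p q a)).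
have TC : ltor j k i = - ltor k j i by rewrite /ltor /tor; tring.
tlc (esub (eadd (Ct j k i) (eadd (Cs j i k) (eadd (Cs i k j) (ltor_cyclic i j k))))
  (eadd (Ct i j k) (eadd (Ct k i j) (eadd (Cs k j i) (emul 2 TC))))).
Qed.

Lemma levi_chern i j k : G i j k = U i j k - \sum_l h k l * ltor l j i.
Proof.
have E1 := \each l, emul (h k l) (contor_ltor i j l).
have E2 := hg (fun a => U i j a - G i j a) k.
rewrite /contor in E1; tlc (esub E2 E1).
Qed.

Lemma complex_skew_inv i j : \sum_a h i a * J a j = - \sum_a h j a * J a i.
Proof.
tlc (esub (\each a b, emul (h i a * h j b) (complex_skew a b))
  (eadd (hg (fun p => \sum_a h i a * J a p) j) (hg (fun p => \sum_a h j a * J a p) i))).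
Qed.

Definition covJ i j k := dJ i j k - \sum_a G i j a * J a k + \sum_a G i a k * J j a.

(** Because nabla J = 0, D J consists of two contorsion terms; they agree by the anti-invariance of
    tau, whence the factor 2. *)
Lemma covJ_ltor i j k : covJ i j k = 2 * \sum_a \sum_l h a l * ltor l j i * J a k.
Proof.
rewrite /covJ.
have E1 := UJ i j k.
have E2 := \each a, emul (J a k) (levi_chern i j a).
have E3 := \each a, emul (J j a) (levi_chern i a k).
have E4 := \each l, emul (h k l) (ltor_J12 l j i).
have E5 := \each l, emul (ltor l j i) (complex_skew_inv k l).
tlc (eadd E1 (eadd (esub E3 E2) (esub E4 E5))).
Qed.

(** Applying J once more to [covJ_ltor] recovers the contorsion of [levi_chern] from D J. *)
Lemma chern_formula i j k : 2 * U i j k = 2 * G i j k - \sum_a covJ i j a * J a k.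
Proof.
have E1 := emul 2 (levi_chern i j k).
have E2 := \each a, emul (J a k) (covJ_ltor i j a).
have E3 := emul 2 (JJt (fun a => \sum_l h a l * ltor l j i) k).
tlc (eadd (esub E2 E1) E3).
Qed.
End FirstOrder.

(** * Curvature, commutators and the flow *)

Section Evolution.
Variables (A : comPzRingType) (m : nat).
Local Notation I := 'I_m.
(* [der None] is the time derivative, [der (Some i)] the i-th coordinate derivative;
   below, h is the inverse of g, U the Chern and G the Levi-Civita connection. *)
Variable der : option I -> A -> A.
Hypothesis derD : forall o x y, der o (x + y) = der o x + der o y.
Hypothesis derM : forall o x y, der o (x * y) = der o x * y + x * der o y.
Hypothesis derC : forall o p x, der o (der p x) = der p (der o x).
Hypothesis two_reg : forall x : A, 2 * x = 0 -> x = 0.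
Local Notation d i := (der (Some i)).

Variables (g h J : I -> I -> A) (U : I -> I -> I -> A).

Hypothesis gC : forall i j, g i j = g j i.
Hypothesis hC : forall i j, h i j = h j i.
Ltac tring := tring_with der derD derM [:: lift2 g; lift2 h] ltac:(first [exact: gC | exact: hC]).
Tactic Notation "tlc" uconstr(H) := refine (lin_comb H _); tring.
Hypothesis hg : forall (X : I -> A) i, \sum_a \sum_b h i a * g a b * X b = X i.
Hypothesis gh : forall (X : I -> A) i, \sum_a \sum_b g i a * h a b * X b = X i.
Hypothesis JJ : forall (X : I -> A) i, \sum_a \sum_b J i a * J a b * X b = - X i.
Hypothesis JJt : forall (X : I -> A) i, \sum_a \sum_b J a b * J b i * X a = - X i.
Hypothesis Jg : forall i j, \sum_a J i a * g j a = - \sum_a J j a * g i a.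
Hypothesis Ug : forall i j k,
  d i (g j k) = \sum_a U i j a * g a k + \sum_a U i k a * g j a.
Hypothesis UJ : forall i j k,
  d i (J j k) = \sum_a U i j a * J a k - \sum_a U i a k * J j a.

Local Notation t := (tor U).
Local Notation T := (ltor g U).

Hypothesis T12 : forall i j k, \sum_a J i a * T a j k = \sum_a J j a * T i a k.
Hypothesis T23 : forall i j k, \sum_a J j a * T i a k = \sum_a J k a * T i j a.
Hypothesis Tcyc : forall i j k, T i j k + T j k i + T k i j = 0.

Lemma TC i j k : T i j k = - T j i k.
Proof. by rewrite /ltor /tor; tring. Qed.

Hypothesis hJ : forall i j, \sum_a h i a * J a j = - \sum_a h j a * J a i.

Lemma Uh i j k : d i (h j k) = - \sum_a U i a j * h a k - \sum_a U i a k * h j a.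
Proof.
have E := congr1 (d i) (hg (fun b => h b k) j).
tlc (esub E (eadd (hg (fun b => d i (h b k)) j) (eadd (hg (fun b => d i (h b j)) k)
    (eadd (\each a b, emul (h j a * h b k) (Ug i a b))
    (eadd (hg (fun b => \sum_a U i a b * h a k) j) (hg (fun b => \sum_a U i a b * h a j) k)))))).
Qed.

Lemma T13 i j k : \sum_a J i a * T a j k = \sum_a J k a * T i j a.
Proof. by rewrite T12 T23. Qed.

(** * The covariant derivative of tau and its symmetries *)

Definition nabT a i j k := d a (T i j k) - \sum_e U a i e * T e j k
  - \sum_e U a j e * T i e k - \sum_e U a k e * T i j e.

Lemma dT a i j k : d a (T i j k) = nabT a i j k + \sum_e U a i e * T e j k
  + \sum_e U a j e * T i e k + \sum_e U a k e * T i j e.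
Proof. by rewrite /nabT; tring. Qed.

Lemma NC a i j k : nabT a i j k = - nabT a j i k.
Proof.
rewrite /nabT; have E := congr1 (d a) (TC i j k).
tlc (esub E (eadd (\each e, emul (U a i e) (TC e j k))
 (eadd (\each e, emul (U a j e) (TC i e k)) (\each e, emul (U a k e) (TC i j e))))).
Qed.

Lemma Ncyc a i j k : nabT a i j k + nabT a j k i + nabT a k i j = 0.
Proof.
rewrite /nabT; have E := congr1 (d a) (Tcyc i j k).
tlc (esub E (eadd (\each e, emul (U a i e) (Tcyc e j k))
 (eadd (\each e, emul (U a j e) (Tcyc i e k)) (\each e, emul (U a k e) (Tcyc i j e))))).
Qed.

Lemma N12 a i j k : \sum_e J i e * nabT a e j k = \sum_e J j e * nabT a i e k.
Proof.
rewrite /nabT; have E := congr1 (d a) (T12 i j k).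
tlc (esub E (eadd (esub (\each e, emul (T e j k) (UJ a i e))
                        (\each e, emul (T i e k) (UJ a j e)))
 (eadd (\each e, emul (U a i e) (T12 e j k))
 (eadd (\each e, emul (U a j e) (T12 i e k)) (\each e, emul (U a k e) (T12 i j e)))))).
Qed.

Lemma N23 a i j k : \sum_e J j e * nabT a i e k = \sum_e J k e * nabT a i j e.
Proof.
rewrite /nabT; have E := congr1 (d a) (T23 i j k).
tlc (esub E (eadd (esub (\each e, emul (T i e k) (UJ a j e))
                        (\each e, emul (T i j e) (UJ a k e)))
 (eadd (\each e, emul (U a i e) (T23 e j k))
 (eadd (\each e, emul (U a j e) (T23 i e k)) (\each e, emul (U a k e) (T23 i j e)))))).
Qed.

Lemma N13 a i j k : \sum_e J i e * nabT a e j k = \sum_e J k e * nabT a i j e.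
Proof. by rewrite N12 N23. Qed.

(** * Chern curvature, Bianchi identity and commutators *)

Definition Om a b c k := d a (U b c k) - d b (U a c k) + \sum_e U a e k * U b c e
  - \sum_e U b e k * U a c e.

Definition OmL a b c e := \sum_k Om a b c k * g k e.

Lemma OC a b c e : OmL a b c e = - OmL b a c e.
Proof. by rewrite /OmL /Om; tring. Qed.

(** Equality of mixed second derivatives of g, each expanded by nabla g = 0; [OJ_up] is the same
    argument for J. *)
Lemma OLC a b c e : OmL a b c e = - OmL a b e c.
Proof.
rewrite /OmL /Om.
have K := derC (Some a) (Some b) (g c e).
have Ea := congr1 (d a) (Ug b c e); have Eb := congr1 (d b) (Ug a c e).
have Fb := eadd (\each x, emul (U b c x) (Ug a x e)) (\each x, emul (U b e x) (Ug a c x)).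
have Fa := eadd (\each x, emul (U a c x) (Ug b x e)) (\each x, emul (U a e x) (Ug b c x)).
tlc (esub (eadd K (eadd Eb Fa)) (eadd Ea Fb)).
Qed.

Lemma OJ_up a b c k : \sum_p J c p * Om a b p k = \sum_p Om a b c p * J p k.
Proof.
rewrite /Om.
have K := derC (Some a) (Some b) (J c k).
have Ea := congr1 (d a) (UJ b c k); have Eb := congr1 (d b) (UJ a c k).
have Fb := esub (\each x, emul (U b c x) (UJ a x k)) (\each x, emul (U b x k) (UJ a c x)).
have Fa := esub (\each x, emul (U a c x) (UJ b x k)) (\each x, emul (U a x k) (UJ b c x)).
tlc (esub (eadd Ea Fb) (eadd K (eadd Eb Fa))).
Qed.

Lemma OJ a b c e : \sum_p J c p * OmL a b p e = - \sum_p J e p * OmL a b c p.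
Proof.
rewrite /OmL.
tlc (eadd (\each k, emul (g k e) (OJ_up a b c k)) (\each p, emul (Om a b c p) (Jg p e))).
Qed.

(** The first Bianchi identity of a connection with torsion; [Ug] enters through the derivative of
    the metric hidden in the lowered torsion. *)
Lemma bianchi a b c e : OmL a b c e + OmL b c a e + OmL c a b e =
  nabT a b c e + nabT b c a e + nabT c a b e
  + \sum_f (t a b f * T f c e + t b c f * T f a e + t c a f * T f b e).
Proof.
have E := eadd (\each l, emul (- t b c l) (Ug a l e))
  (eadd (\each l, emul (- t c a l) (Ug b l e)) (\each l, emul (- t a b l) (Ug c l e))).
by rewrite /OmL /Om /nabT /ltor /tor in E *; tlc E.
Qed.

Definition nabT2 a b i j k := d a (nabT b i j k) - \sum_e U a b e * nabT e i j k
  - \sum_e U a i e * nabT b e j k - \sum_e U a j e * nabT b i e k - \sum_e U a k e * nabT b i j e.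

Lemma ricci_id a b i j k : nabT2 a b i j k - nabT2 b a i j k =
  - \sum_e (Om a b i e * T e j k + Om a b j e * T i e k + Om a b k e * T i j e
            + t a b e * nabT e i j k).
Proof.
rewrite /nabT2 /nabT /Om /tor; tlc (derC (Some a) (Some b) (T i j k)).
Qed.

(** Inserting 1 = -J^2 in the contracted index and moving one J through V and the other through X
    shows that the contraction equals its negative. *)
Lemma contract_inv_anti (V X : I -> I -> A) :
  (forall i j, \sum_p V p j * J p i = \sum_p V i p * J p j) ->
  (forall i j, \sum_p J i p * X p j = - \sum_p J j p * X i p) ->
  \sum_i \sum_j V i j * X i j = 0.
Proof.
move=> VJ XJ; apply: two_reg.
have H1 := \each i j, emul (X i j) (JJt (fun a => V a j) i).
have H2 := \each i j b, emul (X i j * J b i) (VJ b j).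
have H3 := \each b p j, emul (V b p * J p j) (XJ b j).
have H4 := \each b p, emul (- V b p) (JJ (X b) p).
tlc (esub H1 (eadd H2 (eadd H3 H4))).
Qed.

Definition up3 (X : I -> I -> I -> A) i j k :=
  \sum_a \sum_b \sum_c h i a * h j b * h k c * X a b c.

(** In complex terms the type (3,0)+(0,3), for upper indices and with skewness in the first two. *)
Definition type30 (V : I -> I -> I -> A) :=
  [/\ forall i j k, V i j k = - V j i k,
      forall i j k, \sum_p V p j k * J p i = \sum_p V i p k * J p j
    & forall i j k, \sum_p V i p k * J p j = \sum_p V i j p * J p k].

Lemma up3_type X : (forall i j k, X i j k = - X j i k) ->
  (forall i j k, \sum_a J i a * X a j k = \sum_a J j a * X i a k) ->
  (forall i j k, \sum_a J j a * X i a k = \sum_a J k a * X i j a) -> type30 (up3 X).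
Proof.
move=> H1 H2 H3; rewrite /up3; split => i j k.
- tlc (\each a b c, emul (h i a * h j b * h k c) (H1 a b c)).
- have K1 := \each a b c, emul (h j b * h k c * X a b c) (hJ a i).
  have K2 := \each a b c, emul (h i a * h k c * X a b c) (hJ b j).
  have K3 := \each a b c, emul (- h i a * h j b * h k c) (H2 a b c).
  tlc (esub K1 (esub K2 K3)).
- have K1 := \each a b c, emul (h i a * h k c * X a b c) (hJ b j).
  have K2 := \each a b c, emul (h i a * h j b * X a b c) (hJ c k).
  have K3 := \each a b c, emul (- h i a * h j b * h k c) (H3 a b c).
  tlc (esub K1 (esub K2 K3)).
Qed.

Lemma TU_type : type30 (up3 T).
Proof. exact: (up3_type TC T12 T23). Qed.

Definition NU a := up3 (nabT a).

Lemma NU_type a : type30 (NU a).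
Proof. exact: (up3_type (NC a) (N12 a) (N23 a)). Qed.

Lemma tup i j k : t i j k = \sum_l h k l * T i j l.
Proof. by rewrite /ltor; tlc (esub (erefl 0) (hg (t i j) k)). Qed.

Lemma tJ2 i j k : \sum_p J j p * t i p k = - \sum_p t i j p * J p k.
Proof.
have E1 := \each p, emul (J j p) (tup i p k).
have E2 := \each p, emul (J p k) (tup i j p).
have E3 := \each l, emul (h k l) (T23 i j l).
have E4 := \each l, emul (T i j l) (hJ k l).
tlc (eadd E1 (eadd E2 (esub E3 (esub (erefl 0) E4)))).
Qed.

Lemma tC i j k : t i j k = - t j i k. Proof. by rewrite /tor; tring. Qed.

Lemma tJ1 i j k : \sum_p J i p * t p j k = - \sum_p t i j p * J p k.
Proof.
have E1 := \each p, emul (J i p) (tC p j k).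
have E2 := \each p, emul (J p k) (tC i j p).
tlc (eadd E1 (esub E2 (tJ2 j i k))).
Qed.

Lemma tJ12 i j k : \sum_p J i p * t p j k = \sum_p J j p * t i p k.
Proof. by rewrite tJ1 tJ2. Qed.

(** J passes through the contracted index, so a product of two anti-invariant factors is invariant
    in its free pair. Quadratic torsion terms therefore vanish against tensors anti-invariant in
    that pair. *)
Lemma quad_inv (P Q : I -> I -> A) :
  (forall j f, \sum_p J j p * P p f = - \sum_p P j p * J p f) ->
  (forall f k, \sum_p J f p * Q p k = \sum_p J k p * Q f p) ->
  forall j k, \sum_p J j p * (\sum_f P p f * Q f k) = - \sum_p J k p * (\sum_f P j f * Q f p).
Proof.
move=> HP HQ j k.
tlc (esub (\each f, emul (Q f k) (HP j f)) (\each f, emul (P j f) (HQ f k))).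
Qed.

Lemma type13 V : type30 V -> forall i j k, \sum_p V p j k * J p i = \sum_p V i j p * J p k.
Proof. by case=> _ H2 H3 i j k; rewrite H2 H3. Qed.

(** In the Bianchi identity on l, i, j two of the three curvature terms, and all quadratic terms,
    are J-invariant in a pair in which V is anti-invariant. Only the curvature term with l in third
    place survives. *)
Lemma bianchi_contr V l : type30 V ->
  \sum_i \sum_j \sum_k V i j k * OmL i j l k =
  \sum_i \sum_j \sum_k V i j k * (nabT l i j k - 2 * nabT i l j k).
Proof.
move=> VT; have [VC V12 V23] := VT; have V13 := type13 VT.
have Z1 := \each i, contract_inv_anti (V23 i) (fun j k => OJ l i j k).
have Z2 := \each j, contract_inv_anti (fun i k => V13 i j k) (fun i k => OJ j l i k).
have Q1 := \each k, contract_inv_anti (fun i j => V12 i j k)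
  (fun i j => quad_inv (tJ2 l) (fun f j => T12 f j k) i j).
have Q2 := \each i, contract_inv_anti (V23 i)
  (fun j k => quad_inv (tJ2 i) (fun f k => T13 f l k) j k).
have Q3 := \each k, contract_inv_anti (fun j i => esym (V12 i j k))
  (fun j i => quad_inv (fun j f => tJ1 j l f) (fun f i => T12 f i k) j i).
have B := \each i j k, emul (V i j k) (bianchi l i j k).
have C1 := \each i j k, emul (V i j k) (NC i j l k).
have C2 := \each i j k, emul (nabT j l i k) (VC i j k).
tlc (eadd (eadd (esub B (eadd Z1 Z2)) (eadd C1 C2)) (eadd Q1 (eadd Q2 Q3))).
Qed.

(* The contracted Bianchi identity against V and against its J-twist V'. *)
Lemma nabT_bianchi V l : type30 V ->
  \sum_i \sum_j \sum_k V i j k * (nabT l i j k - 4 * nabT i l j k)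
  - \sum_i \sum_j \sum_k \sum_a \sum_b V i j k * J i b * J l a * nabT a b j k = 0.
Proof.
move=> VT; have [VC V12 V23] := VT; have V13 := type13 VT.
pose V' i j k := \sum_b V b j k * J b i.
have V'T : type30 V'.
  rewrite /V'; split=> i j k.
  - have K1 := \each b, emul (J b i) (VC b j k).
    have K2 := V12 i j k.
    tlc (eadd (V12 i j k) (\each b, emul (J b j) (VC i b k))).
  - tlc (\each b, emul (J b i) (V12 b j k)).
  - tlc (\each b, emul (J b i) (V23 b j k)).
have B := bianchi_contr l VT.
have B' := \each a, emul (J l a) (bianchi_contr a V'T).
rewrite /V' in B'.
(* On the twisted side J moves through V and then meets its partner: the curvature term comes back
   unchanged ([L1] to [L3]), the term in [nabT i l j k] with the opposite sign ([R1] to [R3]). In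
   the difference the curvature cancels and -2 - 2 gives the coefficient -4. *)
have L1 := \each i j k a, emul (J l a * OmL i j a k) (V13 i j k).
have L2 := \each i j k b, emul (V i j b * J b k) (OJ i j l k).
have L3 := \each i j k, emul (V i j k) (JJ (fun a => OmL i j l a) k).
have R1 := \each i j k a, emul (J l a * nabT i a j k) (V12 i j k).
have R2 := \each i j k b, emul (V i b k * J b j) (N12 i l j k).
have R3 := \each i j k, emul (V i j k) (JJ (fun a => nabT i l a k) j).
tlc (esub (eadd B' L3) (eadd (eadd B (eadd L1 L2)) (emul 2 (eadd R1 (eadd R2 R3))))).
Qed.

Lemma dTU a i j k : d a (up3 T i j k) = NU a i j k - \sum_e U a e i * up3 T e j k
  - \sum_e U a e j * up3 T i e k - \sum_e U a e k * up3 T i j e.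
Proof.
rewrite /up3.
have E1 := \each p q r, emul (h j q * h k r * T p q r) (Uh a i p).
have E2 := \each p q r, emul (h i p * h k r * T p q r) (Uh a j q).
have E3 := \each p q r, emul (h i p * h j q * T p q r) (Uh a k r).
by rewrite /NU /up3 /nabT; tlc (eadd E1 (eadd E2 E3)).
Qed.

Local Notation TU := (up3 T).

(** The terms in which the derivative hits the contracting tau vanish by [nabT_bianchi] again, now
    with V = nabla_p tau. *)
Lemma nabT2_bianchi p l :
  \sum_i \sum_j \sum_k TU i j k * (nabT2 p l i j k - 4 * nabT2 p i l j k)
  - \sum_i \sum_j \sum_k \sum_a \sum_b TU i j k * J i b * J l a * nabT2 p a b j k = 0.
Proof.
have E := congr1 (d p) (nabT_bianchi l TU_type).
have E' := nabT_bianchi l (NU_type p).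
have F := \each e, emul (U p l e) (nabT_bianchi e TU_type).
have D1 := \each i j k, emul (nabT l i j k - 4 * nabT i l j k) (dTU p i j k).
have D2 := \each i j k a b, emul (J i b * J l a * nabT a b j k) (dTU p i j k).
have D3 := \each i j k a b, emul (TU i j k * J l a * nabT a b j k) (UJ p i b).
have D4 := \each i j k a b, emul (TU i j k * J i b * nabT a b j k) (UJ p l a).
rewrite /nabT2.
tlc (esub (eadd E (eadd D2 (eadd D3 D4))) (eadd E' (eadd F D1))).
Qed.

(** * Quadratic torsion tensors and Ricci-type contractions *)

Lemma contract_anti_inv (V X : I -> I -> A) :
  (forall i j, \sum_p V p j * J p i = - \sum_p V i p * J p j) ->
  (forall i j, \sum_p J i p * X p j = \sum_p J j p * X i p) ->
  \sum_i \sum_j V i j * X i j = 0.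
Proof.
move=> VJ XJ; apply: two_reg.
have H1 := \each i j, emul (X i j) (JJt (fun a => V a j) i).
have H2 := \each i j b, emul (X i j * J b i) (VJ b j).
have H3 := \each b p j, emul (V b p * J p j) (XJ b j).
have H4 := \each b p, emul (V b p) (JJ (X b) p).
tlc (eadd (esub H1 H2) (eadd H3 H4)).
Qed.

(** J with its lower index raised, which is -omega^pa in the convention of the statement; this is
    the sign in [Pf]. *)
Definition Jup p a := \sum_l h p l * J l a.

Lemma WC p a : Jup p a = - Jup a p. Proof. exact: hJ. Qed.

Lemma WJ i j : \sum_p Jup p j * J p i = - \sum_p Jup i p * J p j.
Proof. by rewrite /Jup; tlc (\each l, emul (J l j) (hJ l i)). Qed.

Definition type11 (Y : I -> I -> A) :=
  (forall i j, Y i j = Y j i) /\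
  (forall i j, \sum_p Y p j * J p i = - \sum_p Y i p * J p j).

(** Up to a factor 4, [b1] and [b2] are the tensors B^1 and B^2 written through tau ([B1_b1],
    [B2_b2]). *)
Definition b1 i j := \sum_a \sum_b \sum_c \sum_e h a b * h c e * T a c i * T b e j.
Definition b2 i j := \sum_a \sum_b \sum_c \sum_e h a b * h c e * T i a c * T j b e.
Definition up2 (X : I -> I -> A) i j := \sum_a \sum_b h i a * h j b * X a b.
Definition dot2 (X Y : I -> I -> A) := \sum_i \sum_j X i j * Y i j.

Lemma up2_type X : (forall i j, X i j = X j i) ->
  (forall i j, \sum_p J i p * X p j = - \sum_p J j p * X i p) -> type11 (up2 X).
Proof.
move=> XC XJ; rewrite /up2; split => i j.
  tlc (\each a b, emul (h i a * h j b) (XC a b)).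
have K1 := \each a b, emul (h j b * X a b) (hJ a i).
have K2 := \each a b, emul (h i a * X a b) (hJ b j).
have K3 := \each a b, emul (h i a * h j b) (XJ a b).
tlc (esub K1 (eadd K3 (esub (erefl 0) K2))).
Qed.

Lemma b1C i j : b1 i j = b1 j i. Proof. by rewrite /b1; tring. Qed.
Lemma b2C i j : b2 i j = b2 j i. Proof. by rewrite /b2; tring. Qed.

Lemma b1J i j : \sum_p J i p * b1 p j = - \sum_p J j p * b1 i p.
Proof.
rewrite /b1.
have K1 := \each a b c e, emul (h a b * h c e * T b e j) (T13 a c i).
have K2 := \each a b c e, emul (h a b * h c e * T a c i) (T13 b e j).
have K3 := \each a b c e, emul (h c e * T a c i * T b e j) (hJ a b).
tlc (esub K3 (eadd K1 K2)).
Qed.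
Lemma b2J i j : \sum_p J i p * b2 p j = - \sum_p J j p * b2 i p.
Proof.
rewrite /b2.
have K1 := \each a b c e, emul (h a b * h c e * T j b e) (T12 i a c).
have K2 := \each a b c e, emul (h a b * h c e * T i a c) (T12 j b e).
have K3 := \each a b c e, emul (h c e * T i a c * T j b e) (hJ a b).
tlc (eadd K3 (eadd K1 K2)).
Qed.

Definition b1U := up2 b1.
Definition b2U := up2 b2.
Lemma b1U_type : type11 b1U. Proof. exact: up2_type b1C b1J. Qed.
Lemma b2U_type : type11 b2U. Proof. exact: up2_type b2C b2J. Qed.

Definition Pf a b := - \sum_c \sum_e Jup c e * OmL a b c e.
(** The three traces of the curvature paired with Y: [rY] traces slots 1 and 3, [pY] the last pair
    and [sY] the first pair. In the last two a J converts between the symmetric Y and a 2-form. *)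
Definition rY (Y : I -> I -> A) := \sum_a \sum_l \sum_b \sum_p h a l * OmL a b l p * Y b p.
Definition pY (Y : I -> I -> A) := \sum_i \sum_j \sum_a J i a * Pf a j * Y i j.
Definition sY (Y : I -> I -> A) := - \sum_i \sum_c \sum_p \sum_a \sum_x Jup p a * OmL p a i c
  * Y i x * J x c.

Definition YJ (Y : I -> I -> A) b e := \sum_x Y b x * J x e.

Lemma YJC Y : type11 Y -> forall b e, YJ Y b e = - YJ Y e b.
Proof.
move=> [YC YJ_] b e; rewrite /YJ.
tlc (eadd (\each x, emul (J x e) (YC b x)) (YJ_ e b)).
Qed.

Lemma YJJ Y : type11 Y -> forall i j, \sum_p YJ Y p j * J p i = - \sum_p YJ Y i p * J p j.
Proof. by move=> [YC H] i j; rewrite /YJ; tlc (\each x, emul (J x j) (H i x)). Qed.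

Lemma b1_b2 i j : b1 i j = 2 * b2 i j
  - 2 * \sum_a \sum_b \sum_c \sum_e h a b * h c e * T i a c * T j e b.
Proof.
rewrite /b1 /b2.
have K1 := \each a b c e, emul (h a b * h c e * T b e j) (Tcyc a c i).
have K2 := \each a b c e, emul (h a b * h c e * (T c i a)) (Tcyc b e j).
have K3 := \each a b c e, emul (h a b * h c e * (T i a c)) (Tcyc b e j).
have F1 := \each a b c e, emul (h a b * h c e * T i a c) (TC e j b).
have F2 := \each a b c e, emul (h a b * h c e * T e j b) (TC c i a).
have F3 := \each a b c e, emul (h a b * h c e * T j b e) (TC c i a).
have F4 := \each a b c e, emul (h a b * h c e * T i c a) (TC e j b).
tlc (esub (eadd K1 (eadd F1 (eadd F2 F3))) (eadd K2 (eadd K3 F4))).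
Qed.

Lemma WJ3 (X : I -> I -> A) : (forall i j, \sum_p J i p * X p j = \sum_p J j p * X i p) ->
  \sum_i \sum_j Jup i j * X i j = 0.
Proof. exact: contract_anti_inv WJ. Qed.

(** The quadratic torsion term that the Bianchi identity leaves in [sY_id]; [b3_quad] is its
    counterpart for [pY_id]. *)
Lemma b1_quad (Y : I -> I -> A) :
  2 * \sum_q \sum_p \sum_b \sum_x \sum_f h q p * t p b f * T f q x * Y b x = - dot2 b1 Y.
Proof.
have I1 := \each q p b x f, emul (h q p * T f q x * Y b x) (tup p b f).
have I2 := \each q p b x f l, emul (h q p * h f l * T f q x * Y b x) (TC p b l).
have I3 := \each q p b x f l, emul (h q p * h f l * T b p l * Y b x) (Tcyc f q x).
have I4 := \each q p b x f l, emul (h q p * h f l * T b p l * Y b x) (TC q x f).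
have I5 := \each b x, emul (Y b x) (b1_b2 b x).
rewrite /dot2 /b2 in I5 *.
tlc (esub (eadd I5 (emul 2 (eadd I1 (eadd I2 I4)))) (emul 2 I3)).
Qed.

(** The Bianchi identity on p, a, b is contracted with [Jup] in p, a and with the J-invariant 2-form
    [YJ Y] in b, e. Each derivative term is anti-invariant in one of these pairs, or in both indices
    of an invariant one, and vanishes; one curvature term is [sY], and the other two agree and yield
    [rY]. *)
Lemma sY_id Y : type11 Y -> sY Y = - 2 * rY Y + dot2 b1 Y.
Proof.
move=> YT; have [YC YJ0] := YT.
have ZJ := YJJ YT.
have B := \each p a b e, emul (Jup p a * YJ Y b e) (bianchi p a b e).
have N1 := \each p a, emul (Jup p a) (contract_anti_inv ZJ (fun b e => N23 p a b e)).
have Nb := \each p a, emul (Jup p a) (contract_anti_inv ZJ (fun b e => N13 a b p e)).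
have N3 := \each b e, emul (YJ Y b e) (WJ3 (fun p a => N12 b p a e)).
have T1 := \each b e f, emul (YJ Y b e * T f b e) (contract_anti_inv WJ (fun p a => tJ12 p a f)).
have D1 := \each p a b e, emul (Jup p a * YJ Y b e) (OC b p a e).
have D2 := \each p a b e, emul (OmL a b p e * YJ Y b e) (WC a p).
have E1 := \each p a b e f, emul (Jup p a * YJ Y b e * T f a e) (tC b p f).
have E2 := \each p a b e f, emul (YJ Y b e * t a b f * T f p e) (WC a p).
have F1 := \each p a b e, emul (OmL a b p e * YJ Y b e) (WC p a).
have F2 := \each a l b e, emul (h a l * YJ Y b e) (OJ a b l e).
have F3 := \each a l b x, emul (h a l * Y b x) (JJ (fun p => OmL a b l p) x).
have G1 := \each p a b x f, emul (Jup p a * Y b x * t a b f) (T23 f p x).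
have G2 := \each q l a b x f, emul (J l a * t a b f * Y b x * T f q x) (hJ l q).
have G3 := \each q p b x f, emul (h q p * Y b x * T f q x) (JJ (fun a => t a b f) p).
have K := b1_quad Y.
have E := esub (eadd D1 (eadd E2 (emul 2 (eadd F1 (eadd F3 (eadd G1 G3))))))
  (eadd (eadd B (eadd N1 (eadd Nb (eadd N3 T1)))) (eadd D2 (eadd E1 (eadd (emul 2
    (eadd F2 G2)) K)))).
by rewrite /sY /rY /Jup /YJ in E *; tlc E.
Qed.

Lemma b3_quad (Y : I -> I -> A) :
  2 * \sum_b \sum_c \sum_a \sum_x \sum_f h b c * t x b f * T f a c * Y a x = dot2 b1 Y - 2
    * dot2 b2 Y.
Proof.
have I1 := \each b c a x f, emul (h b c * T f a c * Y a x) (tup x b f).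
have I2 := \each b c a x f l, emul (h b c * h f l * T x b l * Y a x) (TC f a c).
have I5 := \each a x, emul (Y a x) (b1_b2 x a).
rewrite /dot2 /b1 /b2 in I5 *.
tlc (esub (emul 2 (eadd I1 I2)) I5).
Qed.

(** The same argument with [YJ Y] on the first pair a, b and [Jup] on the last pair c, e of the
    Bianchi identity. *)
Lemma pY_id Y : type11 Y -> pY Y = 2 * rY Y + dot2 b1 Y - 2 * dot2 b2 Y.
Proof.
move=> YT; have [YC YJ0] := YT.
have ZJ := YJJ YT; have ZC := YJC YT.
have B := \each c e a b, emul (Jup c e * YJ Y a b) (bianchi a b c e).
have N1 := \each a b, emul (YJ Y a b) (WJ3 (fun c e => N23 a b c e)).
have Nb := \each a b, emul (YJ Y a b) (WJ3 (fun c e => N13 b c a e)).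
have N3 := \each c e, emul (Jup c e) (contract_anti_inv ZJ (fun a b => N12 c a b e)).
have T1 := \each c e f, emul (Jup c e * T f c e) (contract_anti_inv ZJ (fun a b => tJ12 a b f)).
have D1 := \each c e a b, emul (Jup c e * YJ Y a b) (OC c a b e).
have D2 := \each c e a b, emul (Jup c e * OmL b c a e) (ZC b a).
have E1 := \each c e a b f, emul (Jup c e * YJ Y a b * T f b e) (tC c a f).
have E2 := \each c e a b f, emul (Jup c e * t b c f * T f a e) (ZC b a).
have F0 := \each c l e a b, emul (h c l * J l e * OmL b c a e) (ZC a b).
have F2 := \each c l a b, emul (h c l * YJ Y b a) (OJ b c a l).
have F3 := \each c l x b, emul (h c l * Y b x) (JJ (fun p => OmL b c p l) x).
have F4 := \each c l x b, emul (h c l * Y b x) (OC b c x l).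
have F5 := \each c l x b, emul (h c l * Y b x) (OLC c b x l).
have P0 := \each i j a c e, emul (J i a * Jup c e * OmL a j c e) (YC i j).
have P1 := \each a b c e, emul (Jup c e * OmL a b c e) (ZC b a).
have G1 := \each c e a x f, emul (Jup c e * Y a x * T f a e) (tJ12 x c f).
have G2 := \each l b e a x f, emul (J l e * Y a x * t x b f * T f a e) (hJ l b).
have G3 := \each b c a x f, emul (h b c * Y a x * t x b f) (JJ (fun e => T f a e) c).
have K := b3_quad Y.
have E := esub (eadd B (eadd N1 (eadd Nb (eadd N3 (eadd T1 (eadd D2 (eadd E1 (eadd (emul 2
  (eadd F2 (eadd F4 (eadd G1 G2)))) K))))))))
  (eadd P0 (eadd P1 (eadd D1 (eadd E2 (emul 2 (eadd F0 (eadd F3 (eadd F5 G3)))))))).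
by rewrite /pY /Pf /rY /Jup /YJ in E *; tlc E.
Qed.

Lemma Oup a b c e : Om a b c e = \sum_f h e f * OmL a b c f.
Proof. by rewrite /OmL; tlc (esub (erefl 0) (hg (Om a b c) e)). Qed.

(** * The curvature terms of the statement *)

Lemma b1_half i j : 2 * \sum_a \sum_b \sum_c \sum_e h a b * h c e * T i a c * T e b j = b1 i j.
Proof.
have K1 := \each a b c e, emul (h a b * h c e * T i a c) (Tcyc e b j).
have K2 := \each a b c e, emul (h a b * h c e * T i a c) (TC b j e).
have K3 := b1_b2 i j; rewrite /b2 in K3.
tlc (esub (emul 2 (esub K1 K2)) K3).
Qed.

Definition TM f r k := \sum_e \sum_a h e f * h a r * T e a k.

Lemma TMC f r k : TM f r k = - TM r f k.
Proof. by rewrite /TM; tlc (\each e a, emul (h e f * h a r) (TC e a k)). Qed.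

Lemma TMJ1 f r k : \sum_p J k p * TM f r p = - \sum_p TM p r k * J p f.
Proof.
rewrite /TM.
have K1 := \each e a, emul (h e f * h a r) (T13 e a k).
have K2 := \each e a, emul (h a r * T e a k) (hJ e f).
tlc (esub K2 K1).
Qed.

Lemma TMJ2 f r k : \sum_p J k p * TM f r p = - \sum_p TM f p k * J p r.
Proof.
have E1 := \each p, emul (J k p) (TMC f r p).
have E2 := \each p, emul (J p r) (TMC f p k).
tlc (eadd E1 (esub E2 (TMJ1 r f k))).
Qed.

Lemma TMJ12 f r k : \sum_p TM p r k * J p f = \sum_p TM f p k * J p r.
Proof. by apply: oppr_inj; rewrite -TMJ1 -TMJ2. Qed.

Lemma quad_up (P Q : I -> I -> A) :
  (forall i k, \sum_p P p k * J p i = \sum_p P i p * J p k) ->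
  (forall f k, \sum_p J k p * Q f p = - \sum_p Q p k * J p f) ->
  forall i f, \sum_p (\sum_k P p k * Q f k) * J p i = - \sum_p (\sum_k P i k * Q p k) * J p f.
Proof.
move=> HP HQ i f.
tlc (eadd (\each k, emul (Q f k) (HP i k)) (\each k, emul (P i k) (HQ f k))).
Qed.

Definition TOT1 := \sum_p \sum_q \sum_k \sum_a \sum_r \sum_e TU p q k * h a r * Om r p q e
  * T e a k.
Definition TOT2 := \sum_p \sum_q \sum_k \sum_a \sum_r \sum_e TU p k q * h a r * Om r p q e
  * T k a e.
Definition TOT3 := \sum_p \sum_q \sum_k \sum_a \sum_r \sum_e TU p k q * h a r * Om r p q e
  * T k e a.

(** The Bianchi identity on r, p, q is contracted with tau^pqk tau^fr_k. This product is J-invariant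
    in (q, f) and in (p, f), which kills the derivative terms, and Omega_pqrf vanishes against the
    anti-invariant pair (r, f). The other two curvature terms coincide and are thus balanced by
    quartic torsion alone. *)
Lemma TOT1_E : 4 * TOT1 = dot2 b1 b1U.
Proof.
have [UC U12 U23] := TU_type; have U13 := type13 TU_type.
have B := \each r p q f k, emul (TU p q k * TM f r k) (bianchi r p q f).
have Z1 := \each p q k, emul (TU p q k) (contract_inv_anti (fun r f => esym (TMJ12 f r k))
  (fun r f => OJ p q r f)).
have Vqf p r := quad_up (fun q k => U23 p q k) (fun f k => TMJ1 f r k).
have Vpf q r := quad_up (fun p k => U13 p q k) (fun f k => TMJ1 f r k).
have N1 := \each r p, contract_anti_inv (Vqf p r) (fun q f => N23 r p q f).
have Nb := \each r p, contract_anti_inv (Vqf p r) (fun q f => N13 p q r f).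
have N3 := \each r q, contract_anti_inv (Vpf q r) (fun p f => N23 q r p f).
have T1 := \each r p x, emul (t r p x) (contract_anti_inv (Vqf p r) (fun q f => T23 x q f)).
have T3 := \each r q x, emul (t q r x) (contract_anti_inv (Vpf q r) (fun p f => T23 x p f)).
have D1 := \each r p q f k, emul (TU p q k * TM f r k) (OC q r p f).
have D2 := \each r p q f k, emul (TM f r k * OmL r p q f) (UC p q k).
have L := \each p q k a r e, emul (TU p q k * h a r * T e a k) (Oup r p q e).
have R1 := \each k x p q, emul (TU p q k * t p q x) (b1_half x k).
have R2 := \each k x p q, emul (TU p q k * b1 x k) (tup p q x).
have E := esub (eadd (emul 2 (eadd (eadd B D2) (eadd N1 (eadd Nb (eadd N3 (eadd T1 T3)))))) (eadd
  (emul 4 L) (eadd R1 R2)))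
   (emul 2 (eadd D1 Z1)).
by rewrite /TOT1 /TM /dot2 /b1U /up2 /b1 /up3 in E *; tlc E.
Qed.

(** The cyclic identity gives tau_kae - tau_kea = tau_eak, so the difference again contains [TM],
    and the Bianchi argument of [TOT1_E] applies, with tau^pkq in place of tau^pqk. *)
Lemma TOT23_E : 2 * (TOT2 - TOT3) = dot2 b1 b2U.
Proof.
have [UC U12 U23] := TU_type; have U13 := type13 TU_type.
have B := \each r p q f k, emul (TU p k q * TM f r k) (bianchi r p f q).
have Z3 := \each r f k, emul (TM f r k) (contract_inv_anti (fun p q => U13 p k q)
  (fun p q => OJ f r p q)).
have Vpf q r := quad_up (fun p k => U12 p k q) (fun f k => TMJ1 f r k).
have Vqf p r := quad_up (fun q k => esym (U23 p k q)) (fun f k => TMJ1 f r k).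
have Vpr q f := quad_up (fun p k => U12 p k q) (fun r k => TMJ2 f r k).
have Vqr p f := quad_up (fun q k => esym (U23 p k q)) (fun r k => TMJ2 f r k).
have N1 := \each r q, contract_anti_inv (Vpf q r) (fun p f => N12 r p f q).
have Nb := \each r p, contract_anti_inv (Vqf p r) (fun q f => esym (N13 p f r q)).
have N3 := \each f q, contract_anti_inv (Vpr q f) (fun p r => esym (N12 f r p q)).
have T1 := \each r p x, emul (t r p x) (contract_anti_inv (Vqf p r) (fun q f => esym (T23 x f q))).
have T2 := \each p f x, emul (t p f x) (contract_anti_inv (Vqr p f) (fun q r => esym (T23 x r q))).
have D1 := \each r p q f k, emul (TU p k q * TM f r k) (OLC r p f q).
have D2 := \each r p q f k, emul (TU p k q * TM f r k) (OC p f r q).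
have D3 := \each r p q f k, emul (TU p k q * TM f r k) (OLC f p r q).
have D4 := \each r p q f k, emul (TU p k q * OmL r p q f) (TMC f r k).
have L := \each p q k a r e, emul (TU p k q * h a r * (T k a e - T k e a)) (Oup r p q e).
have L2 := \each p q k a r e f, emul (TU p k q * h a r * h e f * OmL r p q f) (Tcyc k a e).
have L3 := \each p q k a r e f, emul (TU p k q * h a r * h e f * OmL r p q f) (TC e k a).
have L4 := \each p q k a r e f, emul (TU p k q * h a r * h e f * OmL r p q f) (TC a e k).
have R2 := \each k x f r p q, emul (TM f r k * TU p k q * T x p q) (tup f r x).
have R3 := \each k x l a b c p q, emul (b1 k l * h l x * h p a * h k b * h q c * T x p q)
  (TC a b c).
have E := esub (eadd (emul 2 (eadd L L2)) (eadd D1 (eadd D2 (eadd D4 Z3))))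
   (eadd B (eadd D3 (eadd N1 (eadd Nb (eadd N3 (eadd T1 (eadd T2 (eadd R2 (eadd R3 (emul 2
     (eadd L3 L4))))))))))).
rewrite /dot2 /TOT2 /TOT3 /b2U /up2 in E *; rewrite /TM /up3 /b1 /b2 in E *.
tlc E.
Qed.

Lemma d_sqtor l : d l (\sum_i \sum_j \sum_k TU i j k * T i j k) =
   2 * \sum_i \sum_j \sum_k TU i j k * nabT l i j k.
Proof.
have E1 := \each i j k, emul (T i j k) (dTU l i j k).
have E2 := \each i j k, emul (TU i j k) (dT l i j k).
have E := eadd E1 E2; rewrite /NU /up3 in E *; tlc E.
Qed.

Lemma laplacian_f f : f = \sum_i \sum_j \sum_k TU i j k * T i j k ->
  \sum_p \sum_l h p l * (d p (d l f) - \sum_a U p l a * d a f) =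
  2 * \sum_p \sum_l \sum_i \sum_j \sum_k h p l * (NU p i j k * nabT l i j k)
  + 2 * \sum_p \sum_l \sum_i \sum_j \sum_k h p l * (TU i j k * nabT2 p l i j k).
Proof.
move=> fE; have dfl l : d l f = 2 * \sum_i \sum_j \sum_k TU i j k * nabT l i j k by rewrite fE d_sqtor.
have E1 := \each p l, emul (h p l) (congr1 (d p) (dfl l)).
have E2 := \each p l a, emul (h p l * U p l a) (dfl a).
have E3 := \each p l i j k, emul (h p l * nabT l i j k) (dTU p i j k).
have dN p l i j k : d p (nabT l i j k) = nabT2 p l i j k + \sum_e U p l e * nabT e i j k
  + \sum_e U p i e * nabT l e j k + \sum_e U p j e * nabT l i e k + \sum_e U p k e * nabT l i j e.
  by rewrite /nabT2; tring.
have E4 := \each p l i j k, emul (h p l * up3 T i j k) (dN p l i j k).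
have E := eadd (esub E1 E2) (emul 2 (eadd E3 E4)).
tlc E.
Qed.

Lemma OCup a b c k : Om a b c k = - Om b a c k.
Proof. by rewrite /Om; tring. Qed.

(** The cost of exchanging the derivatives in nabla S. The torsion term of [ricci_id] vanishes by
    type, and the curvature acting on the slots l, j, k of tau produces [rY b2U], [TOT1] and [TOT2]
    respectively. *)
Lemma nabT2_commutator : \sum_p \sum_l \sum_i \sum_j \sum_k
    h p l * (TU i j k * (nabT2 i p l j k - nabT2 p i l j k)) = rY b2U - TOT1 - TOT2.
Proof.
have [UC U12 U23] := TU_type.
have R := \each p l i j k, emul (h p l * TU i j k) (ricci_id i p l j k).
have HP e i l : \sum_q J i q * (\sum_p t q p e * h p l) = - \sum_q (\sum_p t i p e * h p q) * J q l.
  tlc (eadd (\each p, emul (h p l) (tJ12 i p e)) (\each p, emul (t i p e) (hJ l p))).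
have Z := \each e k, contract_inv_anti (fun i j => U12 i j k) (quad_inv (HP e)
  (fun l j => N12 e l j k)).
have A1 := \each p l i j k e, emul (h p l * TU i j k * T e j k) (Oup i p l e).
have A2 := \each p l i j k e f, emul (h p l * h e f * TU i j k * T e j k) (OC i p l f).
have B1 := \each p l i j k e, emul (h p l * TU i j k * T l e k) (OCup i p j e).
have B2 := \each p l i j k e, emul (h p l * TU i j k * Om p i j e) (TC l e k).
have C1 := \each p l i j k e, emul (h p l * TU i j k * T l j e) (OCup i p k e).
have C2 := \each p l i j k e, emul (h p l * TU i j k * Om p i k e) (TC l j e).
have E := esub (eadd R (eadd B2 C2)) (eadd Z (eadd A1 (eadd A2 (eadd B1 C1)))).
by rewrite /rY /TOT1 /TOT2 /b2U /up2 /b2 /up3 in E *; tlc E.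
Qed.

(** As [Jup] is skew, only the commutator of the two derivatives counts. Curvature acting on either
    of the first two slots of tau gives [sY b2U], and on the third slot [sY b1U]. *)
Lemma nabT2_commutator_twisted : 2 * \sum_p \sum_l \sum_i \sum_j \sum_k \sum_a \sum_b
    h p l * (TU i j k * J i b * J l a * nabT2 p a b j k) = - 2 * sY b2U - sY b1U.
Proof.
have [UC U12 U23] := TU_type.
have C1 := \each p a b i j k, emul (TU i j k * J i b * nabT2 p a b j k) (WC p a).
have R := \each p a b i j k, emul (Jup p a * TU i j k * J i b) (ricci_id p a b j k).
have Z := \each i j k b e, emul (TU i j k * J i b * nabT e b j k) (contract_anti_inv WJ
  (fun p a => tJ12 p a e)).
have M1 := \each p a i j k e, emul (Jup p a * TU i j k * T e j k) (OJ_up p a i e).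
have M2 := \each p a i j k e x, emul (Jup p a * TU i j k * T e j k * J x e) (Oup p a i x).
have M3 := \each p a i j k e c, emul (Jup p a * TU i j k * T e j k * OmL p a i c) (hJ c e).
have M4 := \each p a i j k e, emul (Jup p a * TU i j k * Om p a j e) (T12 i e k).
have M5 := \each p a i j k e b, emul (Jup p a * Om p a j e * J e b * T i b k) (UC i j k).
have M6 := \each p a i j k e b, emul (Jup p a * Om p a j e * J e b * TU j i k) (TC i b k).
have M7 := \each p a i j k e, emul (Jup p a * TU i j k * Om p a k e) (T13 i j e).
have M8 := \each p a i j k e b, emul (Jup p a * TU i j k * J e b * T i j b) (Oup p a k e).
have M9 := \each p a i j k b c, emul (Jup p a * TU i j k * T i j b * OmL p a k c) (hJ c b).
have E := esub (eadd C1 (eadd R M6)) (eadd Z (eadd M1 (eadd (emul 2 (eadd M2 M3)) (eadd M4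
  (eadd M5 (eadd M7 (eadd M8 M9))))))).
by rewrite /sY /b1U /b2U /up2 /b1 /b2 /Jup /up3 in E *; tlc E.
Qed.

(** * Anti-invariant parts of P and Rc in terms of S = [divT] *)

Definition divT j k := \sum_p \sum_l h p l * nabT p l j k.

Lemma SJ j k : \sum_p J j p * divT p k = \sum_p J k p * divT j p.
Proof. by rewrite /divT; tlc ((\each p l, emul (h p l) (N23 p l j k))). Qed.

(** Twice X^{2,0+0,2}; the factor one half is supplied later by [hf]. *)
Definition aop (X : I -> I -> A) (i j : I) := X i j - \sum_s \sum_u J i s * J j u * X s u.

Lemma aop_inv X : (forall i j, \sum_p J i p * X p j = - \sum_p J j p * X i p) ->
  forall i j, aop X i j = 0.
Proof.
move=> XJ i j; rewrite /aop.
tlc (esub (JJ (fun s => X s j) i) (\each s, emul (J i s) (XJ s j))).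
Qed.

Lemma aop_anti X : (forall i j, \sum_p J i p * X p j = \sum_p J j p * X i p) ->
  forall i j, aop X i j = 2 * X i j.
Proof.
move=> XJ i j; rewrite /aop.
tlc (esub (\each s, emul (J i s) (XJ s j)) (JJ (fun s => X s j) i)).
Qed.

Lemma eq_aop X Y : (forall i j, X i j = Y i j) -> forall i j, aop X i j = aop Y i j.
Proof.
move=> XY i j; rewrite /aop.
tlc (esub (XY i j) (\each s u, emul (J i s * J j u) (XY s u))).
Qed.

Definition R1 b c := \sum_a Om a b c a.
Definition XW b c := \sum_a \sum_e Jup a e * OmL a b e c.
Definition NW b c := \sum_a \sum_e Jup a e * nabT a b e c.

Lemma XW_R1 b c : XW b c = \sum_e J c e * R1 b e.
Proof.
have E := esub (\each a l, emul (h a l) (OJ a b l c)) (eadd (\each a l e, emul (h a l * J c e)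
  (OLC a b l e)) (\each a e, emul (J c e) (Oup a b e a))).
by rewrite /XW /R1 /Jup in E *; tlc E.
Qed.

Lemma NW_S b c : NW b c = - \sum_e J c e * divT b e.
Proof.
have E := eadd (\each a l, emul (h a l) (N23 a b l c)) (\each a l e, emul (h a l * J c e)
  (NC a b l e)).
by rewrite /NW /divT /Jup in E *; tlc E.
Qed.

(** In the Bianchi identity traced with [Jup] over a and e two curvature terms give 2 [XW]. The
    third ([Y]) and the quadratic terms ([Qd]) are J-invariant in b, c and are annihilated by
    [aop]. *)
Lemma aop_XW b c : aop XW b c = 2 * NW b c.
Proof.
apply: (two_reg_inj two_reg).
pose Y b c := \sum_a \sum_e Jup a e * OmL e a b c.
pose Qd b c := \sum_a \sum_e Jup a e * \sum_f t a b f * T f e c.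
have YI : forall i j, aop Y i j = 0.
  apply: aop_inv => i j; rewrite /Y.
  tlc ((\each a e, emul (Jup a e) (OJ e a i j))).
have QI : forall i j, aop Qd i j = 0.
  apply: aop_inv => i j; rewrite /Qd.
  tlc (\each a e, emul (Jup a e) (quad_inv (tJ2 a) (fun f k => T13 f e k) i j)).
have NA : forall i j, aop NW i j = 2 * NW i j.
  apply: aop_anti => i j; rewrite /NW.
  tlc (\each a e, emul (Jup a e) (N13 a i e j)).
have E b' c' : 2 * XW b' c' = - Y b' c' + 2 * NW b' c' + 2 * Qd b' c'.
  have B := (\each a e, emul (Jup a e) (bianchi a b' e c')).
  have Z1 := WJ3 (fun a e => esym (N12 b' e a c')).
  have Z3 := \each f, emul (T f b' c') (contract_anti_inv WJ (fun a e => esym (tJ12 e a f))).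
  rewrite /XW /Y /NW /Qd.
  have F1 := \each a e, emul (Jup a e) (OC b' e a c').
  have F2 := \each a e, emul (OmL a b' e c') (WC e a).
  have F3 := \each a e, emul (Jup a e) (NC e a b' c').
  have F4 := \each a e, emul (nabT a b' e c') (WC e a).
  have F5 := \each a e f, emul (Jup a e * T f a c') (tC b' e f).
  have F6 := \each a e f, emul (t a b' f * T f e c') (WC e a).
  tlc (esub (eadd B (eadd F2 (eadd Z1 (eadd F3 (eadd F5 Z3))))) (eadd F1 (eadd F4 F6))).
have E1 := esub (eq_aop E b c) (eadd (YI b c) (emul (- 2) (eadd (NA b c) (QI b c)))).
by rewrite /aop in E1 *; tlc E1.
Qed.

Lemma aop_R1 b c : aop R1 b c = - 2 * divT b c.
Proof.
have E := \each e, emul (J c e) (aop_XW b e).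
have X := \each e, emul (J c e) (XW_R1 b e).
have Y := \each e, emul (J c e) (NW_S b e).
have X2 := \each e s u, emul (J c e * J b s * J e u) (XW_R1 s u).
have J1 := JJ (R1 b) c.
have J2 := \each s, emul (J b s) (JJ (fun u => \sum_v J u v * R1 s v) c).
have J3 := JJ (divT b) c.
have H := esub (eadd X (eadd J1 (emul 2 J3))) (eadd E (eadd X2 (eadd J2 (emul 2 Y)))).
by rewrite /aop in H *; tlc H.
Qed.

(** Bianchi writes P as the antisymmetrised [XW] plus the derivative term [NP] and J-invariant
    quadratic terms, which reduces the claim to [aop_XW]. *)
Lemma aop_Pf a b : aop Pf a b = 4 * \sum_e J b e * (divT a e - divT e a).
Proof.
pose Qd b a := \sum_c \sum_e Jup c e * \sum_f t b c f * T f a e.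
have QI : forall i j, aop Qd i j = 0.
  apply: aop_inv => i j; rewrite /Qd.
  have H := \each c e, emul (Jup c e) (quad_inv (fun j f => tJ1 j c f) (fun f k => T12 f k e) i j).
  tlc H.
pose NP a b := \sum_c \sum_e Jup c e * nabT c a b e.
have NA : forall i j, aop NP i j = 2 * NP i j.
  apply: aop_anti => i j; rewrite /NP.
  tlc (\each c e, emul (Jup c e) (N12 c i j e)).
have NPE i j : NP i j = \sum_e J j e * (divT e i - divT i e).
  rewrite /NP /divT /Jup.
  have H := esub (\each c l e, emul (h c l * J j e) (Ncyc c i e l)) (eadd (\each c l, emul (h c l)
    (N23 c i j l)) (\each c l e, emul (h c l * J j e) (NC c e l i))).
  tlc H.
have E a' b' : Pf a' b' = XW b' a' - XW a' b' - NP a' b' - Qd b' a' + Qd a' b'.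
  have B := \each c e, emul (Jup c e) (bianchi a' b' c e).
  have N1 := WJ3 (fun c e => N23 a' b' c e).
  have Nb' := WJ3 (fun c e => N13 b' c a' e).
  have T1 := \each f, emul (t a' b' f) (WJ3 (fun c e => T23 f c e)).
  have F1 := \each c e, emul (Jup c e) (OC b' c a' e).
  have F2 := \each c e, emul (Jup c e) (OLC c b' a' e).
  have F3 := \each c e, emul (Jup c e) (OLC c a' b' e).
  have F4 := \each c e f, emul (Jup c e * T f b' e) (tC c a' f).
  rewrite /Pf /XW /NP /Qd.
  tlc (esub (eadd F1 F3) (eadd B (eadd F2 (eadd N1 (eadd Nb' (eadd T1 F4)))))).
have H1 := eadd (eq_aop E a b) (esub (eadd (aop_XW b a) (QI a b)) (eadd (aop_XW a b) (eadd
  (NA a b) (QI b a)))).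
have H2 := emul 2 (eadd (esub (NW_S b a) (eadd (NW_S a b) (NPE a b))) (SJ b a)).
have H := eadd H1 H2.
by rewrite /aop in H *; tlc H.
Qed.

Variable G : I -> I -> I -> A.
Hypothesis GU : forall i j k, G i j k = U i j k - \sum_l h k l * T l j i.

Definition RG a b c k := d a (G b c k) - d b (G a c k) + \sum_e G a e k * G b c e
  - \sum_e G b e k * G a c e.
Definition Rc b c := \sum_a RG a b c a.

Lemma hJt i j : \sum_p h p j * J p i = - \sum_p h i p * J p j.
Proof. by tlc (hJ j i). Qed.

Lemma T_trace c : \sum_a \sum_l h a l * T l c a = 0.
Proof. exact: (contract_anti_inv hJt (fun a l => esym (T13 l c a))). Qed.

(** Insert G = U - h T into the Riemann tensor. The trace of tau vanishes, so the derivative of the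
    contorsion survives only as S_cb; the remaining terms are quadratic and, by [aop_Rc], invisible
    to [aop]. *)
Lemma Rc_R1 b c : Rc b c = R1 b c - divT c b
  - \sum_a \sum_e \sum_l t a b e * h a l * T l c e
  - \sum_a \sum_e \sum_k \sum_l h a l * T l e b * h e k * T k c a.
Proof.
rewrite /Rc /RG.
have G1 := \each a, esub (congr1 (d a) (GU b c a)) (congr1 (d b) (GU a c a)).
have G2 := \each a e, emul (G b c e) (GU a e a).
have G3 := \each a e, emul (G a c e) (GU b e a).
have G4 := \each a e, emul (U a e a - \sum_l h a l * T l e a) (GU b c e).
have G5 := \each a e, emul (U b e a - \sum_l h a l * T l e b) (GU a c e).
have T1 := congr1 (d b) (T_trace c).
have T2 := \each e, emul (U b c e) (T_trace e).
have T3 := \each e l, emul (h e l * T l c b) (T_trace e).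
have D1 := \each a l, emul (T l c b) (Uh a a l).
rewrite /R1 /Om /divT /nabT /tor.
tlc (esub (eadd G1 (eadd G2 (eadd G4 (eadd T1 T3)))) (eadd G3 (eadd G5 (eadd T2 D1)))).
Qed.
Lemma aop_Rc b c : aop Rc b c = - 2 * (divT b c + divT c b).
Proof.
pose Q1 b c := \sum_a \sum_e \sum_l t a b e * h a l * T l c e.
pose Q2 b c := \sum_a \sum_e \sum_k \sum_l h a l * T l e b * h e k * T k c a.
have Q1I : forall i j, aop Q1 i j = 0.
  apply: aop_inv => i j; rewrite /Q1.
  have HP e b' l : \sum_p J b' p * (\sum_a t a p e * h a l) = - \sum_p (\sum_a t a b' e * h a p)
    * J p l.
    tlc (esub (\each a, emul (t a b' e) (hJ l a)) (\each a, emul (h a l) (tJ12 a b' e))).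
  tlc (\each e, quad_inv (HP e) (fun l c => T12 l c e) i j).
have Q2I : forall i j, aop Q2 i j = 0.
  apply: aop_inv => i j; rewrite /Q2.
  have HP l b' k : \sum_p J b' p * (\sum_e T l e p * h e k) = - \sum_p (\sum_e T l e b' * h e p)
    * J p k.
    tlc (esub (\each e, emul (T l e b') (hJ k e)) (\each e, emul (h e k) (T23 l e b'))).
  tlc (\each a l, emul (h a l) (quad_inv (HP l) (fun k c => T12 k c a) i j)).
have SA : forall i j, aop divT i j = 2 * divT i j by apply: aop_anti; exact: SJ.
have E b' c' : Rc b' c' = R1 b' c' - divT c' b' - Q1 b' c' - Q2 b' c' by exact: Rc_R1.
have H := esub (eadd (eq_aop E b c) (aop_R1 b c)) (eadd (SA c b) (eadd (Q1I b c) (Q2I b c))).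
by rewrite /aop in H *; tlc H.
Qed.

Variable hf : A.
Hypothesis hfE : 2 * hf = 1.
Local Notation D := (der None).
Definition Pd i j := \sum_c \sum_e (\sum_s J s c * h e s) * OmL i j c e.
Definition anti X i j := hf * aop X i j.

Hypothesis dtw : forall i j, D (\sum_a J i a * g j a) = - Pd i j.
Hypothesis dtJ : forall i k, D (J i k) =
  - \sum_w (anti Pd i w - 2 * \sum_e J i e * anti Rc e w) * h w k.

Lemma Pd_Pf i j : Pd i j = Pf i j.
Proof.
have H := (\each c e, emul (OmL i j c e) (WC c e)).
by rewrite /Pd /Pf /Jup in H *; tlc H.
Qed.

(** P contributes 2 J_w^e (S_ie - S_ei) to the bracket and the Ricci term, after J is moved by [SJ],
    2 J_w^e (S_ie + S_ei): the transposed terms cancel and the coefficient 4 remains. *)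
Lemma flowJ i k : D (J i k) = 4 * \sum_l \sum_p divT i l * h l p * J p k.
Proof.
have E1 := (\each w, emul (hf * h w k) (eq_aop Pd_Pf i w)).
have E2 := (\each w, emul (hf * h w k) (aop_Pf i w)).
have E3 := (\each w e, emul (2 * hf * h w k * J i e) (aop_Rc e w)).
have E4 := (\each w, emul (h w k) (SJ i w)).
have E5 := \each w, emul (h w k) (SJ w i).
have E6 := (\each w e, emul (h w k * J w e * divT i e) (hfE)).
have E8 := (\each e, emul (divT i e) (hJ k e)).
have E0 := dtJ i k.
rewrite /anti in E0.
tlc (esub (eadd E0 (eadd E3 (emul (4 * hf) E5))) (eadd E1 (eadd E2 (eadd (emul (4 * hf) E4)
  (emul 4 (eadd E6 E8)))))).
Qed.

(** * The time derivative of |tau|^2 *)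

Definition gD i j := D (g i j).
Definition UD i j k := D (U i j k).

(** When omega = g(J., .) is differentiated in time, the term with dJ/dt amounts to the
    anti-invariant S, which is orthogonal to Y; what is left is P. *)
Lemma time_metric_dot Y : type11 Y -> \sum_i \sum_j gD i j * Y i j = pY Y.
Proof.
move=> [YC YJ0].
have E1 := (\each i j x, emul (- J x i * Y j x) (dtw i j)).
have E2 := (\each j x, emul (Y j x) (JJ (fun a => D (g j a)) x)).
have E3 := (\each i j x, emul (J x i * Y j x) (Pd_Pf i j)).
have E4 := (\each i j a, emul (J i a * Pf a j) (YC i j)).
have E5 := (\each i j x a, emul (J x i * Y j x * g j a) (flowJ i a)).
have E6 := (\each i j x l p, emul (J x i * Y j x * divT i l * h l p) (Jg p j)).
have E7 := (\each i j x a, emul (J x i * Y j x * J j a) (gh (divT i) a)).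
have E8 := (\each i j x, emul (J x i * Y j x) (SJ i j)).
have E9 := (\each j x, emul (Y j x) (JJ (fun i => divT i j) x)).
have Z := contract_anti_inv YJ0 SJ.
have E10 := (\each j x, emul (divT x j) (YC j x)).
rewrite /gD /pY.
tlc (esub (eadd E1 (eadd E2 (eadd E3 (eadd E5 (emul 4 (eadd E6 (eadd E8 (eadd E10 Z))))))))
  (eadd E4 (emul 4 (eadd E7 E9)))).
Qed.

Lemma d_divT i j k : d i (divT j k) = \sum_p \sum_l h p l * nabT2 i p l j k
   + \sum_e U i j e * divT e k + \sum_e U i k e * divT j e.
Proof.
have E := (\each p l, emul (nabT p l j k) (Uh i p l)).
by rewrite /divT /nabT2; tlc E.
Qed.

Lemma time_inverse i j : D (h i j) = - \sum_a \sum_b h i a * gD a b * h b j.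
Proof.
rewrite /gD; have E := congr1 D (hg (fun b => h b j) i).
tlc (esub E (eadd (hg (fun b => D (h b j)) i) (hg (fun b => D (h b i)) j))).
Qed.

(** The time derivative of nabla J = 0 determines dU/dt up to its part commuting with J, which tau
    does not see. Contracted with tau, the two terms with dU/dt in [UJ] become equal, whence the 2
    on the left; the right side is nabla_i S by [flowJ]. *)
Lemma time_chern_contr : 2 * \sum_i \sum_j \sum_k \sum_l TU i j k * UD i j l * g l k =
  4 * \sum_i \sum_j \sum_k \sum_p \sum_l h p l * (TU i j k * nabT2 i p l j k).
Proof.
have [UC U12 U23] := TU_type.
have dd i j k : D (d i (J j k)) = d i (4 * \sum_l \sum_p divT j l * h l p * J p k).
  by rewrite derC flowJ.
have E1 := (\each i j q m k, emul (TU i j m * J k q * g q m) (dd i j k)).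
have E2 := (\each i j q m k, emul (TU i j m * J k q * g q m) (congr1 D (UJ i j k))).
have F1 := (\each i j a m, emul (TU i j m * UD i j a) (JJ (fun q => g q m) a)).
have F2 := (\each i a k q m, emul (UD i a k * J k q * g q m) (U23 i a m)).
have F3 := (\each i a k p q, emul (UD i a k * TU i a p * J k q) (Jg p q)).
have F4 := (\each i a k p, emul (UD i a k * TU i a p) (JJ (fun m => g p m) k)).
have F5 := (\each i j q m k l p, emul (TU i j m * J k q * g q m * h l p * J p k) (d_divT i j l)).
have F6 := (\each i j q m k l p, emul (TU i j m * J k q * g q m * divT j l * J p k) (Uh i l p)).
have F7 := (\each i j q m k l p, emul (TU i j m * J k q * g q m * divT j l * h l p) (UJ i p k)).
have F8 := (\each i j q m k a, emul (TU i j m * J k q * g q m * U i j a) (flowJ a k)).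
have F9 := (\each i j q m k a, emul (TU i j m * J k q * g q m * U i a k) (flowJ j a)).
have F10 := (\each i j m l p v w, emul (TU i j m * h v w * nabT2 i v w j l * h l p) (JJ
  (fun q => g q m) p)).
have F11 := (\each i j m v w, emul (TU i j m * h v w) (gh (nabT2 i v w j) m)).
have H := esub (eadd E2 (eadd F8 (eadd F1 (eadd F4 (emul 4 F11)))))
  (eadd E1 (eadd F9 (eadd F2 (eadd F3 (emul 4 (eadd F5 (eadd F6 (eadd F7 F10)))))))).
by rewrite /UD in H *; tlc H.
Qed.

Definition sqtor := \sum_i \sum_j \sum_k \sum_a \sum_b \sum_c
  h i a * h j b * h k c * T i j k * T a b c.

(** The pairing of dg/dt with b1 occurs with -1 from the third inverse metric and with +2 from the
    metrics lowering the two torsions; the first two inverse metrics give -2 for b2. *)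
Lemma time_sqtor : D sqtor = 8 * \sum_i \sum_j \sum_k \sum_p \sum_l h p l * (TU i j k * nabT2 i p l j k)
  + pY b1U - 2 * pY b2U.
Proof.
rewrite -!time_metric_dot; [|exact: b2U_type|exact: b1U_type].
have E1 := (\each i j k a b c, emul (h j b * h k c * T i j k * T a b c) (time_inverse i a)).
have E2 := (\each i j k a b c, emul (h i a * h k c * T i j k * T a b c) (time_inverse j b)).
have E3 := (\each i j k a b c, emul (h i a * h j b * T i j k * T a b c) (time_inverse k c)).
have E4 := emul 2 time_chern_contr.
have E5 := emul 4 (\each i j k a b l x y, emul (U j i l * g l k * h i a * h j b * h k x * D
  (g x y)) (hg (t a b) y)).
have H := eadd (eadd E1 (eadd E2 E3)) (eadd E4 E5).
rewrite /sqtor /b1U /b2U /up2 /b1 /b2 /up3 /UD /gD in H *.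
by rewrite /ltor /tor in H *; tlc H.
Qed.

Lemma sqtor_E : sqtor = \sum_i \sum_j \sum_k TU i j k * T i j k.
Proof. by rewrite /sqtor /up3; tring. Qed.

Definition lap f := \sum_p \sum_l h p l * (d p (d l f) - \sum_a U p l a * d a f).

(** By [nabT2_bianchi] the leading term becomes the Laplacian of tau and cancels. The multiples of
    [rY b2U] add up to 8 - 4 - 4 and those of [rY b1U] to 2 - 2. There remains -8 (TOT1 + TOT2),
    made symmetric by [TOT1_E] and [TOT23_E] at the cost of -b1.b1 - 2 b1.b2. *)
Lemma heat_dot : D sqtor - lap sqtor =
  - 2 * \sum_p \sum_l \sum_i \sum_j \sum_k h p l * (NU p i j k * nabT l i j k)
  + (dot2 b1 b1U - 4 * dot2 b1 b2U + 4 * dot2 b2 b2U) - 4 * (TOT1 + TOT2 + TOT3).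
Proof.
rewrite /lap (laplacian_f sqtor_E) time_sqtor.
have K := (\each p l, emul (h p l) (nabT2_bianchi p l)).
have E1 := emul 8 nabT2_commutator.
have E2 := nabT2_commutator_twisted.
have P1 := pY_id b1U_type.
have P2 := pY_id b2U_type.
have Q1 := sY_id b1U_type.
have Q2 := sY_id b2U_type.
have X : dot2 b2 b1U = dot2 b1 b2U.
  by rewrite /dot2 /b1U /b2U /up2 /b1 /b2; tring.
have Z := TOT23_E.
tlc (esub (eadd E1 (eadd (emul 2 Q2) (eadd Q1 P1)))
  (eadd E2 (eadd TOT1_E (emul 2 (eadd K (eadd P2 (eadd X Z))))))).
Qed.

(** * The tensor B through the torsion *)

Definition levi_J i j k := d i (J j k) - \sum_a G i j a * J a k + \sum_a G i a k * J j a.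
Definition B1 i j := \sum_k \sum_l \sum_p \sum_q h k l * g p q * levi_J i k p * levi_J j l q.
Definition B2 i j := \sum_k \sum_l \sum_p \sum_q h k l * g p q * levi_J k i p * levi_J l j q.

Hypothesis DJE : forall i j k, levi_J i j k = 2 * \sum_a \sum_l h a l * T l j i * J a k.

Lemma JgJ p q : \sum_a \sum_b J p a * J q b * g a b = g p q.
Proof.
tlc (esub (\each a, emul (J p a) (Jg q a)) (JJ (fun a => g q a) p)).
Qed.

Lemma B1_b1 i j : B1 i j = 4 * b1 i j.
Proof.
rewrite /B1 /b1.
have E1 := \each k l p q, emul (h k l * g p q * levi_J j l q) (DJE i k p).
have E2 := \each k l p q a r, emul (h k l * g p q * h a r * T r k i * J a p) (DJE j l q).
have E3 := \each k l a r b s, emul (h k l * h a r * T r k i * h b s * T s l j) (JgJ a b).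
have E4 := \each k l a r, emul (h k l * h a r * T r k i) (gh (fun s => T s l j) a).
tlc (eadd E1 (emul 2 (eadd E2 (emul 2 (eadd E3 E4))))).
Qed.

Lemma B2_b2 i j : B2 i j = 4 * b2 i j.
Proof.
rewrite /B2 /b2.
have E1 := \each k l p q, emul (h k l * g p q * levi_J l j q) (DJE k i p).
have E2 := \each k l p q a r, emul (h k l * g p q * h a r * T r i k * J a p) (DJE l j q).
have E3 := \each k l a r b s, emul (h k l * h a r * T r i k * h b s * T s j l) (JgJ a b).
have E4 := \each k l a r, emul (h k l * h a r * T r i k) (gh (fun s => T s j l) a).
have E5 := \each k l r s, emul (h k l * h r s * T s j l) (TC r i k).
have E6 := \each k l r s, emul (h k l * h r s * T i r k) (TC s j l).
tlc (eadd E1 (emul 2 (eadd E2 (emul 2 (eadd E3 (eadd E4 (esub E5 E6))))))).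
Qed.

Variable qf : A.
Hypothesis qfE : 4 * qf = 1.
Definition B i j := qf * B1 i j - hf * B2 i j.

Lemma B_b i j : B i j = b1 i j - 2 * b2 i j.
Proof.
rewrite /B; tlc (eadd (esub (emul qf (B1_b1 i j)) (emul hf (B2_b2 i j)))
  (esub (emul (b1 i j) qfE) (emul (2 * b2 i j) hfE))).
Qed.

Lemma B_norm : \sum_i \sum_j \sum_a \sum_b h i a * h j b * B i j * B a b =
  dot2 b1 b1U - 4 * dot2 b1 b2U + 4 * dot2 b2 b2U.
Proof.
have E1 := \each i j a b, emul (h i a * h j b * B i j) (B_b a b).
have E2 := \each i j a b, emul (h i a * h j b * (b1 a b - 2 * b2 a b)) (B_b i j).
rewrite /dot2 /b1U /b2U /up2.
tlc (eadd E1 E2).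
Qed.

Definition sqnormB := \sum_i \sum_j \sum_a \sum_b h i a * h j b * B i j * B a b.
Definition sqnorm_nabT := \sum_i \sum_j \sum_k \sum_l \sum_a \sum_b \sum_c \sum_e
  h i a * h j b * h k c * h l e * nabT i j k l * nabT a b c e.
Definition curv_tor := \sum_a \sum_p \sum_b \sum_q \sum_c \sum_r \sum_e \sum_k \sum_l
  h a p * h b q * h c r * h k l * Om r p q e
  * (T e c k * T a b l + T k c e * T a l b + T k e c * T a l b).
Definition curv_tor4 := \sum_c \sum_r \sum_a \sum_p \sum_b \sum_q \sum_e \sum_k \sum_l
  h c r * h a p * h b q * h k l * Om r p q e
  * (T e c k * T a b l + 2 * (T k e c * T a l b)).
Definition pair_raised X Y := \sum_i \sum_j \sum_a \sum_b h i a * h j b * X i j * Y a b.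

Lemma sqN_NU : sqnorm_nabT = \sum_p \sum_l \sum_i \sum_j \sum_k h p l * (NU p i j k * nabT l i j k).
Proof. by rewrite /sqnorm_nabT /NU /up3; tring. Qed.

Lemma heat_main : D sqtor - lap sqtor = sqnormB - 2 * sqnorm_nabT - 4 * curv_tor.
Proof. by rewrite heat_dot /sqnormB B_norm sqN_NU /curv_tor /TOT1 /TOT2 /TOT3 /up3; tring. Qed.

(** Replacing [TOT2] by [TOT3] costs -2 b1.b2 by [TOT23_E], which turns the coefficient -4 in |b1 -
    2 b2|^2 into -6. *)
Lemma heat_main4 : D sqtor - lap sqtor = - 2 * sqnorm_nabT - 4 * curv_tor4 + (pair_raised b1 b1 - 6 * pair_raised b1 b2 + 4 * pair_raised b2 b2).
Proof.
have E := emul (- 2) TOT23_E.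
rewrite heat_dot sqN_NU; rewrite /pair_raised /dot2 /b1U /b2U /up2 /TOT1 /TOT2 /TOT3 /up3 in E *.
by rewrite /curv_tor4 /up3; tlc E.
Qed.
End Evolution.

(** * Real dimension four *)

Section Table.
Variable R : rcfType.
Variable F : 'I_4 -> 'I_4 -> 'I_4 -> R.
(* In the frame e_0, e_1 = J e_0, e_2, e_3 = J e_2 one has J e_a = sg a * e_(sw a). *)
Let sg (a : nat) : R := if odd a then -1 else 1.
Let sw (a : nat) : nat := if odd a then a.-1 else a.+1.
Let f (a b c : nat) : R := F (inord a) (inord b) (inord c).
Hypothesis FC : forall a b c, F a b c = - F b a c.
Hypothesis F12 : forall a b c : 'I_4, sg a * F (inord (sw a)) b c = sg b * F a (inord (sw b)) c.
Hypothesis F23 : forall a b c : 'I_4, sg b * F a (inord (sw b)) c = sg c * F a b (inord (sw c)).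

Let q1 i j := \sum_a \sum_c F a c i * F a c j.
Let q2 i j := \sum_a \sum_c F i a c * F j a c.

(** The symmetries leave F = (e^02 - e^13) u + (e^03 + e^12) v, with 2-forms in the first two slots,
    covectors u and v in the third, u orthogonal to v and |u| = |v|. Hence q1 = 4 (uu + vv) and q2 =
    L id with L = 2 |u|^2, and the sum is 8 L^2 - 24 L^2 + 16 L^2. *)
Lemma four_dim_quartic :
  \sum_i \sum_j (q1 i j * q1 i j - 6 * (q1 i j * q2 i j) + 4 * (q2 i j * q2 i j)) = 0.
Proof.
have fC a b c : f a b c = - f b a c by exact: FC.
have f12 a b c : (a < 4)%N -> (b < 4)%N -> sg a * f (sw a) b c = sg b * f a (sw b) c.
  by move=> a4 b4; have := F12 (inord a) (inord b) (inord c); rewrite !inordK.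
have f23 a b c : (b < 4)%N -> (c < 4)%N -> sg b * f a (sw b) c = sg c * f a b (sw c).
  by move=> a4 b4; have := F23 (inord a) (inord b) (inord c); rewrite !inordK.
have d0 a k : f a a k = 0 by have := fC a a k; lra.
have z01 k : f 0%N 1%N k = 0.
  by have := f12 0%N 0%N k isT isT; have := fC 0%N 1%N k; rewrite /sg /sw /=; lra.
have z23 k : f 2%N 3%N k = 0.
  by have := f12 2%N 2%N k isT isT; have := fC 2%N 3%N k; rewrite /sg /sw /=; lra.
have f12k k : f 1%N 2%N k = f 0%N 3%N k.
  by have := f12 0%N 2%N k isT isT; rewrite /sg /sw /=; lra.
have f13k k : f 1%N 3%N k = - f 0%N 2%N k.
  by have := f12 0%N 3%N k isT isT; rewrite /sg /sw /=; lra.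
pose x0 := f 0%N 2%N 0%N; pose x1 := f 0%N 3%N 0%N.
pose y0 := f 0%N 2%N 2%N; pose y1 := f 0%N 3%N 2%N.
have e021 : f 0%N 2%N 1%N = x1.
  by have := f23 0%N 2%N 0%N isT isT; rewrite /sg /sw /= /x1; lra.
have e031 : f 0%N 3%N 1%N = - x0.
  by have := f23 0%N 3%N 0%N isT isT; rewrite /sg /sw /= /x0; lra.
have e023 : f 0%N 2%N 3%N = y1.
  by have := f23 0%N 2%N 2%N isT isT; rewrite /sg /sw /= /y1; lra.
have e033 : f 0%N 3%N 3%N = - y0.
  by have := f23 0%N 3%N 2%N isT isT; rewrite /sg /sw /= /y0; lra.
pose u (k : nat) : R := match k with 0 => x0 | 1 => x1 | 2 => y0 | _ => y1 end%N.
pose v (k : nat) : R := match k with 0 => x1 | 1 => - x0 | 2 => y1 | _ => - y0 end%N.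
have fu k : (k < 4)%N -> f 0%N 2%N k = u k.
  by case: k => [|[|[|[|//]]]] _ /=.
have fv k : (k < 4)%N -> f 0%N 3%N k = v k.
  by case: k => [|[|[|[|//]]]] _ /=.
have FE (i j k : 'I_4) : F i j k = f i j k by rewrite /f !inord_val.
have S4 (G : 'I_4 -> R) : \sum_i G i = G (inord 0) + G (inord 1) + G (inord 2) + G (inord 3).
  rewrite !big_ord_recl big_ord0 addr0 !addrA.
  by congr (G _ + G _ + G _ + G _); apply: val_inj; rewrite /= inordK.
pose L := 2 * (x0 ^+ 2 + x1 ^+ 2 + y0 ^+ 2 + y1 ^+ 2).
have f10 k : f 1%N 0%N k = 0 by rewrite fC z01 oppr0.
have f32 k : f 3%N 2%N k = 0 by rewrite fC z23 oppr0.
have q1E (i j : 'I_4) : q1 i j = 4 * (u i * u j + v i * v j).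
  rewrite /q1 !S4 !FE !inordK // !d0 !z01 !f10 !z23 !f32 !f12k !f13k.
  rewrite ![f 2%N 0%N _]fC ![f 3%N 0%N _]fC ![f 2%N 1%N _]fC ![f 3%N 1%N _]fC.
  by rewrite !f12k !f13k !fu // !fv //; ring.
have q2E (i j : 'I_4) : q2 i j = L * (i == j)%:R.
  rewrite /q2 !S4 !FE !inordK //.
  case: i => [[|[|[|[|//]]]] ?]; case: j => [[|[|[|[|//]]]] ?];
  rewrite /= ?d0 ?z01 ?f10 ?z23 ?f32 ?f12k ?f13k;
  rewrite ?[f 2%N 0%N _]fC ?[f 3%N 0%N _]fC ?[f 2%N 1%N _]fC ?[f 3%N 1%N _]fC;
  rewrite ?f12k ?f13k ?fu // ?fv // /L /=; ring.
under eq_bigr => i _ do under eq_bigr => j _ do rewrite q1E q2E.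
rewrite !S4 !inordK //= -!val_eqE /= !inordK //= /L; ring.
Qed.
End Table.

Section Frame.
Variable R : rcfType.
Local Notation I := 'I_4.
Variables (g h J : I -> I -> R) (T : I -> I -> I -> R).
Hypothesis gC : forall i j, g i j = g j i.
Hypothesis hg : forall (X : I -> R) i, \sum_a \sum_b h i a * g a b * X b = X i.
Hypothesis g_pos : forall v : 'rV[R]_4, v != 0 ->
  0 < \sum_i \sum_j g i j * v 0 i * v 0 j.
Hypothesis JJt : forall (X : I -> R) i, \sum_a \sum_b J a b * J b i * X a = - X i.
Hypothesis Jg : forall i j, \sum_a J i a * g j a = - \sum_a J j a * g i a.
Hypothesis TC : forall i j k, T i j k = - T j i k.
Hypothesis T12 : forall i j k, \sum_a J i a * T a j k = \sum_a J j a * T i a k.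
Hypothesis T23 : forall i j k, \sum_a J j a * T i a k = \sum_a J k a * T i j a.

Ltac tring := tring_with (@zero_der R 4) (@zero_derD R 4)
  (@zero_derM R 4) [:: lift2 g] ltac:(exact: gC).
Tactic Notation "tlc" uconstr(H) := refine (lin_comb H _); tring.

Let ip (v w : I -> R) := \sum_i \sum_j g i j * v i * w j.
Let Jv (v : I -> R) j := \sum_i v i * J i j.

Let ipC v w : ip v w = ip w v. Proof. by rewrite /ip; tring. Qed.

Let ipJl v w : ip (Jv v) w = - ip v (Jv w).
Proof.
rewrite /ip /Jv.
tlc (\each i j, emul (v i * w j) (Jg i j)).
Qed.

Let JvJv v i : Jv (Jv v) i = - v i.
Proof. by rewrite /Jv; tlc (JJt v i). Qed.

Let ipJJ v w : ip (Jv v) (Jv w) = ip v w.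
Proof.
rewrite ipJl -[RHS]opprK; congr (- _); rewrite /ip -sumrN; apply: eq_bigr => i _.
by rewrite -sumrN; apply: eq_bigr => j _; rewrite JvJv mulrN.
Qed.

Let ipvJ v : ip v (Jv v) = 0.
Proof. by have := ipJl v v; rewrite ipC; lra. Qed.

Let ip_pos (v : I -> R) : (exists i, v i != 0) -> 0 < ip v v.
Proof.
case=> i vi; have := @g_pos (\row_j v j); rewrite /ip.
under eq_bigr => a _ do under eq_bigr => b _ do rewrite !mxE.
by apply; apply/eqP => /rowP/(_ i); rewrite !mxE => e; rewrite e eqxx in vi.
Qed.

Let unit_of (v : I -> R) : (exists i, v i != 0) -> exists2 c, ip (fun i => c * v i) (fun i => c
  * v i) = 1 & c != 0.
Proof.
move=> /ip_pos vp; exists (Num.sqrt (ip v v))^-1; last by rewrite invr_eq0 gt_eqF ?sqrtr_gt0.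
set c := _^-1; have -> : ip (fun i => c * v i) (fun i => c * v i) = c ^+ 2 * ip v v.
  by rewrite /ip expr2; tring.
by rewrite /c exprVn sqr_sqrtr ?ltW // mulVf // gt_eqF.
Qed.

(** Two linear conditions on four coordinates: the matrix M has rank at most 2, so its kernel is
    nonzero. *)
Let orthogonal (v w : I -> R) : exists2 u : I -> R, (exists i, u i != 0) & ip u v = 0 /\ ip u w = 0.
Proof.
pose M : 'M[R]_(4, 2) := \matrix_(i, k) \sum_j g i j * (if k == 0 then v j else w j).
have : kermx M != 0.
  rewrite -mxrank_eq0 mxrank_ker subn_eq0 -ltnNge.
  by rewrite (leq_ltn_trans (rank_leq_col M)).
case/rowV0Pn => u /sub_kermxP uM u0; exists (fun i => u 0 i).
  apply/existsP; move: u0; apply: contraNT; rewrite negb_exists => /forallP u0.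
  by apply/eqP/rowP => i; rewrite mxE; apply/eqP; have := u0 i; rewrite negbK.
have E (k : 'I_2) : \sum_i \sum_j g i j * u 0 i * (if k == 0 then v j else w j) = 0.
  have := congr1 (fun N : 'rV_2 => N 0 k) uM; rewrite !mxE => e; rewrite -[RHS]e.
  apply: eq_bigr => i _; rewrite mxE mulr_sumr; apply: eq_bigr => j _; ring.
by split; [exact: (E 0) | exact: (E 1)].
Qed.

(** The vector e_2 is taken orthogonal to e_0 and J e_0; since J is a skew isometry, J e_2 is then
    orthogonal to all three others. *)
Let frame : exists e : I -> I -> R,
  (forall a b, ip (e a) (e b) = (a == b)%:R) /\
  (forall (a : I) j, Jv (e a) j =
     (if odd a then -1 else 1) * e (inord (if odd a then a.-1 else a.+1)) j).
Proof.
have [|c0 n0 c0z] := @unit_of (fun i => (i == 0)%:R).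
  by exists 0; rewrite eqxx oner_neq0.
pose e0 (i : I) : R := c0 * (i == 0)%:R.
have [u unz [uv uw]] := orthogonal e0 (Jv e0).
have [c2 n2 c2z] := unit_of unz.
pose e2 (i : I) : R := c2 * u i.
have ipe2 w : ip e2 w = c2 * ip u w by rewrite /ip /e2; tring.
have n0' : ip e0 e0 = 1 := n0.
have n2' : ip e2 e2 = 1 := n2.
have e20 : ip e2 e0 = 0 by rewrite ipe2 uv mulr0.
have e21 : ip e2 (Jv e0) = 0 by rewrite ipe2 uw mulr0.
have e30 : ip (Jv e2) e0 = 0 by rewrite ipJl e21 oppr0.
pose e (a : I) : I -> R := match val a with
  0 => e0 | 1 => Jv e0 | 2 => e2 | _ => Jv e2 end%N.
exists e; split.
- move=> a b; rewrite -(inj_eq val_inj).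
  by case: a => [[|[|[|[|//]]]] ?]; case: b => [[|[|[|[|//]]]] ?];
    rewrite /e /= ?[ip e0 _]ipC ?[ip (Jv e0) _]ipC ?[ip (Jv e2) e2]ipC ?ipvJ
      ?ipJJ ?e20 ?e21 ?e30 ?n0' ?n2' ?mulr0n ?mulr1n.
- case=> [[|[|[|[|//]]]] ?] j; rewrite /e /= !inordK //=;
    by rewrite ?JvJv ?mulN1r ?mul1r.
Qed.

Let b1 i j := \sum_a \sum_b \sum_c \sum_e h a b * h c e * T a c i * T b e j.
Let b2 i j := \sum_a \sum_b \sum_c \sum_e h a b * h c e * T i a c * T j b e.
Let dot X Y := \sum_i \sum_j \sum_a \sum_b h i a * h j b * X i j * Y a b.

Lemma four_dim_identity : dot b1 b1 - 6 * dot b1 b2 + 4 * dot b2 b2 = 0.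
Proof.
have [e [eI eJ]] := frame.
pose E : 'M[R]_4 := \matrix_(a, i) e a i.
pose gm : 'M[R]_4 := \matrix_(i, j) g i j.
have EgE : E *m gm *m E^T = 1%:M.
  apply/matrixP => a b; rewrite !mxE -eI /ip exchange_big; apply: eq_bigr => j _.
  rewrite !mxE mulr_suml; apply: eq_bigr => i _; rewrite !mxE; ring.
have hgm : (\matrix_(i, j) h i j) *m gm = 1%:M.
  apply/matrixP => i j; rewrite !mxE -[RHS](hg (fun b => (b == j)%:R) i) /=.
  apply: eq_bigr => a _; rewrite (bigD1 j) //= big1 ?addr0 => [|b /negPf ->]; rewrite ?mulr0 //.
  by rewrite !mxE eqxx mulr1.
(* Orthonormality reads E g E^T = 1, so E^T E inverts g, and contractions with h become plain sums
   over the frame. *)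
have hE i j : h i j = \sum_a e a i * e a j.
  have : (\matrix_(i, j) h i j) = E^T *m E.
    have E1 : E^T *m E *m gm = 1%:M by rewrite -mulmxA; exact: mulmx1C.
    by rewrite -[RHS]mulmx1 -(mulmx1C hgm) mulmxA E1 mul1mx.
  move/matrixP/(_ i j); rewrite !mxE => ->.
  by apply: eq_bigr => a _; rewrite !mxE.
pose P (x y z : I -> R) := \sum_i \sum_j \sum_k x i * y j * z k * T i j k.
have PJ1 x y z : P (Jv x) y z = P x (Jv y) z.
  rewrite /P /Jv; tlc (\each i j k, emul (x i * y j * z k) (T12 i j k)).
have PJ2 x y z : P x (Jv y) z = P x y (Jv z).
  rewrite /P /Jv; tlc (\each i j k, emul (x i * y j * z k) (T23 i j k)).
have P1 s x y z : P (fun i => s * x i) y z = s * P x y z by rewrite /P; tring.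
have P2 s x y z : P x (fun i => s * y i) z = s * P x y z by rewrite /P; tring.
have P3 s x y z : P x y (fun i => s * z i) = s * P x y z by rewrite /P; tring.
have eJf a := funext (eJ a).
pose F a b c := P (e a) (e b) (e c).
have FC a b c : F a b c = - F b a c.
  rewrite /F /P; tlc (\each i j k, emul (e a i * e b j * e c k) (TC i j k)).
have Q := @four_dim_quartic R F FC
  (fun a b c => etrans (esym (P1 _ _ _ _)) (etrans (congr1 (fun v => P v _ _) (esym (eJf a)))
     (etrans (PJ1 _ _ _) (etrans (congr1 (fun v => P _ v _) (eJf b)) (P2 _ _ _ _)))))
  (fun a b c => etrans (esym (P2 _ _ _ _)) (etrans (congr1 (fun v => P _ v _) (esym (eJf b)))
     (etrans (PJ2 _ _ _) (etrans (congr1 (fun v => P _ _ v) (eJf c)) (P3 _ _ _ _))))).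
rewrite -[RHS]Q /dot /b1 /b2 /F /P.
have -> : h = (fun i j => \sum_a e a i * e a j) by apply/funext => i; apply/funext => j.
tring.
Qed.
End Frame.

(** * Smooth functions *)

Section SmoothClosure.
Variables (R : realType) (V : normedModType R) (W : set V).
Hypothesis W_open : open W.

Lemma near_W x : W x -> \near x, W x.
Proof. by move=> Wx; exact: open_nbhs_nbhs. Qed.

Lemma smooth_onD f v : smooth_on W f -> smooth_on W ('D_v f).
Proof. by move=> sf s x Wx; have := sf (rcons s v) x Wx; rewrite foldr_rcons. Qed.

Lemma smooth_on0 f : smooth_on W f -> forall x, W x ->
  {for x, continuous f} /\ forall v, derivable f x v.
Proof. by move=> sf x Wx; exact: (sf [::]). Qed.

(* Functions built from smooth ones; the class is stable under directional
   derivatives, which is what makes its members smooth. *)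
Inductive smooth_gen : (V -> R) -> Prop :=
  | gen_base f : smooth_on W f -> smooth_gen f
  | gen_cst c : smooth_gen (cst c)
  | gen_add f g : smooth_gen f -> smooth_gen g -> smooth_gen (f + g)
  | gen_mul f g : smooth_gen f -> smooth_gen g -> smooth_gen (f * g)
  | gen_inv f : (forall x, W x -> f x != 0) -> smooth_gen f ->
      smooth_gen (fun x => (f x)^-1)
  | gen_ext f g : (forall x, W x -> f x = g x) -> smooth_gen f -> smooth_gen g.

Lemma near_eqW (f g : V -> R) x : (forall x, W x -> f x = g x) -> W x ->
  \near x, f x = g x.
Proof. by move=> fg Wx; near=> y; apply: fg; near: y; exact: near_W. Unshelve. all: by end_near.
  Qed.

Lemma derive_eqW (f g : V -> R) v x : (forall x, W x -> f x = g x) -> W x ->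
  'D_v f x = 'D_v g x.
Proof.
by move=> fg Wx; apply: near_eq_derive; exact: near_eqW.
Qed.

Lemma gen_regular f : smooth_gen f -> forall x, W x ->
  {for x, continuous f} /\ forall v, derivable f x v.
Proof.
elim=> {f} [f /smooth_on0 //|c|f g _ IHf _ IHg|f g _ IHf _ IHg|f f0 _ IHf|f g fg _ IHf] x Wx.
- by split=> [|v]; [exact: cvg_cst | exact: derivable_cst].
- have [cf d_sqtor] := IHf x Wx; have [cg dg] := IHg x Wx.
  by split=> [|v]; [exact: continuousD | exact: derivableD].
- have [cf d_sqtor] := IHf x Wx; have [cg dg] := IHg x Wx.
  by split=> [|v]; [exact: continuousM | exact: derivableM].
- have [cf d_sqtor] := IHf x Wx.
  by split=> [|v]; [apply: continuousV => //; exact: f0 | apply: derivableV => //; exact: f0].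
have [cf d_sqtor] := IHf x Wx; split=> [|v].
  have E := near_eqW fg Wx; rewrite /prop_for /continuous_at -(fg x Wx).
  apply: cvg_trans cf; apply: near_eq_cvg.
  by near=> y; near: y.
by apply: near_eq_derivable (d_sqtor v) => //; exact: near_eqW.
Unshelve. all: by end_near. Qed.

Lemma gen_derive f v : smooth_gen f -> smooth_gen ('D_v f).
Proof.
elim=> {f} [f sf|c|f g sf IHf sg IHg|f g sf IHf sg IHg|f f0 sf IHf|f g fg sf IHf].
- exact/gen_base/smooth_onD.
- by apply: (gen_ext _ (gen_cst 0)) => x _; rewrite derive_cst.
- apply: (gen_ext _ (gen_add IHf IHg)) => x Wx.
  by rewrite deriveD //; [exact: (gen_regular sf Wx).2|exact: (gen_regular sg Wx).2].
- apply: (gen_ext _ (gen_add (gen_mul sf IHg) (gen_mul sg IHf))) => x Wx.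
  by rewrite deriveM //; [exact: (gen_regular sf Wx).2|exact: (gen_regular sg Wx).2].
- apply: (gen_ext _ (gen_mul (gen_mul (gen_cst (-1)) (gen_mul (gen_inv f0 sf)
  (gen_inv f0 sf))) IHf)) => x Wx.
  rewrite deriveV //; [|exact: f0|exact: (gen_regular sf Wx).2].
  by rewrite /GRing.scale /= expr2 invfM /cst /= mulN1r.
apply: (gen_ext _ IHf) => x Wx; exact: derive_eqW.
Qed.

Lemma gen_smooth f : smooth_gen f -> smooth_on W f.
Proof.
move=> sf s; suff: smooth_gen (foldr (fun v u => 'D_v u) f s) by exact: gen_regular.
by elim: s => //= v s; exact: gen_derive.
Qed.

Lemma derive_line (f : V -> R) x u (s : R) : derivable f (x + s *: u) u ->
  is_derive s 1 (fun r : R => f (x + r *: u)) ('D_u f (x + s *: u)).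
Proof.
move=> d_sqtor; have E : (fun h : R => h^-1 *: (((fun r => f (x + r *: u)) \o shift s) (h *: 1) - f (x
  + s *: u)))
   = (fun h => h^-1 *: ((f \o shift (x + s *: u)) (h *: u) - f (x + s *: u))).
  apply/funext => h /=; congr (_ *: (f _ - _)).
  by rewrite [h *: 1]mulr1 scalerDl addrCA.
by split; rewrite /derivable /derive E.
Qed.

Lemma mvt_line (f : V -> R) x u (s : R) : 0 < s ->
  (forall r, 0 <= r <= s -> derivable f (x + r *: u) u) ->
  exists2 r, 0 < r < s & f (x + s *: u) - f x = s * 'D_u f (x + r *: u).
Proof.
move=> s0 d_sqtor.
have [||r rs e] := @MVT R (fun r => f (x + r *: u)) (fun r => 'D_u f (x + r *: u)) 0 s s0.
- move=> r; rewrite in_itv /= => /andP[r0 rs]; apply: derive_line.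
  by apply: d_sqtor; rewrite !ltW.
- apply: derivable_within_continuous => r; rewrite in_itv /= => rs.
  by have [] := derive_line (d_sqtor r rs).
exists r; first by move: rs; rewrite in_itv.
by move: e; rewrite scale0r addr0 subr0 mulrC.
Qed.

(** The mean value theorem along u for y |-> f(y + s v) - f(y), then along v for the derivative of f
    in direction u. *)
Lemma mvt_square (f : V -> R) x u v (s : R) : 0 < s -> smooth_on W f ->
  (forall r q, 0 <= r <= s -> 0 <= q <= s -> W (x + r *: u + q *: v)) ->
  exists r q, [/\ 0 < r < s, 0 < q < s &
    f (x + s *: u + s *: v) - f (x + s *: u) - (f (x + s *: v) - f x)
    = s * (s * 'D_v ('D_u f) (x + r *: u + q *: v))].
Proof.
move=> s0 sf inW; have sge : 0 <= s <= s by rewrite ltW //=.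
have zge : 0 <= (0 : R) <= s by rewrite lexx ltW.
have shiftE y : (fun h : R => h^-1 *: (((fun y => f (y + s *: v)) \o shift y) (h *: u) - f (y
  + s *: v)))
  = (fun h => h^-1 *: ((f \o shift (y + s *: v)) (h *: u) - f (y + s *: v))).
  by apply/funext => h /=; rewrite addrA.
have dshift y : W (y + s *: v) -> is_derive y u (fun y => f (y + s *: v)) ('D_u f (y + s *: v)).
  move=> Wy; split; rewrite /derivable /derive shiftE //.
  exact: (smooth_on0 sf Wy).2.
have W0 r : 0 <= r <= s -> W (x + r *: u).
  by move=> rs; have := inW r 0 rs zge; rewrite scale0r addr0.
have dphi r : 0 <= r <= s -> is_derive (x + r *: u) u (fun y => f (y + s *: v) - f y)
   ('D_u f (x + r *: u + s *: v) - 'D_u f (x + r *: u)).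
  move=> rs; apply: is_deriveB; first exact: (dshift _ (inW _ _ rs sge)).
  by apply/derivableP; exact: (smooth_on0 sf (W0 _ rs)).2.
have [r rs E1] := @mvt_line (fun y => f (y + s *: v) - f y) x u s s0
  (fun r rs => @ex_derive _ _ _ _ _ _ _ (dphi r rs)).
have rs' : 0 <= r <= s by case/andP: rs => r0 rs; rewrite !ltW.
have [q qs E2] := @mvt_line ('D_u f) (x + r *: u) v s s0
  (fun q qs => (smooth_on0 (smooth_onD u sf) (inW _ _ rs' qs)).2 v).
exists r, q; split=> //; rewrite -E2 E1; congr (_ * _).
by have := dphi r rs' => d; rewrite derive_val.
Qed.

(** The second difference over a small parallelogram is symmetric in u and v. By [mvt_square] it is
    s^2 times either mixed derivative at some nearby point, and both mixed derivatives are
    continuous at x. *)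
Lemma schwarz f u v x : smooth_on W f -> W x -> 'D_u ('D_v f) x = 'D_v ('D_u f) x.
Proof.
move=> sf Wx; apply/eqP; rewrite -subr_eq0 -normr_eq0 eq_le normr_ge0 andbT.
apply/ler_addgt0Pr => e e0; rewrite add0r.
have e20 : 0 < e / 2 by rewrite divr_gt0.
have c1 := (smooth_on0 (smooth_onD u (smooth_onD v sf)) Wx).1.
have c2 := (smooth_on0 (smooth_onD v (smooth_onD u sf)) Wx).1.
have [d d0 D] : exists2 d : R, 0 < d & forall y, `|x - y| < d ->
   [/\ W y, `|'D_u ('D_v f) x - 'D_u ('D_v f) y| < e / 2
     & `|'D_v ('D_u f) x - 'D_v ('D_u f) y| < e / 2].
  have n1 : nbhs x [set y | `|'D_u ('D_v f) x - 'D_u ('D_v f) y| < e / 2].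
    by move/cvgrPdist_lt: c1; apply.
  have n2 : nbhs x [set y | `|'D_v ('D_u f) x - 'D_v ('D_u f) y| < e / 2].
    by move/cvgrPdist_lt: c2; apply.
  have nW : nbhs x W by exact: open_nbhs_nbhs.
  have [d /= d0 H] := (nbhs_normP x _).1 (filterI nW (filterI n1 n2)).
  by exists d; [exact: d0|move=> y xy; have [Wy [D1 D2]] := H y xy; exact: And3 Wy D1 D2].
(* Small enough to keep the parallelogram with sides s u and s v inside the ball of radius d; the
   summand 1 keeps the divisor positive when u = v = 0. *)
pose s := d / (2 * (`|u| + `|v| + 1)).
have k0 : 0 < `|u| + `|v| + 1 by rewrite ltr_wpDl // addr_ge0.
have s0 : 0 < s by rewrite divr_gt0 // mulr_gt0.
have near_sq r q : 0 <= r <= s -> 0 <= q <= s -> `|x - (x + r *: u + q *: v)| < d.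
  move=> /andP[r0 rs] /andP[q0 qs]; rewrite -addrA opprD addNKr normrN.
  rewrite (le_lt_trans (ler_normD _ _)) // !normrZ !ger0_norm //.
  apply: (@le_lt_trans _ _ (s * (`|u| + `|v|))).
    by rewrite mulrDr lerD // ler_wpM2r.
  apply: (@lt_le_trans _ _ (s * (2 * (`|u| + `|v| + 1)))).
    by rewrite ltr_pM2l //; have := normr_ge0 u; have := normr_ge0 v; lra.
  by rewrite /s divfK // gt_eqF // mulr_gt0.
have inW r q (rs : 0 <= r <= s) (qs : 0 <= q <= s) : W (x + r *: u + q *: v) by have [] := D _
  (near_sq _ _ rs qs).
have inW' r q (rs : 0 <= r <= s) (qs : 0 <= q <= s) : W (x + r *: v
  + q *: u) by rewrite addrAC; exact: inW.
have [r [q [rs qs E1]]] := mvt_square s0 sf inW.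
have [r' [q' [rs' qs' E2]]] := mvt_square s0 sf inW'.
have lt2 (a b : R) : 0 < a < b -> 0 <= a <= b by case/andP => a0 ab; rewrite !ltW.
have E : 'D_v ('D_u f) (x + r *: u + q *: v) = 'D_u ('D_v f) (x + r' *: v + q' *: u).
  have sn0 : s != 0 by rewrite gt_eqF.
  apply: (mulfI sn0); apply: (mulfI sn0); apply: etrans (esym E1) (etrans _ E2).
  rewrite [x + s *: v + s *: u]addrAC.
  move: (f (x + s *: u + s *: v)) (f (x + s *: u)) (f (x + s *: v)) (f x) => a b c k.
  by ring.
have [_ _ B1] := D _ (near_sq _ _ (lt2 _ _ rs) (lt2 _ _ qs)).
have := near_sq _ _ (lt2 _ _ qs') (lt2 _ _ rs'); rewrite addrAC => /D[_ B2 _].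
move: B1 B2; rewrite E.
move: ('D_u ('D_v f) x) ('D_v ('D_u f) x) ('D_u ('D_v f) _) => a b c B1 B2.
apply: le_trans (ler_distD c a b) _.
rewrite [e]splitr [`|c - b|]distrC; apply: lerD; apply: ltW; [exact: B2|exact: B1].
Qed.
End SmoothClosure.

(** * The ring of smooth functions on an open set *)

Section SmoothRing.
Variables (R : realType) (V : normedModType R) (W : set V).
Hypothesis W_open : open W.

(* Extension by 0 outside W makes equality of elements equality on W. *)
Definition smf_pred (oW : open W) : pred (V -> R) :=
  fun f => `[< smooth_on W f /\ forall x, ~ W x -> f x = 0 >].
Definition smf := {f : V -> R | smf_pred W_open f}.
HB.instance Definition _ := Choice.on smf.
Implicit Types a b c : smf.

Definition restrict (f : V -> R) : V -> R := fun x => if `[< W x >] then f x else 0.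

Lemma restrict_in f x : W x -> restrict f x = f x.
Proof. by rewrite /restrict => /asboolP ->. Qed.

Lemma restrictP f : smooth_gen W f -> smf_pred W_open (restrict f).
Proof.
move=> sf; apply/asboolP; split=> [|x nW]; last first.
  by rewrite /restrict; case: asboolP.
apply: (gen_smooth W_open); apply: gen_ext sf => x Wx; by rewrite restrict_in.
Qed.

Definition mk_smf f (sf : smooth_gen W f) : smf := Sub (restrict f) (restrictP sf).

Lemma smf_gen a : smooth_gen W (val a).
Proof. by apply: gen_base; have /asboolP[] := valP a. Qed.

Lemma smf_out a x : ~ W x -> val a x = 0.
Proof. by have /asboolP[_] := valP a; exact. Qed.

Lemma smfP a b : (forall x, W x -> val a x = val b x) -> a = b.
Proof.
move=> ab; apply: val_inj; apply/funext => x.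
by have [/ab|nW] := pselect (W x); rewrite // !smf_out.
Qed.

Lemma val_mk f (sf : smooth_gen W f) x : W x -> val (mk_smf sf) x = f x.
Proof. exact: restrict_in. Qed.

Definition szero := mk_smf (gen_cst W 0).
Definition sone := mk_smf (gen_cst W 1).
Definition sadd a b := mk_smf (gen_add (smf_gen a) (smf_gen b)).
Definition smul a b := mk_smf (gen_mul (smf_gen a) (smf_gen b)).
Definition sopp a := mk_smf (gen_mul (gen_cst W (-1)) (smf_gen a)).

Lemma szeroE x : val szero x = 0.
Proof. by rewrite /= /restrict; case: ifP. Qed.
Lemma soneE x : W x -> val sone x = 1.
Proof. by move=> Wx; rewrite val_mk. Qed.
Lemma saddE a b x : val (sadd a b) x = val a x + val b x.
Proof.
have [Wx|nW] := pselect (W x); first by rewrite val_mk.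
by rewrite !smf_out // addr0.
Qed.
Lemma smulE a b x : val (smul a b) x = val a x * val b x.
Proof.
have [Wx|nW] := pselect (W x); first by rewrite val_mk.
by rewrite !smf_out // mulr0.
Qed.
Lemma soppE a x : val (sopp a) x = - val a x.
Proof.
have [Wx|nW] := pselect (W x); first by rewrite val_mk //= mulN1r.
by rewrite !smf_out // oppr0.
Qed.

Fact saddA : associative sadd.
Proof. by move=> a b c; apply: smfP => x _; rewrite !saddE addrA. Qed.
Fact saddC : commutative sadd.
Proof. by move=> a b; apply: smfP => x _; rewrite !saddE addrC. Qed.
Fact sadd0 : left_id szero sadd.
Proof. by move=> a; apply: smfP => x _; rewrite saddE szeroE add0r. Qed.
Fact saddN : left_inverse szero sopp sadd.
Proof. by move=> a; apply: smfP => x _; rewrite saddE soppE szeroE addNr. Qed.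

HB.instance Definition _ := GRing.isZmodule.Build smf saddA saddC sadd0 saddN.

Fact smulA : associative smul.
Proof. by move=> a b c; apply: smfP => x _; rewrite !smulE mulrA. Qed.
Fact smulC : commutative smul.
Proof. by move=> a b; apply: smfP => x _; rewrite !smulE mulrC. Qed.
Fact smul1 : left_id sone smul.
Proof. by move=> a; apply: smfP => x Wx; rewrite smulE soneE // mul1r. Qed.
Fact smulDl : left_distributive smul (+%R : smf -> smf -> smf).
Proof. by move=> a b c; apply: smfP => x _; rewrite saddE !smulE saddE mulrDl. Qed.

(** For empty W this is the zero ring, hence a structure that allows 1 = 0; the unit is the
    indicator function of W. *)
HB.instance Definition _ := GRing.Zmodule_isComPzRing.Build smf smulA smulC smul1 smulDl.

Definition ev (x : V) (a : smf) : R := val a x.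

Lemma evD x a b : ev x (a + b) = ev x a + ev x b. Proof. exact: saddE. Qed.
Lemma evM x a b : ev x (a * b) = ev x a * ev x b. Proof. exact: smulE. Qed.
Lemma evN x a : ev x (- a) = - ev x a. Proof. exact: soppE. Qed.
Lemma ev0 x : ev x 0 = 0. Proof. exact: szeroE. Qed.
Lemma ev1 x : W x -> ev x 1 = 1. Proof. exact: soneE. Qed.
Lemma ev_sum x (I : finType) (F : I -> smf) : ev x (\sum_i F i) = \sum_i ev x (F i).
Proof. exact: (big_morph (ev x) (evD x) (ev0 x)). Qed.
Lemma ev_nat x n : W x -> ev x n%:R = n%:R.
Proof. by move=> Wx; elim: n => [|n IH]; rewrite ?ev0 // !mulrS evD IH ev1. Qed.

Definition scst (k : R) : smf := mk_smf (gen_cst W k).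

Definition sder v a : smf := mk_smf (gen_derive W_open v (smf_gen a)).
Lemma ev_der v x a : W x -> ev x (sder v a) = 'D_v (val a) x. Proof. exact: val_mk. Qed.

Lemma sder_derivable v a x : W x -> derivable (val a) x v.
Proof. by move=> Wx; exact: (gen_regular W_open (smf_gen a) Wx).2. Qed.

Lemma sderD v a b : sder v (a + b) = sder v a + sder v b.
Proof.
apply: smfP => x Wx; have E : val (a + b) = val a + val b by apply/funext => y; exact: saddE.
rewrite [RHS]saddE; have := ev_der v (a + b) Wx; rewrite E deriveD; try exact: sder_derivable.
by rewrite /ev => ->; congr (_ + _); rewrite -/(ev x _) ev_der.
Qed.

Lemma sderM v a b : sder v (a * b) = sder v a * b + a * sder v b.
Proof.
apply: smfP => x Wx; have E : val (a * b) = val a * val b by apply/funext => y; exact: smulE.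
rewrite [RHS]saddE; have := ev_der v (a * b) Wx; rewrite E deriveM; try exact: sder_derivable.
rewrite /ev => ->; rewrite addrC; congr (_ + _); rewrite smulE -[val
  (sder _ _) _]/(ev x _) ev_der //.
exact: mulrC.
Qed.

Lemma sderC u v a : sder u (sder v a) = sder v (sder u a).
Proof.
apply: smfP => x Wx; rewrite -!/(ev x _) !(ev_der _ _ Wx).
have E (p q : V) : 'D_p (val (sder q a)) x = 'D_p ('D_q (val a)) x.
  by apply: (derive_eqW W_open) Wx => y Wy; exact: ev_der.
have /asboolP[sa _] := valP a.
rewrite !E; exact: (schwarz W_open _ _ sa Wx).
Qed.

Lemma smf_two_reg a : 2 * a = 0 -> a = 0.
Proof.
move=> a2; apply: smfP => x Wx; have := congr1 (ev x) a2.
rewrite evM ev_nat // ev0 -/(ev x a) -/(ev x 0) ev0; lra.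
Qed.

End SmoothRing.

(** * Smoothness of inverse matrices *)

Section SmoothMatrix.
Variables (R : realType) (V : normedModType R) (W : set V).

Lemma gen_sum (I : Type) (r : seq I) (F : I -> V -> R) :
  (forall i, smooth_gen W (F i)) -> smooth_gen W (fun x => \sum_(i <- r) F i x).
Proof.
move=> sF; elim: r => [|i r IH].
  by apply: gen_ext (gen_cst W 0) => x _; rewrite big_nil.
by apply: gen_ext (gen_add (sF i) IH) => x _; rewrite big_cons.
Qed.

Lemma gen_prod (I : Type) (r : seq I) (F : I -> V -> R) :
  (forall i, smooth_gen W (F i)) -> smooth_gen W (fun x => \prod_(i <- r) F i x).
Proof.
move=> sF; elim: r => [|i r IH].
  by apply: gen_ext (gen_cst W 1) => x _; rewrite big_nil.
by apply: gen_ext (gen_mul (sF i) IH) => x _; rewrite big_cons.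
Qed.

Lemma gen_det m (A : V -> 'M[R]_m) :
  (forall i j, smooth_gen W (fun x => A x i j)) -> smooth_gen W (fun x => \det (A x)).
Proof.
move=> sA; pose F (s : {perm 'I_m}) x := (-1) ^+ s * \prod_i A x i (s i).
apply: (@gen_ext _ _ _ (fun x => \sum_s F s x)) => [x _ //|].
apply: gen_sum => s; apply: (gen_mul (gen_cst W ((-1) ^+ s))).
by apply: gen_prod => i; exact: sA.
Qed.

(** By the cofactor formula the entries of the inverse are polynomials in the entries of A divided
    by the determinant. *)
Lemma gen_invmx m (A : V -> 'M[R]_m) i j :
  (forall i j, smooth_gen W (fun x => A x i j)) ->
  (forall x, W x -> \det (A x) != 0) -> smooth_gen W (fun x => invmx (A x) i j).
Proof.
move=> sA dA.
have sC : smooth_gen W (fun x => cofactor (A x) j i).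
  apply: (gen_mul (gen_cst W _)); apply: gen_det => k l.
  by apply: gen_ext (sA (lift j k) (lift i l)) => x _; rewrite !mxE.
apply: gen_ext (gen_mul (gen_inv dA (gen_det sA)) sC) => x Wx.
by rewrite /invmx unitmxE unitfE dA // !mxE.
Qed.

End SmoothMatrix.

Section Gram.
Variables (R : realType) (m : nat) (g : 'I_m -> 'I_m -> R).
Hypothesis gC : forall i j, g i j = g j i.
Hypothesis g_pos : forall v : 'rV[R]_m, v != 0 ->
  0 < \sum_i \sum_j g i j * v 0 i * v 0 j.
Let gM : 'M[R]_m := \matrix_(a, b) g a b.

Lemma gram_det : \det gM != 0.
Proof.
apply/negP => /det0P [v v0 vg]; have := g_pos v0; rewrite exchange_big /=.
rewrite big1 ?ltxx // => j _; rewrite -mulr_suml.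
have := congr1 (fun M : 'rV[R]_m => M 0 j) vg; rewrite !mxE => E.
rewrite [X in X * _](_ : _ = 0) ?mul0r // -[RHS]E; apply: eq_bigr => i _.
by rewrite !mxE mulrC.
Qed.

Lemma gram_unit : gM \in unitmx.
Proof. by rewrite unitmxE unitfE gram_det. Qed.

Lemma gram_invC i j : invmx gM i j = invmx gM j i.
Proof.
have gT : gM^T = gM by apply/matrixP => a b; rewrite !mxE gC.
by rewrite -[in RHS]gT -trmx_inv mxE.
Qed.

Lemma gram_mulV i k : \sum_a invmx gM i a * g a k = (i == k)%:R.
Proof.
have := congr1 (fun M : 'M[R]_m => M i k) (mulVmx gram_unit); rewrite !mxE => <-.
by apply: eq_bigr => a _; rewrite mxE.
Qed.

End Gram.

Section Pairs.
Variables (A : comPzRingType) (m : nat).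

(* Contracting with X lets the identity matrix be eliminated without
   Kronecker deltas. *)
Lemma contract_pair (P Q : 'I_m -> 'I_m -> A) (e : A) :
  (forall i k, \sum_a P i a * Q a k = if i == k then e else 0) ->
  forall X i, \sum_a \sum_b P i a * Q a b * X b = e * X i.
Proof.
move=> PQ X i; rewrite exchange_big (bigD1 i) //= [X in _ + X]big1 => [|b bi].
  by rewrite addr0 -mulr_suml PQ eqxx.
by rewrite -mulr_suml PQ eq_sym (negPf bi) mul0r.
Qed.
End Pairs.

(** * Transfer to a chart *)

Section SpaceTime.
Variables (R : realType) (m : nat) (T : set R) (Q : set 'rV[R]_m).
Hypothesis T_open : open T.
Hypothesis Q_open : open Q.
Local Notation V := (R * 'rV[R]_m)%type.
Let W : set V := T `*` Q.

Lemma spacetime_open : open W.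
Proof.
rewrite openE => -[t x] [/= Tt Qx].
by exists (T, Q) => //; split; exact: open_nbhs_nbhs.
Qed.

Local Notation A := (smf (spacetime_open)).

Definition axis (o : option 'I_m) : V :=
  if o is Some i then (0, delta_mx 0 i) else (1, 0).

Definition sder_axis o (a : A) : A := sder (axis o) a.

Lemma ev_pd i (f : 'rV[R]_m -> R) t x (a : A) : T t -> Q x ->
  (forall y, Q y -> f y = ev (t, y) a) -> pd i f x = ev (t, x) (sder_axis (Some i) a).
Proof.
move=> Tt Qx fa; rewrite ev_der; last by split.
rewrite /pd (@derive_eqW _ _ _ Q_open f (fun y => val a (t, y))) //.
rewrite /derive (_ : (fun h : R => _) = (fun h : R => h^-1 *:
  (val a (h *: axis (Some i) + (t, x)) - val a (t, x)))) //.
apply/funext => h /=; congr (_ *: (val a _ - _)).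
by rewrite -[RHS]/(h *: 0 + t, h *: delta_mx 0 i + x) scaler0 add0r.
Qed.

Lemma ev_dt (f : R -> R) t x (a : A) : T t -> Q x ->
  (forall s, T s -> f s = ev (s, x) a) -> derive1 f t = ev (t, x) (sder_axis None a).
Proof.
move=> Tt Qx fa; rewrite ev_der; last by split.
rewrite derive1E (@derive_eqW _ _ _ T_open f (fun s => val a (s, x))) //.
rewrite /derive (_ : (fun h : R => _) = (fun h : R => h^-1 *:
  (val a (h *: axis None + (t, x)) - val a (t, x)))) //.
apply/funext => h /=; congr (_ *: (val a _ - _)).
by rewrite -[RHS]/(h *: 1 + t, h *: 0 + x) scaler0 add0r.
Qed.
End SpaceTime.

Section Curvature.
Variables (R : realType) (m : nat) (U : 'I_m -> 'I_m -> 'I_m -> 'rV[R]_m -> R).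

Lemma cov_coord_vec d : cov_vec U (coord_vec d) = fun b k => U b d k.
Proof.
apply/funext => b; apply/funext => k; apply/funext => x.
rewrite /cov_vec /pd derive_cst add0r (bigD1 d) //= /coord_vec eqxx mulr1.
by rewrite big1 ?addr0 // => a /negPf ->; rewrite mulr0.
Qed.

(** Antisymmetrising the second covariant derivative leaves a term -tau_ab^e U_ed^k, which the
    torsion term of the definition cancels. *)
Lemma curvatureE a b d k x : curvature U a b d k x =
  pd a (U b d k) x - pd b (U a d k) x + \sum_e U a e k x * U b d e x
  - \sum_e U b e k x * U a d e x.
Proof.
rewrite /curvature /cov2_vec cov_coord_vec /cov_end /torsion.
under [X in _ + X]eq_bigr do rewrite mulrBl.
by rewrite sumrB; ring.
Qed.
End Curvature.

Section Flow.
Variables (R : realType) (m : nat) (M : manifold R m).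
Variables (T : set R) (g J : R -> field2 M) (U G : R -> field3 M).
Hypothesis T_open : open T.
Hypothesis U_chern : forall t, T t -> chern_connection (g t) (J t) (U t).
Hypothesis G_levi_civita : forall t, T t -> levi_civita_connection (g t) (G t).
Hypothesis flow : symplectic_curvature_flow T g J U G.
Variable c : chart M.

Local Notation Q := (chart_img c).
Fact Q_open : open Q. Proof. exact: chart_img_open. Qed.
Local Notation W_open := (spacetime_open T_open Q_open).
Local Notation A := (smf W_open).
Local Notation der := (@sder_axis R m T Q T_open Q_open).

Let g_smooth : smooth_family T g. Proof. by case: flow. Qed.
Let J_smooth : smooth_family T J. Proof. by case: flow. Qed.
Let kahler t : T t -> almost_kahler (g t) (J t). Proof. by case: flow => _ _ H _ _; exact: H. Qed.

Section Pointwise.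
Variables (t : R) (x : 'rV[R]_m).
Hypotheses (Tt : T t) (Qx : Q x).

Lemma metric_sym i j : g t c i j x = g t c j i x.
Proof. by case: (kahler Tt) => -[_ H _] _ _ _; exact: H. Qed.

Lemma metric_pos (v : 'rV[R]_m) : v != 0 -> 0 < \sum_i \sum_j g t c i j x * v 0 i * v 0 j.
Proof. by case: (kahler Tt) => -[_ _ H] _ _ _; exact: H. Qed.

Lemma metric_det : \det (\matrix_(a, b) g t c a b x) != 0.
Proof. exact: (gram_det metric_pos). Qed.

Lemma ginv_sym i j : ginv (g t c) i j x = ginv (g t c) j i x.
Proof. exact: (gram_invC metric_sym). Qed.

Lemma ginv_mul i k : \sum_a ginv (g t c) i a x * g t c a k x = (i == k)%:R.
Proof. exact: (gram_mulV metric_pos). Qed.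

Lemma J_square i k : \sum_a J t c i a x * J t c a k x = - (i == k)%:R.
Proof. by case: (kahler Tt) => _ [_ H] _ _; exact: H. Qed.

Lemma J_isometry i j : \sum_a \sum_b J t c i a x * J t c j b x * g t c a b x = g t c i j x.
Proof. by case: (kahler Tt) => _ _ H _; exact: H. Qed.
End Pointwise.

Definition gA i j : A := mk_smf W_open (gen_base (@g_smooth c i j)).
Definition JA i j : A := mk_smf W_open (gen_base (@J_smooth c i j)).

Lemma ginv_gen i j : smooth_gen (T `*` Q) (fun z : R * 'rV[R]_m => ginv (g z.1 c) i j z.2).
Proof.
apply: gen_invmx => [k l|[t x] [/= Tt Qx]]; last exact: metric_det.
by apply: gen_ext (gen_base (@g_smooth c k l)) => z _; rewrite mxE.
Qed.
Definition hA i j : A := mk_smf W_open (ginv_gen i j).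
Definition hf : A := scst W_open 2^-1.
Definition qf : A := scst W_open 4^-1.
Local Notation DJA := (levi_J der JA).
(** The formulas [christoffel] and, for [UA], [chern_formula], read as definitions in the ring;
    [rep_G] and [rep_U] identify them with the given connections. *)
Definition GA i j k : A := hf * \sum_l hA k l *
  (der (Some i) (gA j l) + der (Some j) (gA i l) - der (Some l) (gA i j)).
Definition UA i j k : A := GA i j k - hf * \sum_a DJA GA i j a * JA a k.

Lemma rep_g t x i j : T t -> Q x -> g t c i j x = ev (t, x) (gA i j).
Proof. by move=> Tt Qx; rewrite [RHS]val_mk. Qed.
Lemma rep_J t x i j : T t -> Q x -> J t c i j x = ev (t, x) (JA i j).
Proof. by move=> Tt Qx; rewrite [RHS]val_mk. Qed.
Lemma rep_h t x i j : T t -> Q x -> ginv (g t c) i j x = ev (t, x) (hA i j).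
Proof. by move=> Tt Qx; rewrite [RHS]val_mk. Qed.
Lemma rep_hf t x : T t -> Q x -> 2^-1 = ev (t, x) hf.
Proof. by move=> Tt Qx; rewrite [RHS]val_mk. Qed.
Lemma rep_qf t x : T t -> Q x -> 4^-1 = ev (t, x) qf.
Proof. by move=> Tt Qx; rewrite [RHS]val_mk. Qed.
Lemma rep_nat t x k : T t -> Q x -> k%:R = ev (t, x) (k%:R : A).
Proof. by move=> Tt Qx; rewrite ev_nat. Qed.

Create HintDb rep discriminated.
#[local] Hint Resolve rep_g rep_J rep_h rep_hf rep_qf rep_nat : rep.
(** Structural recursion proving that a coordinate expression is the value at (t, x) of a ring
    element. For a spatial derivative [ev_pd] asks for the representation on the whole slice Q at
    time t. *)
Ltac rep := lazymatch goal with
  | |- _ = ev _ (\sum_i _) => rewrite ev_sum; apply: eq_bigr => ? _; rep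
  | |- _ = ev _ (_ * _) => rewrite evM; apply: f_equal2; rep
  | |- _ = ev _ (_ + _) => rewrite evD; apply: f_equal2; rep
  | |- _ = ev _ (- _) => rewrite evN; apply: f_equal; rep
  | |- pd _ _ _ = ev _ (_ (Some _) _) => apply: ev_pd; [assumption|assumption|move=> ? ?; rep]
  | |- _ => auto with rep nocore
  end.

Let smf_eq (a b : A) : (forall t x, T t -> Q x -> ev (t, x) a = ev (t, x) b) -> a = b.
Proof. by move=> ab; apply: smfP => -[t x] [Tt Qx]; exact: ab. Qed.

Lemma rep_w t x i j : T t -> Q x ->
  kform (g t c) (J t c) i j x = ev (t, x) (\sum_a JA i a * gA j a).
Proof. by move=> Tt Qx; rewrite /kform; rep. Qed.
#[local] Hint Resolve rep_w : rep.

Let derD o (a b : A) : der o (a + b) = der o a + der o b. Proof. exact: sderD. Qed.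
Let derM o (a b : A) : der o (a * b) = der o a * b + a * der o b. Proof. exact: sderM. Qed.
Let derC o p (a : A) : der o (der p a) = der p (der o a). Proof. exact: sderC. Qed.
Let A_two_reg (a : A) : 2 * a = 0 -> a = 0. Proof. exact: smf_two_reg. Qed.

Lemma der_w o j k : der o (\sum_a JA j a * gA k a) =
  \sum_a (der o (JA j a) * gA k a + JA j a * der o (gA k a)).
Proof. by rewrite (der_sum derD); apply: eq_bigr => a _; rewrite derM. Qed.

Lemma rep_dw t x i j k : T t -> Q x -> pd i (kform (g t c) (J t c) j k) x =
  ev (t, x) (\sum_a (der (Some i) (JA j a) * gA k a + JA j a * der (Some i) (gA k a))).
Proof. by move=> Tt Qx; rewrite -der_w; rep. Qed.

Section Connections.
Variables (t : R) (x : 'rV[R]_m).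
Hypotheses (Tt : T t) (Qx : Q x).
Local Notation g_ := (fun i j => g t c i j x).
Local Notation h_ := (fun i j => ginv (g t c) i j x).
Local Notation J_ := (fun i j => J t c i j x).
Local Notation dg_ := (fun i j k => pd i (g t c j k) x).
Local Notation dJ_ := (fun i j k => pd i (J t c j k) x).
Local Notation U_ := (fun i j k => U t c i j k x).
Local Notation G_ := (fun i j k => G t c i j k x).

Lemma contract_hg (X : 'I_m -> R) i : \sum_a \sum_b h_ i a * g_ a b * X b = X i.
Proof.
rewrite (contract_pair (e := 1)) ?mul1r // => j k.
by rewrite (ginv_mul Tt Qx); case: eqP.
Qed.

Lemma contract_gh (X : 'I_m -> R) i : \sum_a \sum_b g_ i a * h_ a b * X b = X i.
Proof.
rewrite (contract_pair (e := 1)) ?mul1r // => j k.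
transitivity (\sum_a h_ k a * g_ a j); last by rewrite (ginv_mul Tt Qx) eq_sym; case: eqP.
by apply: eq_bigr => a _; rewrite mulrC (ginv_sym Tt Qx) (metric_sym Tt Qx).
Qed.

Lemma contract_JJ (X : 'I_m -> R) i : \sum_a \sum_b J_ i a * J_ a b * X b = - X i.
Proof.
rewrite (contract_pair (e := -1)) ?mulN1r // => j k.
by rewrite (J_square Tt Qx); case: eqP; rewrite ?oppr0.
Qed.

Lemma contract_JJt (X : 'I_m -> R) i : \sum_a \sum_b J_ a b * J_ b i * X a = - X i.
Proof.
transitivity (\sum_a - (a == i)%:R * X a).
  by apply: eq_bigr => a _; rewrite -mulr_suml (J_square Tt Qx).
rewrite (bigD1 i) //= eqxx big1 ?addr0 ?mulN1r // => a /negPf ->.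
by rewrite oppr0 mul0r.
Qed.

Lemma pd_metric_sym i j k : dg_ i j k = dg_ i k j.
Proof. by apply: (derive_eqW Q_open) Qx => y Qy; exact: metric_sym. Qed.

Lemma chern_w i j k : dkf g_ J_ dg_ dJ_ i j k =
  \sum_a U_ i j a * kf g_ J_ a k + \sum_a U_ i k a * kf g_ J_ j a.
Proof.
case: (U_chern Tt) => _ H _ _; move: (H c i j k x Qx); rewrite /cov_form2 rep_dw //.
rewrite /dkf /kf /kform => E.
have -> : \sum_a (dJ_ i j a * g_ k a + J_ j a * dg_ i k a) =
  ev (t, x) (\sum_a (der (Some i) (JA j a) * gA k a + JA j a * der (Some i) (gA k a))) by rep.
by move: E; lra.
Qed.

Lemma chern_J i j k : dJ_ i j k = \sum_a U_ i j a * J_ a k - \sum_a U_ i a k * J_ j a.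
Proof. by case: (U_chern Tt) => _ _ H _; move: (H c i j k x Qx); rewrite /cov_end; lra. Qed.

Lemma chern_t i j k : tor U_ i j k = - \sum_a \sum_b J_ i a * J_ j b * tor U_ a b k.
Proof. by case: (U_chern Tt) => _ _ _ H; exact: (H c i j k x Qx). Qed.

Lemma kform_closed i j k : dkf g_ J_ dg_ dJ_ i j k + dkf g_ J_ dg_ dJ_ j k i
  + dkf g_ J_ dg_ dJ_ k i j = 0.
Proof.
case: (kahler Tt) => _ _ _ H; move: (H c i j k x Qx) => /=; rewrite !rep_dw // => E.
by rewrite -[RHS]E; congr (_ + _ + _); rewrite /dkf; rep.
Qed.

Lemma levi_sym i j k : G_ i j k = G_ j i k.
Proof. by case: (G_levi_civita Tt) => _ H _; move: (H c i j k x Qx); rewrite /torsion; lra. Qed.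

Lemma levi_metric i j k : dg_ i j k = \sum_a G_ i j a * g_ a k + \sum_a G_ i k a * g_ j a.
Proof. by case: (G_levi_civita Tt) => _ _ H; move: (H c i j k x Qx); rewrite /cov_form2; lra. Qed.

Let R_two_reg (a : R) : 2 * a = 0 -> a = 0. Proof. by lra. Qed.

(* Smoothness in time of the connections is not assumed: it follows from explicit
   formulas for them in terms of g and J. *)
Lemma rep_G i j k : G t c i j k x = ev (t, x) (GA i j k).
Proof.
have E := christoffel (metric_sym Tt Qx) (ginv_sym Tt Qx) contract_hg levi_sym levi_metric i j k.
transitivity (2^-1 * (2 * G t c i j k x)); first by rewrite mulKf // pnatr_eq0.
by rewrite E /GA; rep.
Qed.

Lemma rep_U i j k : U t c i j k x = ev (t, x) (UA i j k).
Proof.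
have E := chern_formula R_two_reg (metric_sym Tt Qx) (ginv_sym Tt Qx) contract_hg
  contract_JJ contract_JJt pd_metric_sym (J_isometry Tt Qx) chern_w chern_J chern_t kform_closed
  levi_sym levi_metric i j k.
transitivity (2^-1 * (2 * U t c i j k x)); first by rewrite mulKf // pnatr_eq0.
rewrite E mulrBr mulKf ?pnatr_eq0 // rep_G /UA /levi_J /covJ.
by rep; rewrite ?rep_G.
Qed.
End Connections.
#[local] Hint Resolve rep_G rep_U : rep.

Lemma rep_refl t x (a : A) : T t -> Q x -> ev (t, x) a = ev (t, x) a. Proof. by []. Qed.
#[local] Hint Resolve rep_refl : rep.
(** An identity valid at all times in T and all points of Q becomes an identity in the ring, where
    it may be differentiated in space and time. *)
Lemma pointwise (F F' : R -> 'rV[R]_m -> R) (a b : A) :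
  (forall t x, T t -> Q x -> F t x = F' t x) ->
  (forall t x, T t -> Q x -> F t x = ev (t, x) a) ->
  (forall t x, T t -> Q x -> F' t x = ev (t, x) b) -> a = b.
Proof. by move=> FF' Fa Fb; apply: smf_eq => t x Tt Qx; rewrite -Fa // FF' // Fb. Qed.
Ltac reps := intros; cbv beta; rep.

(** * The geometric hypotheses as identities in the ring *)

Lemma gA_sym i j : gA i j = gA j i.
Proof. by apply: (pointwise (fun t x Tt Qx => metric_sym Tt Qx i j)); reps. Qed.
Lemma hA_sym i j : hA i j = hA j i.
Proof. by apply: (pointwise (fun t x Tt Qx => ginv_sym Tt Qx i j)); reps. Qed.
Lemma contract_hgA X i : \sum_a \sum_b hA i a * gA a b * X b = X i.
Proof.
by apply: (pointwise (fun t x Tt Qx => contract_hg Tt Qx (fun b => ev (t, x) (X b)) i)); reps.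
Qed.
Lemma contract_ghA X i : \sum_a \sum_b gA i a * hA a b * X b = X i.
Proof.
by apply: (pointwise (fun t x Tt Qx => contract_gh Tt Qx (fun b => ev (t, x) (X b)) i)); reps.
Qed.
Lemma contract_JJA X i : \sum_a \sum_b JA i a * JA a b * X b = - X i.
Proof.
by apply: (pointwise (fun t x Tt Qx => contract_JJ Tt Qx (fun b => ev (t, x) (X b)) i)); reps.
Qed.
Lemma contract_JJtA X i : \sum_a \sum_b JA a b * JA b i * X a = - X i.
Proof.
by apply: (pointwise (fun t x Tt Qx => contract_JJt Tt Qx (fun b => ev (t, x) (X b)) i)); reps.
Qed.
Lemma J_isometryA i j : \sum_a \sum_b JA i a * JA j b * gA a b = gA i j.
Proof. by apply: (pointwise (fun t x Tt Qx => J_isometry Tt Qx i j)); reps. Qed.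
Local Notation dgA := (fun i j k => der (Some i) (gA j k)).
Local Notation dJA := (fun i j k => der (Some i) (JA j k)).
Lemma dgA_sym i j k : dgA i j k = dgA i k j.
Proof. by rewrite /= gA_sym. Qed.
Lemma rep_dwA t x i j k : T t -> Q x -> dkf (fun i j => g t c i j x) (fun i j => J t c i j x)
  (fun i j k => pd i (g t c j k) x) (fun i j k => pd i (J t c j k) x) i j k
  = ev (t, x) (dkf gA JA dgA dJA i j k).
Proof. by move=> Tt Qx; rewrite /dkf; rep. Qed.
Lemma rep_tA t x i j k : T t -> Q x -> tor (fun i j k => U t c i j k x) i j k
  = ev (t, x) (tor UA i j k).
Proof. by move=> Tt Qx; rewrite /tor; rep. Qed.
#[local] Hint Resolve rep_dwA rep_tA : rep.
Lemma rep_wA t x i j : T t -> Q x ->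
  kf (fun i j => g t c i j x) (fun i j => J t c i j x) i j = ev (t, x) (kf gA JA i j).
Proof. by move=> Tt Qx; rewrite /kf; rep. Qed.
#[local] Hint Resolve rep_wA : rep.

Lemma chern_wA i j k : dkf gA JA dgA dJA i j k =
  \sum_a UA i j a * kf gA JA a k + \sum_a UA i k a * kf gA JA j a.
Proof. by apply: (pointwise (fun t x Tt Qx => chern_w Tt Qx i j k)); reps. Qed.
Lemma chern_JA i j k : dJA i j k = \sum_a UA i j a * JA a k - \sum_a UA i a k * JA j a.
Proof. by apply: (pointwise (fun t x Tt Qx => chern_J Tt Qx i j k)); reps. Qed.
Lemma chern_tA i j k : tor UA i j k = - \sum_a \sum_b JA i a * JA j b * tor UA a b k.
Proof. by apply: (pointwise (fun t x Tt Qx => chern_t Tt Qx i j k)); reps. Qed.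
Lemma rep_0 t x : T t -> Q x -> 0 = ev (t, x) (0 : A). Proof. by rewrite ev0. Qed.
#[local] Hint Resolve rep_0 : rep.
Lemma kform_closedA i j k : dkf gA JA dgA dJA i j k + dkf gA JA dgA dJA j k i
  + dkf gA JA dgA dJA k i j = 0.
Proof. by apply: (pointwise (fun t x Tt Qx => kform_closed Tt Qx i j k)); reps. Qed.
Lemma levi_symA i j k : GA i j k = GA j i k.
Proof. by apply: (pointwise (fun t x Tt Qx => levi_sym Tt Qx i j k)); reps. Qed.
Lemma levi_metricA i j k : dgA i j k = \sum_a GA i j a * gA a k + \sum_a GA i k a * gA j a.
Proof. by apply: (pointwise (fun t x Tt Qx => levi_metric Tt Qx i j k)); reps. Qed.

Definition JgA := complex_skew gA_sym contract_JJA J_isometryA.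
Definition hJA := complex_skew_inv gA_sym hA_sym contract_hgA contract_JJA J_isometryA.
Definition chern_gA := chern_metric gA_sym contract_JJA dgA_sym chern_wA chern_JA.
Definition T12A := ltor_J12 gA_sym contract_JJA J_isometryA chern_tA.
Definition T23A := ltor_J23 A_two_reg gA_sym contract_JJA J_isometryA chern_wA chern_tA
  kform_closedA.
Definition TcycA := ltor_cyclic A_two_reg gA_sym contract_JJA J_isometryA chern_wA chern_tA
  kform_closedA.
Definition GUA := levi_chern A_two_reg gA_sym hA_sym contract_hgA contract_JJA dgA_sym J_isometryA
  chern_wA chern_JA chern_tA kform_closedA levi_symA levi_metricA.
Definition DJEA := covJ_ltor A_two_reg gA_sym hA_sym contract_hgA contract_JJA dgA_sym J_isometryA
  chern_wA chern_JA chern_tA kform_closedA levi_symA levi_metricA.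

(** * The tensors of the statement as ring elements *)

Lemma rep_curvature t x a b d k : T t -> Q x ->
  curvature (U t c) a b d k x = ev (t, x) (Om der UA a b d k).
Proof. by move=> Tt Qx; rewrite curvatureE /Om; rep. Qed.

Lemma rep_riemann t x a b d k : T t -> Q x ->
  curvature (G t c) a b d k x = ev (t, x) (RG der GA a b d k).
Proof. by move=> Tt Qx; rewrite curvatureE /RG; rep. Qed.
#[local] Hint Resolve rep_curvature rep_riemann : rep.

Lemma rep_torsion t x i j k : T t -> Q x ->
  torsion (U t c) i j k x = ev (t, x) (tor UA i j k).
Proof. by move=> Tt Qx; rewrite /torsion /tor; rep. Qed.
#[local] Hint Resolve rep_torsion : rep.

Lemma rep_T t x i j k : T t -> Q x ->
  torsion_low (g t c) (U t c) i j k x = ev (t, x) (ltor gA UA i j k).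
Proof. by move=> Tt Qx; rewrite /torsion_low /ltor; rep. Qed.
#[local] Hint Resolve rep_T : rep.

Lemma rep_N t x a i j k : T t -> Q x ->
  cov_form3 (U t c) (torsion_low (g t c) (U t c)) a i j k x = ev (t, x) (nabT der gA UA a i j k).
Proof. by move=> Tt Qx; rewrite /cov_form3 /nabT; rep. Qed.

Lemma rep_OL t x a b d k : T t -> Q x ->
  curvature_low (g t c) (U t c) a b d k x = ev (t, x) (OmL der gA UA a b d k).
Proof. by move=> Tt Qx; rewrite /curvature_low /OmL; rep. Qed.

Lemma rep_winv t x i j : T t -> Q x ->
  kform_inv (g t c) (J t c) i j x = ev (t, x) (\sum_s JA s i * hA j s).
Proof. by move=> Tt Qx; rewrite /kform_inv; rep. Qed.
#[local] Hint Resolve rep_N rep_OL rep_winv : rep.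

Local Notation PA := (Pd der gA hA JA UA).
Lemma rep_P t x a b : T t -> Q x ->
  chern_P (g t c) (J t c) (U t c) a b x = ev (t, x) (PA a b).
Proof. by move=> Tt Qx; rewrite /chern_P /Pd; rep. Qed.

Lemma rep_Rc t x a b : T t -> Q x -> ricci (G t c) a b x = ev (t, x) (Rc der GA a b).
Proof. by move=> Tt Qx; rewrite /ricci /Rc; rep. Qed.
#[local] Hint Resolve rep_P rep_Rc : rep.

Lemma rep_anti (X : 'I_m -> 'I_m -> 'rV[R]_m -> R) (XA : 'I_m -> 'I_m -> A) t x i j :
  (forall i j, X i j x = ev (t, x) (XA i j)) -> T t -> Q x ->
  anti_inv (J t c) X i j x = ev (t, x) (anti JA hf XA i j).
Proof. by move=> XE Tt Qx; rewrite /anti_inv /anti /aop; rep. Qed.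
#[local] Hint Resolve rep_anti : rep.

Lemma rep_DJ t x i j k : T t -> Q x ->
  cov_end (G t c) (J t c) i j k x = ev (t, x) (DJA GA i j k).
Proof. by move=> Tt Qx; rewrite /cov_end /levi_J; rep. Qed.
#[local] Hint Resolve rep_DJ : rep.

Lemma rep_B t x i j : T t -> Q x ->
  tensorB (g t c) (J t c) (G t c) i j x = ev (t, x) (B der gA hA JA GA hf qf i j).
Proof.
by move=> Tt Qx; rewrite /tensorB /tensorB1 /tensorB2 /B /B1 /B2; rep.
Qed.
#[local] Hint Resolve rep_B : rep.

Lemma rep_fT t x : T t -> Q x ->
  sqnorm3 (g t c) (torsion_low (g t c) (U t c)) x = ev (t, x) (sqtor gA hA UA).
Proof. by move=> Tt Qx; rewrite /sqnorm3 /sqtor; rep. Qed.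
#[local] Hint Resolve rep_fT : rep.

Lemma rep_lap (f : 'rV[R]_m -> R) (a : A) t x : (forall y, Q y -> f y = ev (t, y) a) ->
  T t -> Q x -> laplacian (g t c) (U t c) f x = ev (t, x) (lap der hA UA a).
Proof. by move=> fa Tt Qx; rewrite /laplacian /cov_form1 /cov_fun /lap; rep. Qed.

Lemma rep_sqB t x : T t -> Q x -> sqnorm2 (g t c) (tensorB (g t c) (J t c) (G t c)) x
  = ev (t, x) (sqnormB der gA hA JA GA hf qf).
Proof. by move=> Tt Qx; rewrite /sqnorm2 /sqnormB; rep. Qed.

Lemma rep_sqN t x : T t -> Q x ->
  sqnorm4 (g t c) (cov_form3 (U t c) (torsion_low (g t c) (U t c))) x
  = ev (t, x) (sqnorm_nabT der gA hA UA).
Proof. by move=> Tt Qx; rewrite /sqnorm4 /sqnorm_nabT; rep. Qed.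
#[local] Hint Resolve rep_sqB rep_sqN : rep.

Lemma flow_w i j : der None (\sum_a JA i a * gA j a) = - PA i j.
Proof.
apply: smf_eq => t x Tt Qx; case: flow => _ _ _ H _.
rewrite -(@ev_dt _ _ _ _ _ _ (fun s => kform (g s c) (J s c) i j x)) //;
  last by move=> s Ts; exact: rep_w.
by rewrite (H t c i j x Tt Qx); rep.
Qed.

Lemma flow_J i k : der None (JA i k) = - \sum_w (anti JA hf PA i w
  - 2 * \sum_e JA i e * anti JA hf (Rc der GA) e w) * hA w k.
Proof.
apply: smf_eq => t x Tt Qx; case: flow => _ _ _ _ H.
rewrite -(@ev_dt _ _ _ _ _ _ (fun s => J s c i k x)) //; last by move=> s Ts; exact: rep_J.
by rewrite (H t c i k x Tt Qx); rep; apply: rep_anti.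
Qed.

Lemma hfE : 2 * hf = 1 :> A.
Proof.
by apply: smf_eq => t x Tt Qx; rewrite evM -rep_hf // -rep_nat // ev1 // mulfV // pnatr_eq0.
Qed.
Lemma qfE : 4 * qf = 1 :> A.
Proof.
by apply: smf_eq => t x Tt Qx; rewrite evM -rep_qf // -rep_nat // ev1 // mulfV // pnatr_eq0.
Qed.

Definition heatA := heat_main derD derM derC A_two_reg gA_sym hA_sym contract_hgA contract_ghA
  contract_JJA contract_JJtA JgA chern_gA chern_JA T12A T23A TcycA hJA GUA hfE flow_w flow_J DJEA
  qfE.
Definition heatA4 := heat_main4 derD derM derC A_two_reg gA_sym hA_sym contract_hgA contract_ghA
  contract_JJA contract_JJtA JgA chern_gA chern_JA T12A T23A TcycA hJA GUA hfE flow_w flow_J.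

Let sqtau t := sqnorm3 (g t c) (torsion_low (g t c) (U t c)).

Lemma rep_heat t x : T t -> Q x ->
  derive1 (fun s => sqtau s x) t - laplacian (g t c) (U t c) (sqtau t) x
  = ev (t, x) (der None (sqtor gA hA UA) - lap der hA UA (sqtor gA hA UA)).
Proof.
move=> Tt Qx; rewrite evD evN -(@rep_lap (sqtau t)) //; last by move=> y Qy; exact: rep_fT.
by congr (_ - _); apply: ev_dt => // s Ts; exact: rep_fT.
Qed.

Lemma heat_equation t x : T t -> Q x ->
  derive1 (fun s => sqtau s x) t - laplacian (g t c) (U t c) (sqtau t) x
  = sqnorm2 (g t c) (tensorB (g t c) (J t c) (G t c)) x
    - 2 * sqnorm4 (g t c) (cov_form3 (U t c) (torsion_low (g t c) (U t c))) x
    - 4 * \sum_a \sum_p \sum_b \sum_q \sum_d \sum_r \sum_e \sum_k \sum_l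
           ginv (g t c) a p x * ginv (g t c) b q x * ginv (g t c) d r x
           * ginv (g t c) k l x * curvature (U t c) r p q e x
           * (torsion_low (g t c) (U t c) e d k x * torsion_low (g t c) (U t c) a b l x
              + torsion_low (g t c) (U t c) k d e x * torsion_low (g t c) (U t c) a l b x
              + torsion_low (g t c) (U t c) k e d x * torsion_low (g t c) (U t c) a l b x).
Proof. by move=> Tt Qx; rewrite rep_heat // heatA; symmetry; rewrite /curv_tor; rep. Qed.

Section Residual.
Variables (t : R) (x : 'rV[R]_m).
Hypotheses (Tt : T t) (Qx : Q x).
Local Notation h_ := (fun i j => ginv (g t c) i j x).
Local Notation T_ := (fun i j k => torsion_low (g t c) (U t c) i j k x).
Local Notation b1_ := (fun i j => \sum_a \sum_b \sum_p \sum_q h_ a b * h_ p q * T_ a p i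
  * T_ b q j).
Local Notation b2_ := (fun i j => \sum_a \sum_b \sum_p \sum_q h_ a b * h_ p q * T_ i a p
  * T_ j b q).
Local Notation dot X Y := (\sum_i \sum_j \sum_a \sum_b h_ i a * h_ j b * X i j * Y a b).

(** This form holds in every dimension; its last line is the quartic torsion defect that
    [four_dim_identity] shows to vanish in real dimension 4. *)
Lemma heat_equation_residual :
  derive1 (fun s => sqtau s x) t - laplacian (g t c) (U t c) (sqtau t) x
  = - 2 * sqnorm4 (g t c) (cov_form3 (U t c) (torsion_low (g t c) (U t c))) x
    - 4 * \sum_d \sum_r \sum_a \sum_p \sum_b \sum_q \sum_e \sum_k \sum_l
           ginv (g t c) d r x * ginv (g t c) a p x * ginv (g t c) b q x
           * ginv (g t c) k l x * curvature (U t c) r p q e x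
           * (torsion_low (g t c) (U t c) e d k x * torsion_low (g t c) (U t c) a b l x
              + 2 * (torsion_low (g t c) (U t c) k e d x * torsion_low (g t c) (U t c) a l b x))
    + (dot b1_ b1_ - 6 * dot b1_ b2_ + 4 * dot b2_ b2_).
Proof.
by rewrite rep_heat // heatA4; symmetry; rewrite /curv_tor4 /pair_raised /b1 /b2; rep.
Qed.

Lemma J_skew i j : \sum_a J t c i a x * g t c j a x = - \sum_a J t c j a x * g t c i a x.
Proof. exact: (complex_skew (metric_sym Tt Qx) (contract_JJ Tt Qx) (J_isometry Tt Qx) i j). Qed.
Lemma T_skew i j k : T_ i j k = - T_ j i k.
Proof. by rewrite /torsion_low -sumrN; apply: eq_bigr => l _; rewrite /torsion; ring. Qed.
Lemma T_J12 i j k : \sum_a J t c i a x * T_ a j k = \sum_a J t c j a x * T_ i a k.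
Proof. exact: (ltor_J12 (metric_sym Tt Qx) (contract_JJ Tt Qx) (J_isometry Tt Qx)
  (chern_t Tt Qx) i j k). Qed.
Lemma T_J23 i j k : \sum_a J t c j a x * T_ i a k = \sum_a J t c k a x * T_ i j a.
Proof.
have two_reg (a : R) : 2 * a = 0 -> a = 0 by lra.
exact: (ltor_J23 two_reg (metric_sym Tt Qx) (contract_JJ Tt Qx) (J_isometry Tt Qx)
  (chern_w Tt Qx) (chern_t Tt Qx) (kform_closed Tt Qx) i j k).
Qed.
End Residual.
End Flow.

Theorem theoremB (R : realType) (n : nat) (M : manifold R (2 * n))
    (T : set R) (g J : R -> field2 M) (U G : R -> field3 M)
    (T_open : open T) (T_interval : is_interval T)
    (U_chern : forall t, T t -> chern_connection (g t) (J t) (U t))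
    (G_levi_civita : forall t, T t -> levi_civita_connection (g t) (G t))
    (flow : symplectic_curvature_flow T g J U G) :
  let tau (t : R) (c : chart M) := torsion_low (g t c) (U t c) in
  let sqtau (t : R) (c : chart M) := sqnorm3 (g t c) (tau t c) in
  let heat (t : R) (c : chart M) (x : 'rV[R]_(2 * n)) :=
    derive1 (fun s => sqtau s c x) t - laplacian (g t c) (U t c) (sqtau t c) x in
  let sqnabla (t : R) (c : chart M) :=
    sqnorm4 (g t c) (cov_form3 (U t c) (tau t c)) in
  (forall (t : R) (c : chart M) (x : 'rV[R]_(2 * n)), T t -> chart_img c x ->
     heat t c x
     = sqnorm2 (g t c) (tensorB (g t c) (J t c) (G t c)) x
       - 2 * sqnabla t c x
       - 4 * \sum_a \sum_p \sum_b \sum_q \sum_d \sum_r \sum_e \sum_k \sum_l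
           ginv (g t c) a p x * ginv (g t c) b q x * ginv (g t c) d r x
           * ginv (g t c) k l x * curvature (U t c) r p q e x
           * (tau t c e d k x * tau t c a b l x
              + tau t c k d e x * tau t c a l b x
              + tau t c k e d x * tau t c a l b x)) /\
  (n = 2%N ->
   forall (t : R) (c : chart M) (x : 'rV[R]_(2 * n)), T t -> chart_img c x ->
     heat t c x
     = - 2 * sqnabla t c x
       - 4 * \sum_d \sum_r \sum_a \sum_p \sum_b \sum_q \sum_e \sum_k \sum_l
           ginv (g t c) d r x * ginv (g t c) a p x * ginv (g t c) b q x
           * ginv (g t c) k l x * curvature (U t c) r p q e x
           * (tau t c e d k x * tau t c a b l x
              + 2 * (tau t c k e d x * tau t c a l b x))).
Proof.
move=> tau sqtau heat sqnabla; split=> [t c x Tt Qx|n2 t c x Tt Qx].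
  exact: (heat_equation T_open U_chern G_levi_civita flow Tt Qx).
apply: etrans (heat_equation_residual T_open U_chern G_levi_civita flow Tt Qx) _.
(* For n = 2 the real dimension 2 * n computes to 4, so what is left is [four_dim_identity] up to
   conversion. *)
rewrite -[RHS]addr0; congr (_ + _); subst n.
exact: (@four_dim_identity R (fun i j => g t c i j x) (fun i j => ginv (g t c) i j x)
  (fun i j => J t c i j x) (fun i j k => tau t c i j k x) (metric_sym flow Tt Qx)
  (contract_hg flow Tt Qx) (metric_pos flow Tt Qx) (contract_JJt flow Tt Qx) (J_skew flow Tt Qx)
  (T_skew _ _ _ _ _) (T_J12 U_chern flow Tt Qx) (T_J23 T_open U_chern flow Tt Qx)).
Qed.
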